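(* Let $V=\mathrm{Ind}_B^G(\chi)$ and $M_0=B_+V^{U^{(1)}}$. Then $M_0$ is minimal in the set $\mathcal{B}_+(V)$ of generating $B_+$-subrepresentations of $V$.
   Context: Let $F,K$ be finite extensions of $\mathbb{Q}_p$ with rings of integers $o_F,o_K$ and residue fields $k_F,k_K$. $G=\mathrm{GL}_n(F)$, $G_0=\mathrm{GL}_n(o_F)$; $B$ is the group of upper triangular matrices, $T$ the diagonal matrices, $N$ the upper triangular unipotent matrices, $N_0=N\cap G_0$, $T_+=\{t\in T\mid tN_0t^{-1}\subset N_0\}$, $B_+=N_0T_+$ (a submonoid of $B$), and $U^{(1)}=\ker(G_0\to\mathrm{GL}_n(k_F))$. Let $\chi=\chi_1\otimes\dots\otimes\chi_n:T\to k_K^*$ be a locally constant character, extended to $B$ via $B\to B/[B,B]\simeq T$. The principal series representation is $V=\mathrm{Ind}_B^G(\chi)=\{f:G\to k_K \text{ locally constant}\mid f(gb)=\chi^{-1}(b)f(g)\ \forall g\in G,b\in B\}$, with $G$ acting by $(gf)(x)=f(g^{-1}x)$; it is regarded as a torsion $o_K$-module. For a torsion $o_K$-module $X$ with $o_K$-linear $B$-action, $\mathcal{B}_+(X)$ denotes the set, partially ordered by inclusion, of generating $B_+$-subrepresentations of $X$, i.e. of those $B_+$-stable $o_K$-submodules $M\subset X$ with $BM=X$ ($BM$ being the submodule generated by all $bm$). $B_+V^{U^{(1)}}$ denotes the $k_K$-span of all $bv$ with $b\in B_+$, $v\in V^{U^{(1)}}$. *)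

(* Defs.v *)
From HB Require Import structures.
From mathcomp Require Import all_boot all_order all_algebra all_field.
From mathcomp Require Import all_classical.

Set Implicit Arguments.
Unset Strict Implicit.
Unset Printing Implicit Defensive.

Import GRing.Theory.

Local Open Scope ring_scope.

(* Unit-ring structure on an arbitrary commutative ring: units are decided and
   inverted classically. *)
Section ClassicalUnits.
Variable R : comNzRingType.

Definition cunit : {pred R} := fun x => `[< exists y, y * x = 1 >].

Definition cinv (x : R) : R :=
  if pselect (exists y, y * x = 1) is left h then projT1 (cid h) else x.

Lemma cmulVx : {in cunit, left_inverse 1 cinv *%R}.
Proof.
move=> x /asboolP ux; rewrite /cinv; case: pselect => // h.
exact: (projT2 (cid h)).
Qed.

Lemma cunitPl (x y : R) : y * x = 1 -> cunit x.
Proof. by move=> yx; apply/asboolP; exists y. Qed.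

Lemma cinv_out : {in [predC cunit], cinv =1 id}.
Proof.
by move=> x /negP ux; rewrite /cinv; case: pselect => // h; case: ux; apply/asboolP.
Qed.
End ClassicalUnits.

(* Z_p is the inverse limit of the rings Z/p^m: [zcoef x m] is the
   representative in [0, p^m) of the image of [x] in Z/p^m (the range condition
   follows from the coherence condition). *)
Record Zp (p : nat) (p_pr : prime p) := MkZp {
  zcoef :> nat -> nat;
  zcoefP : `[< forall m, (zcoef m.+1 %% p ^ m = zcoef m)%N >]
}.

HB.instance Definition _ p (p_pr : prime p) := [isSub for @zcoef p p_pr].
HB.instance Definition _ p (p_pr : prime p) := [Choice of Zp p_pr by <:].

Section ZpRing.
Variables (p : nat) (p_pr : prime p).
Implicit Types x y z : Zp p_pr.

Lemma zcoefE x m : (x m.+1 %% p ^ m = x m)%N.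
Proof. by have /asboolP := zcoefP x; apply. Qed.

Lemma zcoef_mod x m : (x m %% p ^ m = x m)%N.
Proof. by rewrite -[in LHS]zcoefE modn_mod zcoefE. Qed.

Lemma zcoef_modD x m k : (x (k + m) %% p ^ m = x m)%N.
Proof.
elim: k => [|k IH]; first by rewrite add0n zcoef_mod.
rewrite -[RHS]IH -[in RHS](zcoefE x (k + m)) addSn.
by rewrite modn_dvdm // dvdn_exp2l // leq_addl.
Qed.

Lemma Zp_eqP x y : (forall m, x m = y m) -> x = y.
Proof. by move=> xy; apply/val_inj/funext. Qed.

Lemma Zp_subproof (f : nat -> nat) :
    (forall m, f m.+1 = f m %[mod p ^ m]) ->
  `[< forall m, (f m.+1 %% p ^ m.+1 %% p ^ m = f m %% p ^ m)%N >].
Proof.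
move=> fP; apply/asboolP => m; rewrite modn_dvdm ?fP //.
by rewrite dvdn_exp2l.
Qed.

Definition Zp_of f fP : Zp p_pr := MkZp p_pr (@Zp_subproof f fP).

Fact zero_subproof m : (0 = 0 %[mod p ^ m])%N. Proof. by []. Qed.
Fact one_subproof m : (1 = 1 %[mod p ^ m])%N. Proof. by []. Qed.
Fact add_subproof x y m : (x m.+1 + y m.+1 = x m + y m %[mod p ^ m])%N.
Proof. by rewrite -modnDm !zcoefE. Qed.
Fact mul_subproof x y m : (x m.+1 * y m.+1 = x m * y m %[mod p ^ m])%N.
Proof. by rewrite -modnMm !zcoefE. Qed.

Lemma pexp_gt0 m : (0 < p ^ m)%N.
Proof. by rewrite expn_gt0 prime_gt0. Qed.

Lemma zcoef_lt x m : (x m < p ^ m)%N.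
Proof. by rewrite -zcoef_mod ltn_mod pexp_gt0. Qed.

Fact opp_subproof x m : (p ^ m.+1 - x m.+1 = p ^ m - x m %[mod p ^ m])%N.
Proof.
apply/eqP; rewrite -(eqn_modDr (x m.+1)) subnK ?(ltnW (zcoef_lt _ _)) //.
rewrite -modnDmr zcoefE subnK ?(ltnW (zcoef_lt _ _)) // modnn expnS.
by rewrite modnMl.
Qed.

Definition Zp_zero : Zp p_pr := Zp_of zero_subproof.
Definition Zp_one : Zp p_pr := Zp_of one_subproof.
Definition Zp_add x y := Zp_of (add_subproof x y).
Definition Zp_mul x y := Zp_of (mul_subproof x y).
Definition Zp_opp x := Zp_of (opp_subproof x).

Fact Zp_addA : associative Zp_add.
Proof. by move=> x y z; apply: Zp_eqP => m /=; rewrite modnDml modnDmr addnA. Qed.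
Fact Zp_addC : commutative Zp_add.
Proof. by move=> x y; apply: Zp_eqP => m /=; rewrite addnC. Qed.
Fact Zp_add0 : left_id Zp_zero Zp_add.
Proof. by move=> x; apply: Zp_eqP => m /=; rewrite mod0n add0n zcoef_mod. Qed.
Fact Zp_addN : left_inverse Zp_zero Zp_opp Zp_add.
Proof.
move=> x; apply: Zp_eqP => m /=.
by rewrite modnDml subnK ?(ltnW (zcoef_lt _ _)) // modnn mod0n.
Qed.

HB.instance Definition _ :=
  GRing.isZmodule.Build (Zp p_pr) Zp_addA Zp_addC Zp_add0 Zp_addN.

Fact Zp_mulA : associative Zp_mul.
Proof. by move=> x y z; apply: Zp_eqP => m /=; rewrite modnMml modnMmr mulnA. Qed.
Fact Zp_mulC : commutative Zp_mul.
Proof. by move=> x y; apply: Zp_eqP => m /=; rewrite mulnC. Qed.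
Fact Zp_mul1 : left_id Zp_one Zp_mul.
Proof. by move=> x; apply: Zp_eqP => m /=; rewrite modnMml mul1n zcoef_mod. Qed.
Fact Zp_mulDl : left_distributive Zp_mul Zp_add.
Proof.
by move=> x y z; apply: Zp_eqP => m /=; rewrite modnMml modnDm mulnDl.
Qed.
Fact Zp_one_neq0 : Zp_one != 0.
Proof.
apply/eqP => /(congr1 (fun x : Zp p_pr => x 1%N)) /=.
by rewrite expn1 mod0n modn_small // prime_gt1.
Qed.

HB.instance Definition _ := GRing.Zmodule_isComNzRing.Build (Zp p_pr)
  Zp_mulA Zp_mulC Zp_mul1 Zp_mulDl Zp_one_neq0.
HB.instance Definition _ := GRing.ComNzRing_hasMulInverse.Build (Zp p_pr)
  (@cmulVx _) (@cunitPl _) (@cinv_out _).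

Lemma Zp_neq0 x : x != 0 -> exists m, x m != 0%N.
Proof.
move=> x0; apply/not_existsP => h; case/eqP: x0; apply: Zp_eqP => m /=.
by rewrite mod0n; have /negP := h m; rewrite negbK => /eqP.
Qed.

Lemma logn_zcoef x a k : x a != 0%N -> (logn p (x (k + a)) < a)%N.
Proof.
move=> xa; have := zcoef_modD x a k; move: (x (k + a)) => w wa.
have w0 : (0 < w)%N by rewrite lt0n; apply: contra xa => /eqP w0; rewrite -wa w0 mod0n.
rewrite ltnNge; apply: contra xa => le_a; rewrite -wa.
by rewrite -[_ == _]/(p ^ a %| w)%N pfactor_dvdn.
Qed.

Fact Zp_integral : GRing.integral_domain_axiom (Zp p_pr).
Proof.
move=> x y xy0; apply/norP => -[/Zp_neq0[a xa] /Zp_neq0[b yb]].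
have := congr1 (fun z : Zp p_pr => z (a + b)%N) xy0; rewrite /= mod0n.
have lx := @logn_zcoef x a b xa; rewrite addnC in lx.
have ly := @logn_zcoef y b a yb.
have pos (z : Zp p_pr) i k : z i != 0%N -> (0 < z (k + i))%N.
  move=> zi; rewrite lt0n; apply: contra zi => /eqP w0.
  by rewrite -(zcoef_modD z i k) w0 mod0n.
have px := pos x a b xa; rewrite addnC in px.
have py := pos y b a yb.
move/eqP; rewrite -[_ == _]/(p ^ (a + b) %| _)%N pfactor_dvdn ?muln_gt0 ?px //.
by rewrite lognM // leqNgt -addSn leq_add // ltnW.
Qed.

HB.instance Definition _ :=
  GRing.ComUnitRing_isIntegral.Build (Zp p_pr) Zp_integral.

Definition Qp := {fraction Zp p_pr}.
HB.instance Definition _ := GRing.Field.on Qp.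
End ZpRing.

(* The ring of integers of a finite extension F of Q_p: the integral closure of
   Z_p in F. *)
Section Integers.
Variables (p : nat) (p_pr : prime p) (F : fieldExtType (Qp p_pr)).

Definition Zp_in : Zp p_pr -> F := in_alg F \o @tofrac (Zp p_pr).
HB.instance Definition _ := GRing.RMorphism.on Zp_in.

Definition isInteger : {pred F} := fun x => `[< integralOver Zp_in x >].

Fact isInteger_subring : subring_closed isInteger.
Proof.
split=> [|x y /asboolP ix /asboolP iy|x y /asboolP ix /asboolP iy];
  apply/asboolP.
- exact: integral1.
- exact: integral_sub.
- exact: integral_mul.
Qed.
HB.instance Definition _ := GRing.isSubringClosed.Build F isInteger
  isInteger_subring.

Record integers := MkInteger { oval :> F; ovalP : oval \in isInteger }.

HB.instance Definition _ := [isSub for oval].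
HB.instance Definition _ := [Choice of integers by <:].
HB.instance Definition _ := [SubChoice_isSubComNzRing of integers by <:].
HB.instance Definition _ := GRing.RMorphism.copy oval (val : integers -> F).
HB.instance Definition _ := GRing.ComNzRing_hasMulInverse.Build integers
  (@cmulVx _) (@cunitPl _) (@cinv_out _).

(* y \in p^m o_F; these sets are a base of neighbourhoods of 0 in F. *)
Definition in_pO (m : nat) (y : F) : Prop :=
  exists z : integers, y = p%:R ^+ m * oval z.

End Integers.

(* A residue field of O: a field that is a quotient of O. If O is local, as
   rings of integers of p-adic fields are, it is the quotient by the unique
   maximal ideal. *)
Record residueField (O : comNzRingType) := ResidueField {
  residue_sort :> fieldType;
  residue : {rmorphism O -> residue_sort};
  residue_surj : forall y, exists x, residue x = y
}.

Record GLn (R : comUnitRingType) (n : nat) := MkGL {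
  glmx :> 'M[R]_n;
  glmxP : glmx \in unitmx
}.

Section GLGroup.
Variables (R : comUnitRingType) (n : nat).

HB.instance Definition _ := [isSub for @glmx R n].
HB.instance Definition _ := [Choice of GLn R n by <:].

Fact GL_one_subproof : (1%:M : 'M[R]_n) \in unitmx.
Proof. exact: unitmx1. Qed.
Fact GL_mul_subproof (g h : GLn R n) : glmx g *m glmx h \in unitmx.
Proof. by rewrite unitmx_mul !glmxP. Qed.
Fact GL_inv_subproof (g : GLn R n) : invmx (glmx g) \in unitmx.
Proof. by rewrite unitmx_inv glmxP. Qed.

Definition GL_one : GLn R n := MkGL GL_one_subproof.
Definition GL_mul g h : GLn R n := MkGL (GL_mul_subproof g h).
Definition GL_inv g : GLn R n := MkGL (GL_inv_subproof g).

Fact GL_mulA : associative GL_mul.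
Proof. by move=> g h k; apply/val_inj/mulmxA. Qed.
Fact GL_mul1 : left_id GL_one GL_mul.
Proof. by move=> g; apply/val_inj/mul1mx. Qed.
Fact GL_mulr1 : right_id GL_one GL_mul.
Proof. by move=> g; apply/val_inj/mulmx1. Qed.
Fact GL_mulV : left_inverse GL_one GL_inv GL_mul.
Proof. by move=> g; apply/val_inj/mulVmx/glmxP. Qed.
Fact GL_mulrV : right_inverse GL_one GL_inv GL_mul.
Proof. by move=> g; apply/val_inj/mulmxV/glmxP. Qed.

HB.instance Definition _ :=
  isGroup.Build (GLn R n) GL_mulA GL_mul1 GL_mulr1 GL_mulV GL_mulrV.
End GLGroup.

Local Open Scope classical_set_scope.

Definition minimal_in (T : Type) (E : set (set T)) (M : set T) : Prop :=
  E M /\ forall M', E M' -> M' `<=` M -> M' = M.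

Section Modules.
Variables (R : pzRingType) (X : lmodType R).

Definition submodule (M : set X) : Prop := submod_closed [pred x in M].

Definition mspan (S : set X) : set X := smallest submodule S.

Variables (G : groupType) (act : G -> X -> X).

Definition translates (H : set G) (S : set X) : set X :=
  [set x | exists h v, [/\ H h, S v & x = act h v]].

Definition fixedpoints (H : set G) : set X :=
  [set v | forall h, H h -> act h v = v].

Definition generating_subreps (B Bplus : set G) : set (set X) :=
  [set M | [/\ submodule M,
               translates Bplus M `<=` M &
               mspan (translates B M) = setT]].
End Modules.

(* An S-module seen as an R-module through a ring morphism R -> S. *)
Definition restrict_scalars (R S : pzRingType) (phi : {rmorphism R -> S})
  (X : lmodType S) : Type := X.

Section RestrictScalars.
Variables (R S : pzRingType) (phi : {rmorphism R -> S}) (X : lmodType S).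
Local Notation Y := (restrict_scalars phi X).

HB.instance Definition _ := GRing.Zmodule.on Y.

Definition restrict_scale (a : R) (v : Y) : Y := phi a *: (v : X).

Fact restrict_scaleA a b v :
  restrict_scale a (restrict_scale b v) = restrict_scale (a * b) v.
Proof. by rewrite /restrict_scale scalerA rmorphM. Qed.
Fact restrict_scale1 : left_id 1 restrict_scale.
Proof. by move=> v; rewrite /restrict_scale rmorph1 scale1r. Qed.
Fact restrict_scaleDr : right_distributive restrict_scale +%R.
Proof. by move=> a u v; exact: scalerDr. Qed.
Fact restrict_scaleDl v : {morph restrict_scale^~ v : a b / a + b}.
Proof. by move=> a b; rewrite /restrict_scale rmorphD; exact: scalerDl. Qed.

HB.instance Definition _ := GRing.Zmodule_isLmodule.Build R Y
  restrict_scaleA restrict_scale1 restrict_scaleDr restrict_scaleDl.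
End RestrictScalars.

Section Subgroups.
Variables (p : nat) (p_pr : prime p) (F : fieldExtType (Qp p_pr)) (n : nat).
Local Notation G := (GLn F n).

Definition upper : set G :=
  [set g | forall i j : 'I_n, (j < i)%N -> g i j = 0].

Definition torus : set G :=
  [set g | forall i j : 'I_n, i != j -> g i j = 0].

Definition unipotent : set G :=
  [set g | upper g /\ forall i, g i i = 1].

Definition GL_integers : set G :=
  [set g | exists2 a : 'M[integers F]_n,
     a \in unitmx & g = map_mx (@oval _ _ F) a :> 'M_n].

Definition unipotent0 : set G := unipotent `&` GL_integers.

Definition torus_plus : set G :=
  [set t | torus t /\
     forall u, unipotent0 u -> unipotent0 (t * u * t^-1)%g].

Definition upper_plus : set G :=
  [set b | exists u t, [/\ unipotent0 u, torus_plus t & b = (u * t)%g]].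

Definition principal_congruence (kF : residueField (integers F)) : set G :=
  [set g | exists a : 'M[integers F]_n,
     [/\ a \in unitmx, g = map_mx (@oval _ _ F) a :> 'M_n &
         map_mx (residue kF) a = 1%:M]].

(* The sets x (1 + p^m M_n(o_F)) are a base of neighbourhoods of x in GL_n(F). *)
Definition locally_constant (A : Type) (f : G -> A) : Prop :=
  forall x, exists m, forall u : G,
    (forall i j, in_pO m ((glmx u - 1%:M) i j)) -> f (x * u)%g = f x.
End Subgroups.

Arguments upper {p p_pr} F n.
Arguments upper_plus {p p_pr} F n.
Arguments principal_congruence {p p_pr F} n kF.

(* Locally constant characters F^* -> k^*; the value at 0 is irrelevant. *)
Record smoothChar (p : nat) (p_pr : prime p) (F : fieldExtType (Qp p_pr))
    (k : fieldType) := SmoothChar {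
  schar :> F -> k;
  schar_neq0 : forall x, x != 0 -> schar x != 0;
  scharM : forall x y, x != 0 -> y != 0 -> schar (x * y) = schar x * schar y;
  schar_lc : forall x, x != 0 -> exists m, forall y, y != 0 ->
    in_pO m (y - x) -> schar y = schar x
}.

Section PrincipalSeries.
Variables (p : nat) (p_pr : prime p) (F : fieldExtType (Qp p_pr)).
Variables (k : fieldType) (n : nat) (chi : 'I_n -> smoothChar F k).
Local Notation G := (GLn F n).

(* chi_1 (x) ... (x) chi_n, extended from T to B through the diagonal. *)
Definition borel_char (b : G) : k := \prod_i chi i (b i i).

Definition inInd : {pred G -> k^o} := fun f =>
  `[< locally_constant f /\
      forall g b, upper F n b -> f (g * b)%g = (borel_char b)^-1 * f g >].

Fact inInd_submod : submod_closed inInd.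
Proof.
split=> [|a f h /asboolP[lf ef] /asboolP[lh eh]]; apply/asboolP; split.
- by move=> x; exists 0%N.
- by move=> g b _; rewrite mulr0.
- move=> x; have [m1 e1] := lf x; have [m2 e2] := lh x.
  have le_pO i j y : (i <= j)%N -> in_pO (F := F) j y -> in_pO i y.
    move=> ij [z ->]; exists (p%:R ^+ (j - i) * z).
    by rewrite rmorphM rmorphXn rmorph_nat mulrA -exprD subnKC.
  exists (maxn m1 m2) => u uP; rewrite [LHS]/(a * f _ + h _) e1 ?e2 // => i j.
  + by apply: le_pO (uP i j); rewrite leq_maxr.
  + by apply: le_pO (uP i j); rewrite leq_maxl.
- move=> g b ub; rewrite [LHS]/(a * f _ + h _) ef // eh //.
  by rewrite mulrCA; apply/esym; exact: (@mulrDr k).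
Qed.
HB.instance Definition _ := GRing.isSubmodClosed.Build k _ inInd inInd_submod.

Record Ind := MkInd { indfun :> G -> k^o; indfunP : indfun \in inInd }.

HB.instance Definition _ := [isSub for indfun].
HB.instance Definition _ := [Choice of Ind by <:].
HB.instance Definition _ := [SubChoice_isSubLmodule of Ind by <:].

Fact Ind_act_subproof (g : G) (f : Ind) :
  (fun x : G => f (g^-1 * x)%g : k^o) \in inInd.
Proof.
have /asboolP[lf ef] := indfunP f; apply/asboolP; split.
- move=> x; have [m e] := lf (g^-1 * x)%g; exists m => u uP.
  by rewrite mulgA e.
- by move=> x b ub; rewrite mulgA ef.
Qed.

Definition Ind_act (g : G) (f : Ind) : Ind := MkInd (Ind_act_subproof g f).
End PrincipalSeries.

Arguments Ind_act {p p_pr F k n} chi g f.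

(* Main.v *)
Require Import Defs.
From mathcomp Require Import all_boot all_order all_algebra all_field.
From mathcomp Require Import all_classical.
From mathcomp Require Import perm zify ring.
From mathcomp Require cyclic.

Set Implicit Arguments.
Unset Strict Implicit.
Unset Printing Implicit Defensive.

Import Order.TTheory GRing.Theory Num.Theory.

Local Open Scope classical_set_scope.
Local Open Scope ring_scope.
Local Notation Zp := Defs.Zp.

(** Write U1 for the principal congruence subgroup and e for the function supported on U1 B with
    e(1) = 1; the translates x e, x in GL_n(O), span V^U1.

    Generation: since G = B GL_n(O), the B-span of V^U1 is its G-span, and for t contracting the
    lower unipotent group the supports of the translates of t e are arbitrarily small.

    Minimality: let M be a generating B_+-submodule. As V = B M, every v in V satisfies t v in M
    for all sufficiently contracting t, so t V^U1 is contained in M for some such t, which is a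
    product of elements s = diag(pi, .., pi, 1, .., 1). It remains to show that
    t s V^U1 <= M implies t V^U1 <= M. Let P be the parabolic subgroup attached to s and let w be a
    permutation. The function supported on N_P(o) U1 w B lies in V^U1; s carries it to a multiple
    of the function supported on N_P^-(o) U1 w B, which also lies in V^U1 and is the sum of w e and
    of multiples of functions y e for which the flag of y mod pi is in more general position than
    that of w. One concludes by induction on this position, measured by ranks of submatrices,
    using the decomposition GL_n(F) = I W B for the pro-p Iwahori subgroup I.

    The required facts on p-adic fields come from compactness: the norm is bounded away from 0 on
    primitive vectors of a lattice, so an element has integral norm exactly when its powers
    stay in a lattice; hence O is a discrete valuation ring, open and compact. *)

(** * p-adic integers and ultrafilter limits *)

(** Two facts shape the argument. The coefficients have characteristic p, which makes every [chi i]
    trivial on 1 + pi O; hence e, and the functions on the larger double cosets, are well defined.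
    The obstacle is that functions in s V^U1 are invariant under s U1 s^-1, which contains N_P^-(o),
    while x e in general is not: from t s V^U1 <= M one only reaches functions on larger cells, and
    the translate w e has to be isolated by subtracting what lies in more general position. Only
    permutations need this treatment. For x = l w b, the factor l is a product of an element of N_0,
    which moves across t because M is N_0-stable and t N_0 t^-1 <= N_0, and an element of U1, which
    fixes w e. Compactness takes the form of limits along one free ultrafilter on the natural
    numbers, so that finitely many sequences converge at once. *)

Definition free_ultrafilter (U : set_system nat) : Prop :=
  UltraFilter U /\ \oo `<=` U.

Lemma free_ultrafilter_exists : exists U, free_ultrafilter U.
Proof. exact: ultraFilterLemma eventually_filter. Qed.

Lemma free_ultrafilter_inf U (P : nat -> Prop) N :
  free_ultrafilter U -> U [set j | P j] -> exists2 j, (N <= j)%N & P j.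
Proof.
move=> [UU sU] UP; have UN : U [set j | (N <= j)%N].
  by apply: sU; exists N.
by have [j [? ?]] := filter_ex (filterI UN UP); exists j.
Qed.

(** Otherwise the complements of the finitely many fibres of f would all be large, and so would
    their empty intersection. *)
Lemma free_ultrafilter_fin U (T : finType) (f : nat -> T) :
  free_ultrafilter U -> exists t, U [set j | f j = t].
Proof.
move=> [UU sU]; apply: contrapT => /forallNP h.
have : U (fun j => forall t, f j <> t).
  apply: filter_forall => t; have [/h//|] := in_ultra_setVsetC [set j | f j = t] UU.
  by apply: filterS.
by move=> /filter_ex [j /(_ (f j))].
Qed.

Section ZpTheory.
Variables (p : nat) (p_pr : prime p).
Implicit Types x y z : Zp p_pr.

Lemma zcoefM x y m : (x * y) m = (x m * y m %% p ^ m)%N. Proof. by []. Qed.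
Lemma zcoefD x y m : (x + y) m = ((x m + y m) %% p ^ m)%N. Proof. by []. Qed.

Lemma zcoef_nat k m : (k%:R : Zp p_pr) m = (k %% p ^ m)%N.
Proof.
elim: k => [|k IH]; first by rewrite /= !mod0n.
by rewrite -natr1 zcoefD IH /= modnDm addn1.
Qed.

(** Each coefficient takes finitely many values, hence is constant on a large set; the coherence of
    these constants is read off at an index that serves two consecutive levels. *)
Lemma Zp_limit U (x : nat -> Zp p_pr) : free_ultrafilter U ->
  exists z, forall m, U [set j | x j m = z m].
Proof.
move=> FU; have [UU sU] := FU.
have lim m : exists a : nat, (a < p ^ m)%N /\ U [set j | x j m = a].
  have xlt j : (x j m < p ^ m)%N by exact: zcoef_lt.
  have [a aP] := free_ultrafilter_fin (fun j => Ordinal (xlt j)) FU.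
  by exists a; split=> //; apply: filterS aP => j /= <-.
have [a /all_and2[alt aP]] := choice lim.
have aE m : (a m.+1 = a m %[mod p ^ m])%N.
  have [j [/= e1 e2]] := filter_ex (filterI (aP m) (aP m.+1)).
  by rewrite -e1 -e2 zcoefE zcoef_mod.
exists (Zp_of p_pr aE) => m; apply: filterS (aP m) => j /= ->.
by rewrite modn_small.
Qed.

Definition eqZp m x y := x m = y m.

Lemma eqZpD m x x' y y' : eqZp m x x' -> eqZp m y y' -> eqZp m (x + y) (x' + y').
Proof. by rewrite /eqZp !zcoefD => -> ->. Qed.
Lemma eqZpM m x x' y y' : eqZp m x x' -> eqZp m y y' -> eqZp m (x * y) (x' * y').
Proof. by rewrite /eqZp !zcoefM => -> ->. Qed.

Lemma eqZp_det m d (A B : 'M[Zp p_pr]_d) :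
  (forall i j, eqZp m (A i j) (B i j)) -> eqZp m (\det A) (\det B).
Proof.
move=> AB; rewrite /determinant; apply: (big_ind2 (eqZp m)) => //.
  by move=> *; apply: eqZpD.
move=> s _; apply: eqZpM => //; apply: (big_ind2 (eqZp m)) => //.
by move=> *; apply: eqZpM.
Qed.

Lemma Zp_div m x : x m = 0%N -> exists y, x = p%:R ^+ m * y.
Proof.
move=> xm; have dvd k : (p ^ m %| x (m + k)%N)%N by rewrite addnC /dvdn zcoef_modD xm.
have fP i : (x (m + i.+1) %/ p ^ m = x (m + i) %/ p ^ m %[mod p ^ i])%N.
  apply/eqP; rewrite -(eqn_pmul2r (pexp_gt0 p_pr m)) !muln_modl -expnD.
  by rewrite !divnK // addnS [(i + m)%N]addnC zcoefE zcoef_mod.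
exists (Zp_of p_pr fP); apply: Zp_eqP => k.
rewrite zcoefM -natrX zcoef_nat modnMml /=.
rewrite muln_modr -expnD -(modn_dvdm _ (dvdn_exp2l p (leq_addl m k))) modn_mod.
rewrite mulnC divnK // modn_dvdm ?dvdn_exp2l ?leq_addl //.
by rewrite -(zcoef_modD x k m).
Qed.

(** By Euler's theorem the power of x with exponent [(totient (p ^ m)).-1] inverts x modulo p^m; the
    inverse is an ultrafilter limit of these powers. *)
Lemma Zp_unitP x : x 1%N != 0%N -> exists y, x * y = 1.
Proof.
move=> x1; have [U FU] := free_ultrafilter_exists; have [UU _] := FU.
pose y m := x ^+ (totient (p ^ m)).-1.
have cop j : (0 < j)%N -> coprime (x j) (p ^ j).
  case: j => // j _; rewrite coprimeXr // coprime_sym prime_coprime //.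
  apply: contra x1 => /dvdnP[k e].
  by rewrite -(zcoef_modD x 1 j) addn1 e expn1 modnMl.
have zX k j : (x ^+ k) j = (x j ^ k %% p ^ j)%N.
  by elim: k => [//|k IH]; rewrite exprS zcoefM IH modnMmr expnS.
have yP m j : (m <= j)%N -> (0 < j)%N -> (x * y j) m = (1 : Zp p_pr) m.
  move=> mj j0; suff e : (x * y j) j = (1 : Zp p_pr) j.
    by rewrite -[LHS](zcoef_modD _ m (j - m)) -[RHS](zcoef_modD _ m (j - m)) subnK ?e.
  rewrite /y -exprS prednK ?totient_gt0 ?pexp_gt0 //.
  by rewrite zX cyclic.Euler_exp_totient ?cop.
have [z zP] := Zp_limit y FU; exists z; apply: Zp_eqP => m.
have [j j0 e] := free_ultrafilter_inf (m.+1) FU (zP m).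
by rewrite zcoefM -e -zcoefM yP // ?(leq_trans _ j0) // ltnW.
Qed.

Lemma Zp_decomp x : x != 0 -> exists m u u', u * u' = 1 /\ x = p%:R ^+ m * u.
Proof.
move=> x0; have ex : exists m, x m != 0%N by exact: Zp_neq0.
case: (ex_minnP ex) => -[|m] xm min.
  by move: xm; rewrite -(zcoef_mod x 0) expn0 modn1.
have xm0 : x m = 0%N.
  by apply/eqP/negPn/negP => /min; rewrite ltnn.
have [u xu] := Zp_div xm0; exists m, u.
have [|u' uu'] := @Zp_unitP u; last by exists u'.
apply: contra xm => /eqP u1; have [u2 u2E] := @Zp_div 1 u u1.
rewrite xu u2E mulrA -exprSr zcoefM -natrX zcoef_nat modnn.
by rewrite mul0n mod0n.
Qed.

End ZpTheory.

Lemma fraction_numden (R : idomainType) (q : {fraction R}) :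
  exists x y, y != 0 /\ q * FracField.tofrac y = FracField.tofrac x.
Proof.
elim/quotW: q => r; exists (frac r).1, (frac r).2; split; first exact: denom_ratioP.
unlock FracField.tofrac; rewrite -[LHS]FracField.pi_mul; apply/eqmodP => /=.
rewrite /equivf /FracField.mulf /= !numden_Ratio ?(oner_neq0, mulr1, mul1r) ?denom_ratioP //.
by rewrite mulrC.
Qed.

(** * The field Q_p and its valuation *)

Section QpTheory.
Variables (p : nat) (p_pr : prime p).
Local Notation K := (Qp p_pr).
Local Notation fr := (@FracField.tofrac (Zp p_pr)).
Implicit Types q : K.

Definition isZ q := exists z, q = fr z.

Lemma isZD q1 q2 : isZ q1 -> isZ q2 -> isZ (q1 + q2).
Proof. by move=> [x ->] [y ->]; exists (x + y); rewrite tofracD. Qed.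
Lemma isZM q1 q2 : isZ q1 -> isZ q2 -> isZ (q1 * q2).
Proof. by move=> [x ->] [y ->]; exists (x * y); rewrite tofracM. Qed.
Lemma isZX q k : isZ q -> isZ (q ^+ k).
Proof. by move=> [x ->]; exists (x ^+ k); rewrite tofracXn. Qed.
Lemma isZ0 : isZ 0. Proof. by exists 0; rewrite tofrac0. Qed.
Lemma isZ_nat k : isZ k%:R. Proof. by exists k%:R; rewrite rmorph_nat. Qed.
Lemma isZ_sum (I : Type) (r : seq I) (P : pred I) (f : I -> K) :
  (forall i, isZ (f i)) -> isZ (\sum_(i <- r | P i) f i).
Proof. by move=> h; apply: big_ind => //; [exact: isZ0 | exact: isZD]. Qed.

Lemma Zp_p_neq0 : p%:R != 0 :> Zp p_pr.
Proof.
apply/eqP => /(congr1 (fun z : Zp p_pr => z 2)); rewrite zcoef_nat /= mod0n.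
have p1 := prime_gt1 p_pr; rewrite modn_small; last by rewrite -[ltnLHS]expn1 ltn_exp2l.
by move=> p0; move: p1; rewrite p0.
Qed.

Lemma Qp_p_neq0 : p%:R != 0 :> K.
Proof. by rewrite -(rmorph_nat fr) tofrac_eq0 Zp_p_neq0. Qed.

Lemma Zp_p_nunit (x : Zp p_pr) : p%:R * x <> 1.
Proof.
move=> /(congr1 (fun z : Zp p_pr => z 1%N)); rewrite zcoefM zcoef_nat expn1 modnn mul0n mod0n.
by rewrite /= expn1 modn_small // prime_gt1.
Qed.

Lemma Qp_denom q : exists c, isZ (p%:R ^+ c * q).
Proof.
have [x [y [y0 qy]]] := fraction_numden q.
have [m [u [u' [uu' yE]]]] := Zp_decomp y0; exists m, (x * u').
rewrite tofracM -qy yE tofracM tofracXn rmorph_nat mulrCA mulrC -!mulrA.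
by rewrite -tofracM uu' tofrac1 mulr1 mulrC.
Qed.

(** The second alternative puts the inverse of q in pZ_p and not merely in Z_p; this extra factor p
    is what later contradicts [Zp_p_nunit]. *)
Lemma Qp_val q : isZ q \/ exists y, q * fr (p%:R * y) = 1.
Proof.
have [x [y [y0 qy]]] := fraction_numden q.
have [m [u [u' [uu' yE]]]] := Zp_decomp y0.
have fy0 : fr y != 0 by rewrite tofrac_eq0.
have [x0|/Zp_decomp [l [v [v' [vv' xE]]]]] := eqVneq x 0.
  left; exists 0; apply: (mulIf fy0); rewrite qy x0 tofrac0 mul0r //.
have [ml|lm] := leqP m l.
  left; exists (p%:R ^+ (l - m) * v * u'); apply: (mulIf fy0); rewrite qy -tofracM xE yE.
  congr fr; rewrite -[in LHS](subnK ml) exprD -[LHS]mulr1 -uu'; ring.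
right; exists (p%:R ^+ (m - l).-1 * u * v'); apply: (mulIf fy0).
rewrite mul1r mulrAC qy -tofracM xE yE; congr fr.
have {2}-> : m = (l + (m - l).-1.+1)%N by rewrite prednK ?subn_gt0 // subnKC // ltnW.
rewrite exprD exprS -[RHS]mulr1 -vv'; ring.
Qed.
End QpTheory.

(** * The norm of a finite extension of Qp *)

Section NormBound.
Variables (p : nat) (p_pr : prime p) (F : fieldExtType (Qp p_pr)).
Local Notation K := (Qp p_pr).
Local Notation fr := (@FracField.tofrac (Zp p_pr)).
Local Notation d := (\dim {:F}).
Local Notation b := (vbasis {:F}).
Implicit Types x y : F.

(** Row j holds the coordinates of x b_j, so this is the matrix of multiplication by x, and [vnorm]
    is the field norm from F to Q_p. *)
Definition mulmat x : 'M[K]_d := \matrix_(j, k) coord b k (x * b`_j).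
Definition vnorm x : K := \det (mulmat x).

Lemma coord_vbasis_full x : x = \sum_i coord b i x *: b`_i.
Proof. by rewrite -coord_vbasis ?memvf. Qed.

Lemma mulmatE x (j : 'I_d) : x * b`_j = \sum_k mulmat x j k *: b`_k.
Proof.
rewrite {1}[x * _]coord_vbasis_full; apply: eq_bigr => k _; by rewrite mxE.
Qed.

Lemma mulmatD x y : mulmat (x + y) = mulmat x + mulmat y.
Proof. by apply/matrixP => i j; rewrite !mxE mulrDl linearD. Qed.

Lemma mulmatZ (a : K) x : mulmat (a *: x) = a *: mulmat x.
Proof. by apply/matrixP => i j; rewrite !mxE -scalerAl linearZ. Qed.

Lemma mulmat_sum (I : Type) (r : seq I) (P : pred I) (f : I -> F) :
  mulmat (\sum_(i <- r | P i) f i) = \sum_(i <- r | P i) mulmat (f i).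
Proof.
apply: (big_morph mulmat mulmatD); apply/matrixP => i j.
by rewrite !mxE mul0r linear0.
Qed.

Lemma mulmat1 : mulmat 1 = 1%:M.
Proof.
apply/matrixP => i j; rewrite !mxE mul1r.
by rewrite (coord_free i j (basis_free (vbasisP _))).
Qed.

Lemma mulmatM x y : mulmat (x * y) = mulmat x *m mulmat y.
Proof.
apply/matrixP => i j; rewrite !mxE mulrAC mulrC mulmatE mulr_sumr linear_sum /=.
by apply: eq_bigr => k _; rewrite -scalerAr linearZ /= !mxE.
Qed.

Lemma vnormM x y : vnorm (x * y) = vnorm x * vnorm y.
Proof. by rewrite /vnorm mulmatM det_mulmx. Qed.
Lemma vnorm1 : vnorm 1 = 1. Proof. by rewrite /vnorm mulmat1 det1. Qed.
Lemma vnormX x k : vnorm (x ^+ k) = vnorm x ^+ k.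
Proof. by elim: k => [|k IH]; rewrite ?vnorm1 // !exprS vnormM IH. Qed.
Lemma vnorm_neq0 x : x != 0 -> vnorm x != 0.
Proof.
move=> x0; apply: contra_eqN vnorm1 => /eqP e.
by rewrite -(divff x0) vnormM e mul0r eq_sym oner_eq0.
Qed.
Lemma vnormZ (a : K) x : vnorm (a *: x) = a ^+ d * vnorm x.
Proof. by rewrite /vnorm mulmatZ detZ. Qed.
Lemma vnorm_scalar (a : K) : vnorm (a%:A) = a ^+ d.
Proof. by rewrite vnormZ vnorm1 mulr1. Qed.
Lemma dim_gt0 : (0 < d)%N.
Proof. exact: adim_gt0. Qed.

Lemma common_denom (I : finType) (f : I -> K) :
  exists c, forall i, isZ (p%:R ^+ c * f i).
Proof.
have [c cP] := choice (fun i => Qp_denom (f i)).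
exists (\sum_i c i)%N => i.
rewrite (bigD1 i) //= addnC exprD -mulrA; apply: isZM (cP i); exact/isZX/isZ_nat.
Qed.

Definition matZ (M : 'M[K]_d) := forall i j, isZ (M i j).

Lemma mulmat_denom : exists s, forall i : 'I_d, matZ (p%:R ^+ s *: mulmat b`_i).
Proof.
have [s sP] := common_denom (fun u : 'I_d * 'I_d * 'I_d => mulmat b`_u.1.1 u.1.2 u.2).
by exists s => i j k; rewrite mxE; exact: (sP (i, j, k)).
Qed.

(* x lies in p^-c L, where L is the Zp-span of the basis b. *)
Definition lattice c x := forall i, isZ (p%:R ^+ c * coord b i x).

Lemma latticeD c x y : lattice c x -> lattice c y -> lattice c (x + y).
Proof. by move=> lx ly i; rewrite linearD mulrDr; exact: isZD (lx i) (ly i). Qed.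

Lemma lattice_sum c (I : Type) (r : seq I) (P : pred I) (f : I -> F) :
  (forall i, lattice c (f i)) -> lattice c (\sum_(i <- r | P i) f i).
Proof.
move=> h; apply: big_ind => //; last exact: latticeD.
by move=> i; rewrite linear0 mulr0; exact: isZ0.
Qed.

Lemma lattice_muln c x k : lattice c x -> lattice c (x *+ k).
Proof. by move=> lx i; rewrite linearMn mulrnAr -mulr_natl; exact: isZM (isZ_nat _ _) (lx i). Qed.

Lemma lattice_mulmat : exists s, forall c x, lattice c x ->
  matZ (p%:R ^+ (c + s) *: mulmat x).
Proof.
have [s sP] := mulmat_denom; exists s => c x lx i j.
rewrite [x in mulmat x]coord_vbasis_full mulmat_sum scaler_sumr summxE.
apply: isZ_sum => k; rewrite mulmatZ scalerA exprD mulrAC -scalerA mxE.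
exact: isZM (lx k) (sP k i j).
Qed.

Lemma matZ_lift (M : 'M[K]_d) : matZ M -> exists A, M = map_mx fr A.
Proof.
move=> ZM; have [f fP] := choice (fun u : 'I_d * 'I_d => ZM u.1 u.2).
exists (\matrix_(i, j) f (i, j)); apply/matrixP => i j.
by rewrite !mxE; exact: (fP (i, j)).
Qed.

Lemma matZ_det (M : 'M[K]_d) : matZ M -> isZ (\det M).
Proof. by move=> /matZ_lift [A ->]; exists (\det A); rewrite det_map_mx. Qed.

(* The unit sphere of the lattice L is compact and the norm does not vanish on it. *)
Lemma norm_primitive : exists s m0, forall c : 'I_d -> Zp p_pr,
  (exists i, c i 1%N != 0%N) ->
  exists2 D : Zp p_pr, D m0 != 0%N &
    p%:R ^+ (s * d) * vnorm (\sum_(i < d) fr (c i) *: b`_i) = fr D.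
Proof.
have [s sP] := mulmat_denom; have [A AP] := choice (fun i => matZ_lift (sP i)).
pose D (c : 'I_d -> Zp p_pr) := \det (\sum_i c i *: A i).
have DE (c : 'I_d -> Zp p_pr) : p%:R ^+ (s * d) * vnorm (\sum_(i < d) fr (c i) *: b`_i) = fr (D c).
  rewrite /D -det_map_mx exprM -detZ mulmat_sum scaler_sumr rmorph_sum /=.
  congr (\det _); apply: eq_bigr => i _.
  rewrite mulmatZ scalerA mulrC -scalerA AP.
  by apply/matrixP => j k; rewrite !mxE tofracM.
exists s; apply: contrapT => /forallNP h.
(* Without a lower bound there are primitive vectors whose scaled norms [D] are divisible by ever
   higher powers of p; their limit is primitive of norm 0. *)
have hm m : exists c : 'I_d -> Zp p_pr, (exists i, c i 1%N != 0%N) /\ (D c) m = 0%N.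
  apply: contrapT => /forallNP hm; apply: (h m) => c c1; exists (D c) => //.
  by apply/eqP => e; apply: (hm c).
have [c cP] := choice hm.
have [U FU] := free_ultrafilter_exists; have [UU _] := FU.
have [z zP] := choice (fun i => Zp_limit (fun j => c j i) FU).
have close m : U [set j | forall i, c j i m = z i m].
  by apply: filter_forall => i; exact: zP.
have Dz : D z = 0.
  apply: Zp_eqP => m; rewrite /= mod0n.
  have [j mj e] := free_ultrafilter_inf m FU (close m).
  have [_ Dj] := cP j.
  have : eqZp m (D z) (D (c j)).
    apply: eqZp_det => k l; rewrite !summxE; apply: (big_ind2 (eqZp m)) => //.
      by move=> *; apply: eqZpD.
    by move=> i _; rewrite !mxE; apply: eqZpM => //; rewrite /eqZp e.
  by rewrite /eqZp => ->; rewrite -(zcoef_modD _ m (j - m)) subnK // Dj mod0n.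
have : vnorm (\sum_i fr (z i) *: b`_i) = 0.
  have := DE z; rewrite Dz tofrac0 => /eqP; rewrite mulf_eq0 expf_eq0.
  by rewrite (negbTE (Qp_p_neq0 p_pr)) andbF => /eqP.
have [j /(_ _)/= e] := filter_ex (close 1%N).
have [[i ci] _] := cP j.
suff : \sum_i fr (z i) *: b`_i != 0 by move/vnorm_neq0/eqP.
apply/eqP => /(congr1 (coord b i)); rewrite (coord_sum_free _ _ (basis_free (vbasisP _))).
by rewrite linear0 => /eqP; rewrite tofrac_eq0 => /eqP zi; rewrite e zi /= mod0n in ci.
Qed.

Lemma primitive_decomp x : x != 0 -> exists m j (c : 'I_d -> Zp p_pr),
  (exists i, c i 1%N != 0%N) /\
  p%:R ^+ j *: x = p%:R ^+ m *: \sum_i fr (c i) *: b`_i.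
Proof.
move=> x0; have [j jP] := common_denom (fun i => coord b i x); have [z zP] := choice jP.
have [i0 zi0] : exists i, z i != 0.
  apply: contrapT => /forallNP h; case/eqP: x0; rewrite [x]coord_vbasis_full.
  apply: big1 => i _; have /negP := h i; rewrite negbK => /eqP zi.
  have /eqP := zP i; rewrite zi tofrac0 mulf_eq0 expf_eq0 (negbTE (Qp_p_neq0 p_pr)) andbF.
  by move=> /eqP ->; rewrite scale0r.
have ex : exists m, [exists i, z i m != 0%N].
  by have [m] := Zp_neq0 zi0; exists m; apply/existsP; exists i0.
case: (ex_minnP ex) => -[|m] /existsP[i zm] min.
  by move: zm; rewrite -(zcoef_mod _ 0) expn0 modn1.
have z0 k : z k m = 0%N.
  apply/eqP/negPn/negP => h; suff /min : [exists i, z i m != 0%N] by rewrite ltnn.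
  by apply/existsP; exists k.
have [c cP] := choice (fun k => Zp_div (z0 k)).
exists m, j, c; split.
  exists i; apply: contra zm => /eqP c1; have [u uE] := Zp_div c1.
  by rewrite cP uE mulrA -exprSr zcoefM -natrX zcoef_nat modnn mul0n mod0n.
rewrite [x in LHS]coord_vbasis_full !scaler_sumr; apply: eq_bigr => k _.
by rewrite !scalerA zP cP tofracM tofracXn rmorph_nat.
Qed.

(** Write p^j x = p^m y with y primitive. If j > m + m0, an integral norm of x would make the scaled
    norm of y divisible by p^m0, against [norm_primitive]; so x lies in p^-m0 L. *)
Lemma lattice_bound : exists m0, forall x, isZ (vnorm x) -> lattice m0 x.
Proof.
have [s [m0 bd]] := norm_primitive; exists m0 => x [z Nx].
have [->|x0] := eqVneq x 0; first by move=> i; rewrite linear0 mulr0; exact: isZ0.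
have [m [j [c [prim xE]]]] := primitive_decomp x0.
have [D Dm0 DE] := bd c prim.
have p0 : (p%:R : K) != 0 by exact: Qp_p_neq0.
have jm : (j <= m + m0)%N.
  rewrite leqNgt; apply: contra Dm0 => mj.
  have : p%:R ^+ (s * d) * vnorm (p%:R ^+ j *: x) = p%:R ^+ (m * d) * fr D.
    by rewrite xE vnormZ -exprM mulrCA DE.
  rewrite vnormZ Nx -exprM mulrA -exprD.
  have -> : (s * d + j * d = m * d + (m0 + (s * d + (j - m) * d - m0)))%N.
    have := dim_gt0; move: mj; clear; nia.
  rewrite exprD -mulrA => /(mulfI (expf_neq0 _ p0)).
  rewrite -(rmorph_nat fr) -tofracXn -tofracM => /eqP; rewrite tofrac_eq => /eqP <-.
  by rewrite exprD -mulrA zcoefM -natrX zcoef_nat modnn mul0n mod0n.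
move=> i; exists (p%:R ^+ (m + m0 - j) * c i).
apply: (mulfI (expf_neq0 j p0)); have := congr1 (coord b i) xE.
rewrite !linearZ /= (coord_sum_free _ _ (basis_free (vbasisP _))) => e.
rewrite mulrCA e tofracM mulrA [RHS]mulrA tofracXn rmorph_nat -!exprD.
by rewrite subnKC // addnC.
Qed.
End NormBound.

(** * The ring of integers as the unit ball of the norm *)

Section IntegersAreTheUnitBall.
Variables (p : nat) (p_pr : prime p) (F : fieldExtType (Qp p_pr)).
Local Notation K := (Qp p_pr).
Local Notation fr := (@FracField.tofrac (Zp p_pr)).
Local Notation d := (\dim {:F}).
Local Notation b := (vbasis {:F}).
Implicit Types x y : F.

Lemma vnorm_val x : isZ (vnorm x) \/ exists z, vnorm x * fr (p%:R * z) = 1.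
Proof. exact: Qp_val. Qed.

Lemma vnorm0 : vnorm (0 : F) = 0.
Proof. by rewrite -(scale0r 1) vnormZ expr0n gtn_eqF ?dim_gt0 // mul0r. Qed.

Lemma vnormV_val x z : vnorm x * fr z = 1 -> vnorm x^-1 = fr z.
Proof.
move=> e; have x0 : x != 0.
  by apply: contra_eq_neq e => ->; rewrite vnorm0 mul0r eq_sym oner_eq0.
by apply: (mulfI (vnorm_neq0 x0)); rewrite e -vnormM divff ?vnorm1.
Qed.

Lemma vnormV x : isZ (vnorm x) \/ isZ (vnorm x^-1).
Proof.
have [?|[z /vnormV_val ->]] := vnorm_val x; [by left | by right; exists (p%:R * z)].
Qed.

(* All powers of x stay in a fixed lattice, hence so do those of 1 + x, and
   a negative valuation of 1 + x would be visible on large powers. *)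
Lemma vnorm_1D x : isZ (vnorm x) -> isZ (vnorm (1 + x)).
Proof.
move=> Nx; have [m0 bd] := lattice_bound F; have [s mm] := lattice_mulmat F.
have [//|[y e]] := vnorm_val (1 + x).
have lX k : lattice m0 ((1 + x) ^+ k).
  rewrite addrC exprDn; apply: lattice_sum => i; apply: lattice_muln.
  rewrite expr1n mulr1; apply: bd; rewrite vnormX; exact: isZX.
(* p^k clears the denominator of the norm of every power of 1 + x. Since that norm is the inverse of
   p y, its power of exponent k + 1 has a larger denominator. *)
set k := ((m0 + s) * d)%N.
have [z zE] : isZ (p%:R ^+ k * vnorm (1 + x) ^+ k.+1).
  by rewrite -vnormX /vnorm exprM -detZ; apply/matZ_det/mm.
have : fr (p%:R ^+ k) = fr (z * (p%:R * y) ^+ k.+1).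
  rewrite [RHS]tofracM -zE -mulrA [fr (_ ^+ k.+1)]tofracXn -exprMn e expr1n mulr1.
  by rewrite tofracXn rmorph_nat.
move/eqP; rewrite tofrac_eq exprMn [p%:R ^+ k.+1]exprSr => /eqP e1.
have p0 : (p%:R : Zp p_pr) ^+ k != 0 by rewrite expf_neq0 // Zp_p_neq0.
have : p%:R * (z * y ^+ k.+1) = 1 :> Zp p_pr.
  apply: (mulfI p0); rewrite mulr1 [RHS]e1.
  by rewrite [RHS]mulrCA -[RHS]mulrA.
by move/Zp_p_nunit.
Qed.

Lemma vnorm_isZD x y : isZ (vnorm x) -> isZ (vnorm y) -> isZ (vnorm (x + y)).
Proof.
have [->|x0] := eqVneq x 0; first by rewrite add0r.
have [->|y0] := eqVneq y 0; first by rewrite addr0.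
have [q|] := vnormV (y / x).
  move=> Nx _; have -> : x + y = x * (1 + y / x) by field.
  by rewrite vnormM; apply: isZM => //; apply: vnorm_1D.
rewrite invf_div => q _ Ny; have -> : x + y = y * (1 + x / y) by field.
by rewrite vnormM; apply: isZM => //; apply: vnorm_1D.
Qed.

Lemma vnorm_Zp z : isZ (vnorm (Zp_in F z)).
Proof. by rewrite /Zp_in /= vnorm_scalar; apply: isZX; exists z. Qed.

(** If the norm of x is not integral, that of x^-1 lies in pZ_p. Dividing the monic equation by the
    top power of x gives x^-1 w = -1 with w a polynomial in x^-1, of integral norm; taking norms
    makes p a unit. *)
Lemma integral_vnorm x : x \in @isInteger p p_pr F -> isZ (vnorm x).
Proof.
move=> /asboolP [q mq]; have [//|[z /[dup] Nx /vnormV_val Nx']] := vnorm_val x.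
have x0 : x != 0.
  by apply: contra_eq_neq Nx => ->; rewrite vnorm0 mul0r eq_sym oner_eq0.
have qs : (size q).-1.+1 = size q by rewrite prednK // size_poly_gt0 monic_neq0.
rewrite /root horner_coef size_map_poly_id0; last first.
  by rewrite (monicP mq) /Zp_in /= tofrac1 scale1r oner_neq0.
rewrite -qs big_ord_recr /=.
have -> : (map_poly (Zp_in F) q)`_(size q).-1 = 1.
  by rewrite coef_map -[q`__]/(lead_coef q) (monicP mq); exact: rmorph1.
rewrite mul1r => /eqP qx; move: qx; set k := (size q).-1 => qx.
pose w := \sum_(i < k) Zp_in F q`_i * x^-1 ^+ (k.-1 - i).
have [v vE] : isZ (vnorm w).
  rewrite /w; elim/big_ind: _ => //; first by rewrite vnorm0; exact: isZ0.
    exact: vnorm_isZD.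
  move=> i _; rewrite vnormM vnormX; apply: isZM (vnorm_Zp _) _.
  by rewrite Nx'; apply: isZX; exists (p%:R * z).
have xw : x^-1 * w = -1.
  apply: (mulfI (expf_neq0 k x0)); rewrite mulrN1.
  move/eqP: qx; rewrite addr_eq0 => /eqP <-.
  rewrite /w mulrA mulr_sumr; apply: eq_bigr => i _.
  rewrite coef_map mulrCA; congr (_ * _).
  have ik : k = (i + (k.-1 - i).+1)%N.
    by case: i => i /=; case: (k) => // k' ik; rewrite addnS subnKC.
  by rewrite -mulrA -exprS {1}ik exprD -mulrA -exprMn divff // expr1n mulr1.
(* Squaring removes the norm of -1, which is a sign. *)
have : (vnorm x^-1 * vnorm w) ^+ 2 = 1.
  by rewrite -vnormM xw -vnormX sqrrN expr1n vnorm1.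
rewrite Nx' vE -tofracM -tofracXn -(tofrac1 (Zp p_pr)) => /eqP; rewrite tofrac_eq => /eqP e.
suff /Zp_p_nunit : p%:R * (z * v * (p%:R * z * v)) = 1 by [].
apply: etrans e; ring.
Qed.

(** The basis b, viewed as a row vector over F, is an eigenvector for x of the transposed integral
    matrix, so x is a root of a monic characteristic polynomial over Z_p. *)
Lemma matZ_integral x : matZ (mulmat x) -> x \in @isInteger p p_pr F.
Proof.
move=> /matZ_lift [A AE]; apply/asboolP; exists (char_poly A^T); first exact: char_poly_monic.
rewrite map_char_poly -eigenvalue_root_char; apply/eigenvalueP.
exists (\row_i b`_i).
  apply/rowP => j; rewrite !mxE mulmatE; apply: eq_bigr => k _.
  have -> : mulmat x j k = fr (A j k) by rewrite AE mxE.
  rewrite !mxE.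
  by rewrite /Zp_in /= mulr_algr.
apply/eqP => /rowP b0; have := coord_vbasis_full (1 : F).
rewrite big1 => [/eqP|i _]; first by rewrite oner_eq0.
by have := b0 i; rewrite !mxE => ->; rewrite scaler0.
Qed.

(** O contains p^s L, hence is open in F: the factor p^s clears the denominators of the structure
    constants of the basis. *)
Lemma lattice_integral : exists s, forall x,
  (forall i, exists u, coord b i x = p%:R ^+ s * fr u) -> x \in @isInteger p p_pr F.
Proof.
have [s mm] := lattice_mulmat F; exists s => x h; apply: matZ_integral => k l.
have ps0 : (p%:R : K) ^+ s != 0 by rewrite expf_neq0 // Qp_p_neq0.
have := mm 0%N (p%:R ^- s *: x); rewrite mulmatZ scalerA divff // scale1r.
apply=> r; have [u uE] := h r; exists u.
by rewrite linearZ /= expr0 mul1r uE mulKf.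
Qed.

(* Two powers of x are congruent modulo p^m L by compactness, so x is a root of a
   polynomial X^j - X^i - y with y integral. *)
Lemma vnorm_integral x : isZ (vnorm x) -> x \in @isInteger p p_pr F.
Proof.
move=> Nx; have [m0 bd] := lattice_bound F; have [s mm] := lattice_integral.
have lX k i : isZ (p%:R ^+ m0 * coord b i (x ^+ k)).
  by apply: bd; rewrite vnormX; exact: isZX.
have [c' cE'] := choice (fun u : nat * 'I_d => lX u.1 u.2).
pose c k i := c' (k, i); have cE k i := cE' (k, i).
have [U FU] := free_ultrafilter_exists; have [UU _] := FU.
have [z zP] := choice (fun i => Zp_limit (fun j => c j i) FU).
have close m : U [set j | forall i, c j i m = z i m].
  by apply: filter_forall => i; exact: zP.
have [i _ ei] := free_ultrafilter_inf 0 FU (close (m0 + s)%N).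
have [j ij ej] := free_ultrafilter_inf i.+1 FU (close (m0 + s)%N).
have iy : x ^+ j - x ^+ i \in @isInteger p p_pr F.
  have pm0 : (p%:R : K) ^+ m0 != 0 by rewrite expf_neq0 // Qp_p_neq0.
  apply: mm => r; have [u uE] : exists u, c j r - c i r = p%:R ^+ (m0 + s) * u.
    by apply: Zp_div; rewrite zcoefD ej -ei -zcoefD subrr /= mod0n.
  exists u; apply: (mulfI pm0).
  by rewrite linearB mulrBr !cE -tofracB uE tofracM tofracXn rmorph_nat exprD mulrA.
apply/asboolP; apply: (@integral_root_monic _ _ _ _ ('X^j - ('X^i + (x ^+ j - x ^+ i)%:P))).
- rewrite monicE lead_coefDl ?lead_coefXn // size_polyN size_polyXn ltnS.
  rewrite (leq_trans (size_polyD _ _)) // geq_max size_polyXn ij.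
  exact: leq_trans (size_polyC_leq1 _) (leq_trans _ ij).
- by rewrite /root hornerD hornerN hornerD !hornerXn hornerC subrKC subrr.
apply/integral_poly => k; rewrite !(coefB, coefD, coefC, coefXn).
apply: integral_sub; first exact: integral_nat.
apply: integral_add; first exact: integral_nat.
case: ifP => _; [exact/asboolP | exact: integral0].
Qed.

Lemma vnormP x : x \in @isInteger p p_pr F <-> isZ (vnorm x).
Proof. by split; [exact: integral_vnorm | exact: vnorm_integral]. Qed.

Lemma isInteger_val x : x \notin @isInteger p p_pr F -> x^-1 \in @isInteger p p_pr F.
Proof. by move=> /negP xn; apply/vnormP; have [/vnormP|] := vnormV x. Qed.

Lemma integer_p_nunit : p%:R^-1 \notin @isInteger p p_pr F.
Proof.
apply/negP => /vnormP [z zE]; have p0 : (p%:R : K) != 0 by exact: Qp_p_neq0.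
have : vnorm (p%:R : F) * fr z = 1.
  rewrite -zE -vnormM divff ?vnorm1 //; apply: contraTneq p0 => /(congr1 (@vnorm p p_pr F)).
  by rewrite -scaler_nat vnorm_scalar vnorm0 => /eqP; rewrite expf_eq0 => /andP[_ ->].
rewrite -scaler_nat vnorm_scalar -(rmorph_nat fr) -tofracXn -tofracM -(tofrac1 (Zp p_pr)).
move=> /eqP; rewrite tofrac_eq -(prednK (dim_gt0 F)) exprS => /eqP.
by rewrite -mulrA => /Zp_p_nunit.
Qed.

Lemma integers_limit U (x : nat -> F) : free_ultrafilter U ->
  (forall j, x j \in @isInteger p p_pr F) ->
  exists2 z, z \in @isInteger p p_pr F &
    forall m, U [set j | (x j - z) / p%:R ^+ m \in @isInteger p p_pr F].
Proof.
move=> FU ix; have [UU _] := FU.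
have [m0 bd] := lattice_bound F; have [s mm] := lattice_integral.
have lX k i : isZ (p%:R ^+ m0 * coord b i (x k)).
  by apply: bd; apply: integral_vnorm.
have [c' cE'] := choice (fun u : nat * 'I_d => lX u.1 u.2).
pose c k i := c' (k, i); have cE k i := cE' (k, i).
have [z zP] := choice (fun i => Zp_limit (fun j => c j i) FU).
pose y := (p%:R : K) ^- m0 *: \sum_i fr (z i) *: b`_i.
have pX0 m : (p%:R : K) ^+ m != 0 by rewrite expf_neq0 // Qp_p_neq0.
have close m : U [set j | (x j - y) / p%:R ^+ m \in @isInteger p p_pr F].
  (* Here m0 accounts for the denominators of the coordinates of integers, and s for the passage
     from p^s L to O. *)
  have : U [set j | forall i, c j i (m0 + (m + s))%N = z i (m0 + (m + s))%N].
    by apply: filter_forall => i; exact: zP.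
  apply: filterS => j /= e; apply: mm => r.
  have [u uE] : exists u, c j r - z r = p%:R ^+ (m0 + (m + s)) * u.
    by apply: Zp_div; rewrite zcoefD e -zcoefD subrr /= mod0n.
  exists u; apply: (mulfI (pX0 m)); apply: (mulfI (pX0 m0)).
  have -> : (x j - y) / p%:R ^+ m = (p%:R ^- m : K) *: (x j - y).
    have -> : (p%:R : F) = in_alg F p%:R by rewrite rmorph_nat.
    by rewrite -rmorphXn -fmorphV /= mulr_algr.
  rewrite linearZ /= mulVKf // linearB mulrBr cE linearZ /= mulVKf //.
  rewrite (coord_sum_free _ _ (basis_free (vbasisP _))) -tofracB uE.
  by rewrite tofracM tofracXn rmorph_nat !exprD !mulrA.
exists y => //; have [j] := filter_ex (close 0%N); rewrite /= expr0 divr1 => xy.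
by rewrite -[y](subKr (x j)) rpredB ?ix.
Qed.

(* pi is a non-unit whose norm has minimal valuation. *)
Lemma uniformizer_exists : exists pi : F,
  [/\ pi \in @isInteger p p_pr F, pi^-1 \notin @isInteger p p_pr F &
   forall x, x != 0 -> exists (k : int) u, [/\ u \in @isInteger p p_pr F,
     u^-1 \in @isInteger p p_pr F & x = pi ^ k * u]].
Proof.
pose val x m := exists u u', u * u' = 1 /\ vnorm x = fr (p%:R ^+ m * u).
have val_ex x : x != 0 -> x \in @isInteger p p_pr F -> exists m, val x m.
  move=> x0 /vnormP [z zE]; have [|m [u [u' [uu' e]]]] := @Zp_decomp _ _ z.
    by rewrite -tofrac_eq0 -zE vnorm_neq0.
  by exists m, u, u'; rewrite zE e.
have val_unit x : val x 0%N -> x^-1 \in @isInteger p p_pr F.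
  move=> [u [u' [uu' e]]]; apply/vnormP; exists u'; apply: vnormV_val.
  by rewrite e expr0 mul1r -tofracM uu' tofrac1.
pose P m := `[< exists x, [/\ x != 0, x \in @isInteger p p_pr F,
  x^-1 \notin @isInteger p p_pr F & val x m] >].
have exP : exists m, P m.
  have ip : p%:R \in @isInteger p p_pr F by exact: rpred_nat.
  have p0 : p%:R != 0 :> F.
    by apply: contraNneq integer_p_nunit => ->; rewrite invr0 rpred0.
  have [m mP] := val_ex _ p0 ip; exists m; apply/asboolP; exists p%:R.
  by split=> //; exact: integer_p_nunit.
case: (ex_minnP exP) => a /asboolP[pi [pi0 ipi npi vpi]] min.
have a0 : (0 < a)%N.
  by rewrite lt0n; apply: contra npi => /eqP a0; apply: val_unit; rewrite -a0.
exists pi; split=> // x x0.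
(* Descent on the valuation of the norm: a non-unit has valuation at least a by minimality, so its
   quotient by pi is again integral. *)
have main m y : val y m -> y != 0 -> y \in @isInteger p p_pr F ->
    exists (k : nat) u, [/\ u \in @isInteger p p_pr F,
     u^-1 \in @isInteger p p_pr F & y = pi ^+ k * u].
  elim/ltn_ind: m y => l IH y lP y0 iy.
  have [uy|nuy] := boolP (y^-1 \in @isInteger p p_pr F).
    by exists 0%N, y; rewrite expr0 mul1r.
  have al : (a <= l)%N by apply: min; apply/asboolP; exists y.
  have vq : val (y / pi) (l - a)%N.
    have [u [u' [uu' e]]] := vpi; have [v [v' [vv' e']]] := lP.
    exists (v * u'), (v' * u); split; first by rewrite mulrACA vv' mul1r mulrC.
    apply: (mulIf (vnorm_neq0 pi0)); rewrite -vnormM divfK // e' e -tofracM; congr fr.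
    rewrite -{1}(subnKC al) exprD -[LHS]mulr1 -uu'; ring.
  have yp0 : y / pi != 0 by rewrite mulf_neq0 ?invr_neq0.
  have iq : y / pi \in @isInteger p p_pr F.
    by apply/vnormP; have [u [u' [_ ->]]] := vq; eexists.
  have la : (l - a < l)%N by rewrite ltn_subrL a0 (leq_trans a0).
  have [k [u [iu iu' e]]] := IH _ la _ vq yp0 iq.
  by exists k.+1, u; split=> //; rewrite exprS -mulrA -e mulrC divfK.
have [ix|nix] := boolP (x \in @isInteger p p_pr F).
  have [m mP] := val_ex _ x0 ix; have [k [u [iu iu' e]]] := main _ _ mP x0 ix.
  by exists k%:Z, u.
have ix := isInteger_val nix; have x'0 : x^-1 != 0 by rewrite invr_neq0.
have [m mP] := val_ex _ x'0 ix; have [k [u [iu iu' e]]] := main _ _ mP x'0 ix.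
exists (- k%:Z), u^-1; rewrite invrK; split=> //.
by rewrite -[x]invrK e invfM exprnN.
Qed.
End IntegersAreTheUnitBall.

(** * Uniformizers, residue fields and smooth characters *)

Definition uniformizer (p : nat) (p_pr : prime p) (F : fieldExtType (Qp p_pr)) (pi : F) :=
  [/\ pi \in @isInteger p p_pr F, pi^-1 \notin @isInteger p p_pr F &
   forall x, x != 0 -> exists (k : int) u, [/\ u \in @isInteger p p_pr F,
     u^-1 \in @isInteger p p_pr F & x = pi ^ k * u]].

Section DVR.
Variables (p : nat) (p_pr : prime p) (F : fieldExtType (Qp p_pr)) (pi : F).
Hypothesis pi_unif : uniformizer pi.
Local Notation O := (@isInteger p p_pr F).
Implicit Types x y : F.

Definition in_max x := x / pi \in O.

Lemma pi_neq0 : pi != 0.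
Proof. by have [_ + _] := pi_unif; apply: contraNneq => ->; rewrite invr0 rpred0. Qed.

Lemma in_max_integer x : in_max x -> x \in O.
Proof. by have [ipi _ _] := pi_unif => /(rpredM ipi); rewrite mulrC divfK ?pi_neq0. Qed.

Lemma in_max0 : in_max 0. Proof. by rewrite /in_max mul0r rpred0. Qed.
Lemma in_max1 : ~~ in_max 1. Proof. by rewrite /in_max mul1r; have [] := pi_unif. Qed.
Lemma in_maxD x y : in_max x -> in_max y -> in_max (x + y).
Proof. by rewrite /in_max mulrDl; apply: rpredD. Qed.
Lemma in_maxN x : in_max (- x) = in_max x.
Proof. by rewrite /in_max mulNr rpredN. Qed.
Lemma in_maxB x y : in_max x -> in_max y -> in_max (x - y).
Proof. by rewrite /in_max mulrBl; apply: rpredB. Qed.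
Lemma in_maxMl x y : x \in O -> in_max y -> in_max (x * y).
Proof. by rewrite /in_max -mulrA; apply: rpredM. Qed.
Lemma in_maxMr x y : in_max x -> y \in O -> in_max (x * y).
Proof. by rewrite mulrC => *; apply: in_maxMl. Qed.
Lemma in_max_sum (I : Type) (r : seq I) (P : pred I) (f : I -> F) :
  (forall i, P i -> in_max (f i)) -> in_max (\sum_(i <- r | P i) f i).
Proof. by move=> h; elim/big_ind: _ => // [|*]; [exact: in_max0 | exact: in_maxD]. Qed.

Lemma integer_unit x : x \in O -> ~~ in_max x -> x^-1 \in O.
Proof.
have [ipi npi dec] := pi_unif => ix nx; have pi0 := pi_neq0.
have [x0|/dec [k [u [iu iu' xE]]]] := eqVneq x 0; first by rewrite x0 in_max0 in nx.
case: k xE => [[|k]|k] xE.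
- by rewrite xE expr0z mul1r.
- case/negP: nx; rewrite /in_max xE -exprnP exprSr mulrAC mulfK //.
  by rewrite rpredM ?rpredX.
case/negP: npi; have u0 : u != 0.
  by apply: contra_eq_neq xE => ->; rewrite mulr0; case: eqVneq nx => // ->; rewrite in_max0.
have -> : pi^-1 = pi ^+ k * x / u.
  by rewrite xE NegzE -exprnN mulrA mulfK // exprS invfM mulrCA divff ?mulr1 // expf_neq0.
by rewrite !rpredM ?rpredX.
Qed.

Lemma in_max_p : in_max p%:R.
Proof. by apply: contraT => /(integer_unit (rpred_nat _ _)); rewrite (negbTE (integer_p_nunit F)). Qed.

Lemma F_p_neq0 : p%:R != 0 :> F.
Proof. by apply: contraNneq (integer_p_nunit F) => ->; rewrite invr0 rpred0. Qed.

Lemma pi_pow_p m : exists2 k, (0 < k)%N & pi ^+ k / p%:R ^+ m \in O.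
Proof.
have [ipi npi dec] := pi_unif; have pi0 := pi_neq0.
have [k [u [iu iu' pE]]] := dec _ F_p_neq0.
have [e eP] : exists e, pi ^+ e / p%:R \in O.
  case: k pE => k pE; exists k; rewrite pE.
    by rewrite invfM mulrA divff ?mul1r // expf_neq0.
  by rewrite NegzE -exprnN invfM invrK !rpredM ?rpredX.
exists (e * m).+1 => //; rewrite exprS exprM -mulrA -expr_div_n.
by rewrite rpredM ?rpredX.
Qed.

Lemma p_pow_denom x : exists m, p%:R ^+ m * x \in O.
Proof.
have [ipi npi dec] := pi_unif.
have [->|/dec [k [u [iu iu' ->]]]] := eqVneq x 0.
  by exists 0%N; rewrite mulr0 rpred0.
case: k => k; first by exists 0%N; rewrite expr0 mul1r rpredM ?rpredX.
exists k.+1; rewrite NegzE -exprnN mulrA -exprVn -exprMn.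
by rewrite rpredM // rpredX //; exact: in_max_p.
Qed.

Lemma pi_pow_denom x : exists m, forall k, (m <= k)%N -> pi ^+ k * x \in O.
Proof.
have [ipi npi dec] := pi_unif.
have [->|/dec [k [u [iu iu' ->]]]] := eqVneq x 0.
  by exists 0%N => *; rewrite mulr0 rpred0.
case: k => k; first by exists 0%N => *; rewrite !rpredM ?rpredX.
exists k.+1 => l kl; rewrite NegzE -exprnN mulrA -(subnK kl) exprD mulfK ?expf_neq0 ?pi_neq0 //.
by rewrite rpredM ?rpredX.
Qed.

Section Residue.
Variable kF : residueField (integers F).

(** A map from a local ring onto a field kills exactly the maximal ideal. If a in that ideal had
    residue with inverse the residue of y, then 1 - a y would be a unit with residue 0. *)
Lemma residue_eq0 (a : integers F) : (residue kF a == 0) = in_max (oval a).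
Proof.
have inv_res (c : integers F) : (oval c)^-1 \in O -> oval c != 0 -> residue kF c != 0.
  move=> ic c0; apply/eqP => rc; have /eqP := oner_neq0 kF; apply.
  rewrite -(rmorph1 (residue kF)) -[RHS](mul0r (residue kF (MkInteger ic))) -rc -rmorphM.
  congr (residue kF _); apply: val_inj.
  by apply: etrans (rmorph1 (@oval _ _ F)) _; rewrite [RHS](rmorphM (@oval _ _ F)) divff.
apply/idP/idP => [|ma].
  apply: contraLR => na; apply: inv_res; first by apply: integer_unit na; apply: ovalP.
  by apply: contraNneq na => ->; exact: in_max0.
apply: contraT => ra; have [y yE] := residue_surj ((residue kF a)^-1).
have : residue kF (1 - a * y) != 0.
  apply: inv_res.
    apply: integer_unit; first exact: ovalP.
    apply: contra in_max1 => h; rewrite -[1](subrK (oval (a * y))).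
    apply: in_maxD; first by rewrite rmorphB rmorph1 in h.
    by rewrite rmorphM; apply: in_maxMr => //; exact: ovalP.
  rewrite rmorphB rmorph1 subr_eq0; apply: contraNneq in_max1 => ->.
  by rewrite rmorphM; apply: in_maxMr => //; exact: ovalP.
by rewrite rmorphB rmorph1 rmorphM yE divff // subrr eqxx.
Qed.

(** Extended by 0 to non-integral elements, so that matrices over F can be reduced entrywise; the
    algebraic rules therefore require integrality. *)
Definition red x : kF := residue kF (insubd 0 x).

Lemma redE (a : integers F) : red (oval a) = residue kF a.
Proof. by rewrite /red valKd. Qed.

Lemma integerE x : x \in O -> exists a : integers F, x = oval a.
Proof. by move=> ix; exists (MkInteger ix). Qed.

Lemma red0 : red 0 = 0. Proof. by rewrite -(rmorph0 (@oval _ _ F)) redE rmorph0. Qed.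
Lemma red1 : red 1 = 1. Proof. by rewrite -(rmorph1 (@oval _ _ F)) redE rmorph1. Qed.
Lemma redD x y : x \in O -> y \in O -> red (x + y) = red x + red y.
Proof. by move=> /integerE [a ->] /integerE [b ->]; rewrite -rmorphD !redE rmorphD. Qed.
Lemma redB x y : x \in O -> y \in O -> red (x - y) = red x - red y.
Proof. by move=> /integerE [a ->] /integerE [b ->]; rewrite -rmorphB !redE rmorphB. Qed.
Lemma redM x y : x \in O -> y \in O -> red (x * y) = red x * red y.
Proof. by move=> /integerE [a ->] /integerE [b ->]; rewrite -rmorphM !redE rmorphM. Qed.
Lemma red_eq0 x : x \in O -> (red x == 0) = in_max x.
Proof. by move=> /integerE [a ->]; rewrite redE residue_eq0. Qed.
Lemma red_eq x y : x \in O -> y \in O -> (red x == red y) = in_max (x - y).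
Proof. by move=> ix iy; rewrite -subr_eq0 -redB // red_eq0 // rpredB. Qed.
Lemma red_sum (I : Type) (r : seq I) (P : pred I) (f : I -> F) :
  (forall i, f i \in O) -> red (\sum_(i <- r | P i) f i) = \sum_(i <- r | P i) red (f i).
Proof.
move=> h; suff [] : (\sum_(i <- r | P i) f i) \in O /\
   red (\sum_(i <- r | P i) f i) = \sum_(i <- r | P i) red (f i) by [].
elim/big_rec2: _ => [|i y1 y2 _ [iy <-]]; first by rewrite red0 rpred0.
by split; [rewrite rpredD ?h | rewrite redD ?h].
Qed.

End Residue.
End DVR.

Section SmoothChar.
Variables (p : nat) (p_pr : prime p) (F K : fieldExtType (Qp p_pr)) (pi : F).
Hypothesis pi_unif : uniformizer pi.
Variables (kK : residueField (integers K)) (chi : smoothChar F kK).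

Lemma residue_char : p \in [pchar kK].
Proof.
have [piK uK] := uniformizer_exists K.
apply/andP; split=> //; rewrite -(rmorph_nat (residue kK)) (residue_eq0 uK).
by rewrite rmorph_nat; exact: in_max_p.
Qed.

Lemma schar1 : chi 1 = 1.
Proof.
apply: (mulfI (schar_neq0 chi (oner_neq0 F))); by rewrite -scharM ?oner_neq0 // !mulr1.
Qed.

Lemma scharX x k : x != 0 -> chi (x ^+ k) = chi x ^+ k.
Proof.
move=> x0; elim: k => [|k IH]; first exact: schar1.
by rewrite !exprS scharM ?expf_neq0 // IH.
Qed.

(** In the factorization of x^p - 1 by x - 1, the cofactor is a sum of p terms congruent to 1, hence
    congruent to p, and so divisible by pi. *)
Lemma pth_power_close x m : (x - 1) / pi ^+ m.+1 \in @isInteger p p_pr F ->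
  (x ^+ p - 1) / pi ^+ m.+2 \in @isInteger p p_pr F.
Proof.
move=> cx; have ipi : pi \in @isInteger p p_pr F by case: pi_unif.
have mx : in_max pi (x - 1).
  rewrite /in_max; suff -> : (x - 1) / pi = (x - 1) / pi ^+ m.+1 * pi ^+ m by rewrite rpredM ?rpredX.
  by rewrite exprSr invfM mulrA mulrAC mulrVK ?unitfE ?expf_neq0 ?(pi_neq0 pi_unif).
have ix : x \in @isInteger p p_pr F.
  by rewrite -[x](subrK 1) rpredD ?rpred1 ?(in_max_integer pi_unif).
have mX i : in_max pi (x ^+ i - 1).
  by rewrite subrX1; apply: in_maxMr => //; rewrite rpred_sum // => k _; rewrite rpredX.
have ms : in_max pi (\sum_(i < p) x ^+ i).
  have -> : \sum_(i < p) x ^+ i = \sum_(i < p) (x ^+ i - 1) + p%:R.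
    by rewrite sumrB sumr_const card_ord subrK.
  by apply: in_maxD (in_max_p pi_unif); apply: in_max_sum.
by rewrite subrX1 exprS invfM [pi^-1 * _]mulrC mulrACA rpredM.
Qed.

(** The powers x^(p^k) tend to 1, so [chi] is 1 on one of them by local constancy; the Frobenius of
    kK is injective, which allows the p-power to be removed from chi(x)^(p^k) = 1. *)
Lemma schar_1max x : in_max pi (x - 1) -> chi x = 1.
Proof.
move=> mx; have x0 : x != 0.
  apply: contraTneq mx => ->; rewrite sub0r in_maxN; exact: in_max1.
have cl j : (x ^+ (p ^ j) - 1) / pi ^+ j.+1 \in @isInteger p p_pr F.
  elim: j => [//|j IH]; rewrite expnSr exprM; exact: pth_power_close.
have [m lc] := schar_lc chi (oner_neq0 F).
have [k _ kP] := pi_pow_p pi_unif m.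
have : chi (x ^+ (p ^ k)) = 1.
  rewrite -schar1; apply: lc; first by rewrite expf_neq0.
  have ipi : pi \in @isInteger p p_pr F by case: pi_unif.
  have i1 := rpredM ipi (rpredM (cl k) kP).
  exists (MkInteger i1) => /=; have := pi_neq0 pi_unif; have := F_p_neq0 F.
  move: (x ^+ _ - 1) => y p0 pi0; rewrite exprS.
  have := expf_neq0 m p0; have := expf_neq0 k pi0.
  by move: (_ ^+ m) (_ ^+ k) => u v u0 v0; field; rewrite pi0 u0 v0.
rewrite scharX //; elim: k {kP} => [|k IH]; first by rewrite expr1.
rewrite expnSr exprM => cp; apply: IH; apply/eqP; rewrite -subr_eq0.
have ch := residue_char; rewrite -(fmorph_eq0 (pFrobenius_aut ch)) rmorphB rmorph1 /=.
by rewrite pFrobenius_autE cp subrr.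
Qed.
End SmoothChar.

(** * Matrix decompositions *)

Section Pivot.
Variable R : fieldType.

Definition bordered n (r s : 'I_n.+1) (c : R) (M : 'M[R]_n) : 'M[R]_n.+1 :=
  \matrix_(i, j) match unlift r i, unlift s j with
                 | None, None => c
                 | Some a, Some b => M a b
                 | _, _ => 0
                 end.

Section Emb.
Variable n : nat.
Implicit Types (r s t : 'I_n.+1) (c : R) (M : 'M[R]_n).

Lemma bordered_rs r s c M : bordered r s c M r s = c.
Proof. by rewrite mxE !unlift_none. Qed.
Lemma bordered_rl r s c M b : bordered r s c M r (lift s b) = 0.
Proof. by rewrite mxE unlift_none liftK. Qed.
Lemma bordered_ls r s c M a : bordered r s c M (lift r a) s = 0.
Proof. by rewrite mxE unlift_none liftK. Qed.
Lemma bordered_ll r s c M a b : bordered r s c M (lift r a) (lift s b) = M a b.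
Proof. by rewrite mxE !liftK. Qed.
Definition borderedE := (bordered_rs, bordered_rl, bordered_ls, bordered_ll).

Lemma borderedM r t s c c' M M' :
  bordered r t c M *m bordered t s c' M' = bordered r s (c * c') (M *m M').
Proof.
apply/matrixP => i j; rewrite [LHS]mxE (bigD1_ord t) //=.
case: (unliftP r i) => [a|] ->; case: (unliftP s j) => [b|] ->;
  rewrite !borderedE ?mul0r ?mulr0 ?add0r.
- by rewrite mxE; apply: eq_bigr => k _; rewrite !borderedE.
- by apply: big1 => k _; rewrite !borderedE mulr0.
- by apply: big1 => k _; rewrite !borderedE mul0r.
- by rewrite big1 ?addr0 // => k _; rewrite !borderedE mul0r.
Qed.

Lemma bordered_unit r s c M : bordered r s c M \in unitmx -> M \in unitmx.
Proof.
rewrite !unitmxE !unitfE; apply: contraNneq => M0.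
rewrite (expand_det_row _ r) big1 // => j _; case: (unliftP s j) => [b|] ->.
  by rewrite borderedE mul0r.
rewrite /cofactor; have -> : row' r (col' s (bordered r s c M)) = M.
  by apply/matrixP => a b; rewrite 2!mxE borderedE.
by rewrite M0 !mulr0.
Qed.

Definition pivot_col (g : 'M[R]_n.+1) r : 'M[R]_n.+1 :=
  \matrix_(i, j) ((i == j)%:R + ((i != r) && (j == r))%:R * (g i ord0 / g r ord0)).
Definition pivot_row (g : 'M[R]_n.+1) r : 'M[R]_n.+1 :=
  \matrix_(i, j) ((i == j)%:R + ((i == ord0) && (j != ord0))%:R * (g r j / g r ord0)).
Definition schur (g : 'M[R]_n.+1) r : 'M[R]_n :=
  \matrix_(a, b) (g (lift r a) (lift ord0 b) -
                  g (lift r a) ord0 * g r (lift ord0 b) / g r ord0).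

Lemma pivot_colM (g : 'M[R]_n.+1) r (M : 'M_n.+1) i j :
  (pivot_col g r *m M) i j = M i j + (i != r)%:R * (g i ord0 / g r ord0) * M r j.
Proof.
rewrite mxE; under eq_bigr => k _ do rewrite mxE mulrDl.
rewrite big_split /=; congr (_ + _).
  rewrite (bigD1 i) //= eqxx mul1r big1 ?addr0 // => k ki.
  by rewrite eq_sym (negbTE ki) mul0r.
rewrite (bigD1 r) //= eqxx andbT big1 ?addr0 // => k kr.
by rewrite (negbTE kr) andbF !mul0r.
Qed.

Lemma pivot_rowM (g : 'M[R]_n.+1) r (M : 'M_n.+1) i j :
  (M *m pivot_row g r) i j = M i j + M i ord0 * ((j != ord0)%:R * (g r j / g r ord0)).
Proof.
rewrite mxE; under eq_bigr => k _ do rewrite mxE mulrDr.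
rewrite big_split /=; congr (_ + _).
  rewrite (bigD1 j) //= eqxx mulr1 big1 ?addr0 // => k ki.
  by rewrite (negbTE ki) mulr0.
rewrite (bigD1 ord0) //= big1 ?addr0 // => k kr.
by rewrite (negbTE kr) mul0r mulr0.
Qed.

(** One step of Gaussian elimination: row operations clear the first column outside row r, column
    operations clear row r, and the Schur complement of the pivot remains. *)
Lemma pivotE (g : 'M[R]_n.+1) r : g r ord0 != 0 ->
  g = pivot_col g r *m bordered r ord0 (g r ord0) (schur g r) *m pivot_row g r.
Proof.
move=> g0; apply/matrixP => i j; rewrite pivot_rowM !pivot_colM.
case: (unliftP r i) => [a|] ->; case: (unliftP ord0 j) => [b|] ->;
  rewrite !borderedE ?eqxx ?(eq_sym _ r) ?(eq_sym _ ord0) ?neq_lift ?(mul1r, mul0r, mulr0, add0r, addr0) //.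
- by rewrite [schur _ _ _ _]mxE; field.
- by field.
- by field.
Qed.
End Emb.

Definition upmx n (A : 'M[R]_n) := forall i j : 'I_n, (j < i)%N -> A i j = 0.

Lemma upmxM n (A B : 'M[R]_n) : upmx A -> upmx B -> upmx (A *m B).
Proof.
move=> uA uB i j ji; rewrite mxE big1 // => k _.
have [ki|ik] := ltnP k i; first by rewrite uA ?mul0r.
by rewrite uB ?mulr0 // (leq_trans ji).
Qed.

Lemma upmx_diagM n (A B : 'M[R]_n) i : upmx A -> upmx B -> (A *m B) i i = A i i * B i i.
Proof.
move=> uA uB; rewrite mxE (bigD1 i) //= big1 ?addr0 // => k ki.
have [lt|gt|e] := ltngtP k i; first by rewrite uA ?mul0r.
  by rewrite uB ?mulr0.
by case/eqP: ki; apply: val_inj.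
Qed.

Lemma upmx_bordered0 n c (M : 'M_n) : upmx M -> upmx (bordered ord0 ord0 c M).
Proof.
move=> uM i j; case: (unliftP ord0 i) => [a|] ->; last by rewrite ltn0.
case: (unliftP ord0 j) => [b|] ->; rewrite borderedE // !lift0 ltnS; exact: uM.
Qed.

Lemma upmx_pivot_row n (g : 'M_n.+1) r : upmx (pivot_row g r).
Proof.
move=> i j ji; rewrite mxE; have -> : (i == ord0) = false by apply/eqP => i0; rewrite i0 in ji.
by rewrite mul0r addr0; case: eqP ji => // ->; rewrite ltnn.
Qed.

Lemma bordered_perm n r (s : 'S_n) : bordered r ord0 1 (perm_mx s) = perm_mx (lift_perm r ord0 s).
Proof.
apply/matrixP => i j; rewrite [RHS]mxE [RHS]mxE.
case: (unliftP r i) => [a|] ->; case: (unliftP ord0 j) => [b|] ->;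
  rewrite borderedE ?lift_perm_lift ?lift_perm_id ?eqxx //.
by rewrite !mxE (inj_eq lift_inj).
Qed.
End Pivot.

(** * Decompositions of GL_n(F) with integral left factor *)

Section IwasawaBruhat.
Variables (p : nat) (p_pr : prime p) (F : fieldExtType (Qp p_pr)) (pi : F).
Hypothesis pi_unif : uniformizer pi.
Local Notation O := (@isInteger p p_pr F).
Local Notation in_max := (in_max pi).

(* Take the entry of largest index among those of minimal valuation. *)
Lemma pivot_exists m (c : 'I_m -> F) : (exists i, c i != 0) ->
  exists r, c r != 0 /\ forall i, c i / c r \in O /\ ((r < i)%N -> in_max (c i / c r)).
Proof.
move=> [i0 ci0]; have [ipi npi dec] := pi_unif.
have pi0 := pi_neq0 pi_unif.
have ex x : exists k : int, x != 0 -> exists u, [/\ u \in O, u^-1 \in O & x = pi ^ k * u].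
  have [->|/dec [k kP]] := eqVneq x 0; first by exists 0.
  by exists k.
have [k kP] := choice (fun i => ex (c i)).
(* As i < m, this weight orders lexicographically: valuation first, and ties go to the largest
   index. *)
case: (arg_minP (P := fun i => c i != 0) (fun i => k i * m%:Z - i%:Z) ci0).
move=> r cr min; exists r; split=> // i.
have [->|ci] := eqVneq (c i) 0; first by rewrite mul0r rpred0; split=> // _; exact: in_max0.
have [u [iu iu' cu]] := kP _ ci; have [v [iv iv' cv]] := kP _ cr.
have le := min _ ci; have im := ltn_ord i; have rm := ltn_ord r.
have -> : c i / c r = pi ^ (k i - k r) * (u / v).
  rewrite cu cv expfzDr // invfM mulrACA; congr (_ * _ * _).
  by rewrite -exprz_inv; apply: (mulfI (expfz_neq0 (k r) pi0)); rewrite exprz_inv -expfzDr // subrr divff ?expfz_neq0.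
have uv : u / v \in O by rewrite rpredM.
have kle : k r <= k i by move: le im rm; clear; nia.
have klt : (r < i)%N -> k r < k i by move: le im rm; clear; nia.
split=> [|/klt {}klt].
  have [l ->] : exists l : nat, k i - k r = l%:Z by exists `|k i - k r|%N; move: kle; clear; lia.
  by rewrite rpredM ?rpredX.
have [l ->] : exists l : nat, k i - k r = l.+1%:Z by exists (`|k i - k r|.-1)%N; move: klt; clear; lia.
by apply: in_maxMr => //; rewrite /in_max -exprnP exprSr mulfK // rpredX.
Qed.

Definition cong1 n (A : 'M[F]_n) := forall i j, in_max (A i j - (i == j)%:R).

Definition pro_iwahori n (A : 'M[F]_n) := forall i j, A i j \in O /\
  ((j <= i)%N -> in_max (A i j - (i == j)%:R)).

(** Gaussian elimination on the first column. By the choice of the pivot row r, the multipliers are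
    integral, and lie in the maximal ideal below row r, so the left factor stays pro-Iwahori; the
    permutation records that row r was matched with the first column. *)
Lemma iwasawa_bruhat n (g : 'M[F]_n) : g \in unitmx ->
  exists l (s : 'S_n) b, [/\ pro_iwahori l, upmx b & g = l *m perm_mx s *m b].
Proof.
elim: n g => [|n IH] g ug.
  by exists 1%:M, 1%g, 1%:M; split=> [[]|[]|] //; rewrite [LHS]flatmx0 [RHS]flatmx0.
have [|r [gr rP]] := @pivot_exists _ (fun i => g i ord0).
  apply: contrapT => /forallNP h; move: ug; rewrite unitmxE unitfE => /eqP; apply.
  rewrite (expand_det_col _ ord0) big1 // => i _.
  by have /negP := h i; rewrite negbK => /eqP ->; rewrite mul0r.
have gE := pivotE gr; have : bordered r ord0 (g r ord0) (schur g r) \in unitmx.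
  by move: ug; rewrite {1}gE !unitmx_mul => /andP[/andP[]].
move=> /bordered_unit /IH [l' [s' [b' [il ub sE]]]].
exists (pivot_col g r *m bordered r r 1 l'), (lift_perm r ord0 s').
exists (bordered ord0 ord0 (g r ord0) b' *m pivot_row g r); split.
- move=> i j; rewrite pivot_colM; have [ciO cim] := rP i.
  case: (unliftP r i) => [a|] ei; case: (unliftP r j) => [b|] ej; rewrite ei ej ?borderedE.
  + rewrite mulr0 addr0 (inj_eq lift_inj); have [? h] := il a b; split=> // ba; apply: h.
    by move: ba; rewrite /= leq_bump2.
  + have ir : (lift r a == r) = false by rewrite eq_sym eq_liftF.
    rewrite add0r mulr1 ir mul1r subr0 -ei; split=> // ri; apply: cim.
    by rewrite ltn_neqAle ri andbT ei neq_lift.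
  + by rewrite eqxx mul0r mul0r addr0 rpred0 eq_liftF subr0; split=> // _; exact: in_max0.
  + by rewrite eqxx !mul0r addr0 rpred1 subrr; split=> // _; exact: in_max0.
- by apply: upmxM; [exact: upmx_bordered0 | exact: upmx_pivot_row].
rewrite {1}gE sE -bordered_perm -!mulmxA; congr (_ *m _); rewrite !mulmxA.
by rewrite !borderedM !mul1r.
Qed.

(** The corner entry is a unit and can always serve as pivot, so no permutation occurs; the Schur
    complement is again congruent to 1. This is the Iwahori factorization of U1. *)
Lemma cong1_LU n (u : 'M[F]_n) : cong1 u -> exists l b,
  [/\ cong1 l, forall i j : 'I_n, (i <= j)%N -> l i j = (i == j)%:R, upmx b,
      cong1 b & u = l *m b].
Proof.
elim: n u => [|n IH] u cu; first by exists 1%:M, 1%:M; split=> [[]|[]|[]|[]|] //; rewrite [LHS]flatmx0 [RHS]flatmx0.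
have ou i j : u i j \in O.
  rewrite -[u i j](subrK (i == j)%:R) rpredD ?rpred_nat //; exact: in_max_integer (cu _ _).
have nm0 : ~~ in_max (u ord0 ord0).
  apply: contra (in_max1 pi_unif) => h; rewrite -[1](subKr (u ord0 ord0)).
  apply: in_maxB => //; exact: (cu ord0 ord0).
have u00 : u ord0 ord0 != 0 by apply: contraNneq nm0 => ->; exact: in_max0.
have vO : (u ord0 ord0)^-1 \in O by exact: (integer_unit pi_unif).
have [l' [b' [cl' ll' ub' cb' sE]]] : exists l b,
  [/\ cong1 l, forall i j : 'I_n, (i <= j)%N -> l i j = (i == j)%:R, upmx b,
      cong1 b & schur u ord0 = l *m b].
  apply: IH => a b; rewrite mxE addrAC -(inj_eq (@lift_inj _ ord0)).
  apply: in_maxB; first exact: cu.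
  apply: in_maxMr => //; apply: in_maxMr => //.
  by have := cu (lift ord0 a) ord0; rewrite eq_sym eq_liftF subr0.
exists (pivot_col u ord0 *m bordered ord0 ord0 1 l').
exists (bordered ord0 ord0 (u ord0 ord0) b' *m pivot_row u ord0); split.
- move=> i j; rewrite pivot_colM; have := cu i ord0.
  case: (unliftP ord0 i) => [a|] ->; case: (unliftP ord0 j) => [b|] ->; rewrite ?borderedE.
  + by rewrite mulr0 addr0 (inj_eq lift_inj).
  + have ir : (lift ord0 a == ord0) = false by rewrite eq_sym eq_liftF.
    by rewrite add0r mulr1 ir mul1r !subr0 => h; apply: in_maxMr.
  + by rewrite mulr0 addr0 eq_liftF subr0 => _; exact: in_max0.
  + by rewrite eqxx !mul0r addr0 subrr => _; exact: in_max0.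
- move=> i j; rewrite pivot_colM.
  case: (unliftP ord0 i) => [a|] ->; case: (unliftP ord0 j) => [b|] ->; rewrite ?borderedE //.
  + by rewrite !lift0 ltnS mulr0 addr0 (inj_eq lift_inj); exact: ll'.
  + by rewrite mulr0 addr0 eq_liftF.
  + by rewrite eqxx !mul0r addr0.
- by apply: upmxM; [exact: upmx_bordered0 | exact: upmx_pivot_row].
- move=> i j; rewrite pivot_rowM.
  case: (unliftP ord0 i) => [a|] ->; case: (unliftP ord0 j) => [b|] ->; rewrite ?borderedE ?eqxx.
  + by rewrite mul0r addr0 (inj_eq lift_inj); exact: cb'.
  + have ir : (lift ord0 a == ord0) = false by rewrite eq_sym eq_liftF.
    by rewrite mul0r addr0 ir subr0; exact: in_max0.
  + rewrite add0r eq_liftF subr0 eq_sym neq_lift mul1r mulrC divfK //.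
    by have := cu ord0 (lift ord0 b); rewrite eq_liftF subr0.
  + by rewrite mul0r mulr0 addr0; exact: (cu ord0 ord0).
rewrite {1}(pivotE u00) sE -!mulmxA; congr (_ *m _); rewrite !mulmxA.
by rewrite !borderedM !mul1r.
Qed.
End IwasawaBruhat.

(** * Congruence subgroups *)

Section UpperInverse.
Variable R : fieldType.

Lemma upmx_diag_neq0 n (A : 'M[R]_n) i : A \in unitmx -> upmx A -> A i i != 0.
Proof.
move=> uA tA; move: uA; rewrite -unitmx_tr unitmxE unitfE det_trig; last first.
  by apply/is_trig_mxP => j k jk; rewrite mxE tA.
by apply: contraNneq => Ai; rewrite (bigD1 i) //= mxE Ai mul0r.
Qed.

Lemma upmx_inv n (A : 'M[R]_n) : A \in unitmx -> upmx A -> upmx (invmx A).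
Proof.
move=> uA tA i j; have [m] := ubnP (n - i); elim: m i => // m IH i im ji.
apply: (mulfI (upmx_diag_neq0 i uA tA)); rewrite mulr0.
have /matrixP /(_ i j) := mulmxV uA; rewrite !mxE (bigD1 i) //= big1 ?addr0 => [->|k ki].
  by case: eqP ji => // ->; rewrite ltnn.
have [lt|ik|e] := ltngtP k i; first by rewrite tA ?mul0r.
  by rewrite IH ?mulr0 ?(ltn_trans ji) //; move: (ltn_ord k) (ltn_ord i) ik im; lia.
by case/eqP: ki; apply: val_inj.
Qed.

Lemma upmx_diagV n (A : 'M[R]_n) i : A \in unitmx -> upmx A -> invmx A i i = (A i i)^-1.
Proof.
move=> uA tA; apply: (mulfI (upmx_diag_neq0 i uA tA)).
rewrite divff ?upmx_diag_neq0 // -upmx_diagM ?mulmxV ?mxE ?eqxx //.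
exact: upmx_inv.
Qed.

Lemma upmx1 n : upmx (1%:M : 'M[R]_n).
Proof. by move=> i j ji; rewrite mxE; case: eqP ji => // ->; rewrite ltnn. Qed.
End UpperInverse.

Definition is_subgroup (G : groupType) (H : set G) :=
  [/\ H 1%g, forall g h, H g -> H h -> H (g * h)%g & forall g, H g -> H g^-1%g].

Lemma subgroupI (G : groupType) (H H' : set G) :
  is_subgroup H -> is_subgroup H' -> is_subgroup (H `&` H').
Proof.
by move=> [h1 hM hV] [h1' hM' hV']; split=> [//|g h [? ?] [? ?]|g [? ?]]; split; auto.
Qed.

Lemma subgroup_conj (G : groupType) (H : set G) (t : G) :
  is_subgroup H -> is_subgroup [set g | H (t^-1 * g * t)%g].
Proof.
move=> [h1 hM hV]; split=> /=; first by rewrite mulg1 mulVg.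
  move=> g h Hg Hh; have := hM _ _ Hg Hh; congr H.
  by rewrite !mulgA mulgK.
by move=> g /hV; congr H; rewrite !invgM invgK mulgA.
Qed.

Section Subgroups.
Variables (p : nat) (p_pr : prime p) (F : fieldExtType (Qp p_pr)) (pi : F).
Hypothesis pi_unif : uniformizer pi.
Variables (kF : residueField (integers F)) (n : nat).
Local Notation O := (@isInteger p p_pr F).
Local Notation in_max := (in_max pi).
Local Notation G := (GLn F n).
Local Notation Bo := (upper F n).
Implicit Types g h x b : G.

Lemma upper_subgroup : is_subgroup Bo.
Proof.
split=> [|g h|g ug]; first exact: upmx1.
  exact: upmxM.
exact: upmx_inv (glmxP g) ug.
Qed.

Lemma upper_diag_neq0 b i : Bo b -> b i i != 0.
Proof. exact: upmx_diag_neq0 (glmxP b). Qed.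

Definition redmx (A : 'M[F]_n) : 'M[kF]_n := map_mx (red kF) A.
Definition integral_mx (A : 'M[F]_n) := forall i j, A i j \in O.

Lemma integral_mxM A C : integral_mx A -> integral_mx C -> integral_mx (A *m C).
Proof. by move=> iA iC i j; rewrite mxE rpred_sum // => k _; rewrite rpredM ?iA ?iC. Qed.

Lemma integral_mx1 : integral_mx 1%:M.
Proof. by move=> i j; rewrite mxE rpred_nat. Qed.

Lemma redmxM A C : integral_mx A -> integral_mx C -> redmx (A *m C) = redmx A *m redmx C.
Proof.
move=> iA iC; apply/matrixP => i j; rewrite !mxE red_sum => [|k]; last by rewrite rpredM ?iA ?iC.
by apply: eq_bigr => k _; rewrite redM ?iA ?iC // !mxE.
Qed.

Lemma redmx1 : redmx 1%:M = 1%:M.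
Proof. by apply/matrixP => i j; rewrite !mxE; case: (i == j); rewrite ?red1 ?red0. Qed.

Lemma integral_mx_lift A : integral_mx A -> exists a : 'M[integers F]_n, A = map_mx (@oval _ _ F) a.
Proof.
move=> iA; exists (\matrix_(i, j) MkInteger (iA i j)).
by apply/matrixP => i j; rewrite !mxE.
Qed.

Lemma oval_mx_inj : injective (@map_mx _ _ (@oval _ _ F) n n).
Proof.
by move=> a c /matrixP e; apply/matrixP => i j; apply: val_inj; have := e i j; rewrite !mxE.
Qed.

Lemma redmx_map (a : 'M[integers F]_n) :
  redmx (map_mx (@oval _ _ F) a) = map_mx (residue kF) a.
Proof. by apply/matrixP => i j; rewrite !mxE redE. Qed.

Lemma unitmx_residue (a : 'M[integers F]_n) :
  (a \in unitmx) = (map_mx (residue kF) a \in unitmx).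
Proof.
rewrite !unitmxE unitfE det_map_mx (residue_eq0 pi_unif).
apply/idP/idP => [/asboolP [c ca]|na].
  apply: contra (in_max1 pi_unif) => da; rewrite -(rmorph1 (@oval _ _ F)) -ca.
  rewrite (rmorphM (@oval _ _ F)); apply: in_maxMl => //; exact: ovalP.
apply/asboolP; exists (MkInteger (integer_unit pi_unif (ovalP (\det a)) na)).
apply: val_inj; apply: etrans (rmorphM (@oval _ _ F) _ _) _.
rewrite /= mulVf; first exact/esym/(rmorph1 (@oval _ _ F)).
by apply: contraNneq na => ->; exact: in_max0.
Qed.

Definition G0 : set G := [set g : G | integral_mx (glmx g) /\ integral_mx (g^-1)%g].

Lemma G0_subgroup : is_subgroup G0.
Proof.
split=> [|g h [ig ig'] [ih ih']|g [ig ig']]; split; rewrite ?invg1 ?invgM ?invgK //.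
- exact: integral_mx1.
- exact: integral_mx1.
- exact: integral_mxM.
- exact: integral_mxM.
Qed.

Lemma G0P g : G0 g <-> GL_integers g.
Proof.
split=> [[/integral_mx_lift[a ga] /integral_mx_lift[a' ga']]|[a ua ga]].
  exists a => //; suff /mulmx1_unit[] : a *m a' = 1%:M by [].
  have := congr1 (@glmx _ _) (mulgV g); rewrite /= [X in X *m _]ga [X in _ *m X]ga' -map_mxM.
  rewrite -(map_mx1 (@oval _ _ F)); exact: oval_mx_inj.
split=> [i j|]; first by rewrite ga mxE ovalP.
suff -> : glmx (g^-1)%g = map_mx (@oval _ _ F) (invmx a) by move=> i j; rewrite mxE ovalP.
apply: (can_inj (mulKmx (glmxP g))).
have := congr1 (@glmx _ _) (mulgV g); rewrite /= => ->.
by rewrite ga -map_mxM mulmxV // map_mx1.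
Qed.

Lemma G0_red g : integral_mx g -> redmx g \in unitmx -> G0 g.
Proof.
move=> /integral_mx_lift [a ga]; rewrite ga redmx_map -unitmx_residue => ua.
by apply/G0P; exists a.
Qed.

Lemma G0_redmx g : G0 g -> redmx g \in unitmx.
Proof. by move=> /G0P [a ua ->]; rewrite redmx_map -unitmx_residue. Qed.

Lemma G0_redmxM g h : G0 g -> G0 h -> redmx (g * h)%g = redmx g *m redmx h.
Proof. by move=> [ig _] [ih _]; apply: redmxM. Qed.

Lemma G0_redmxV g : G0 g -> redmx (g^-1)%g = invmx (redmx g).
Proof.
move=> Gg; have [_ _ GV] := G0_subgroup; apply: (can_inj (mulKmx (G0_redmx Gg))).
by rewrite -G0_redmxM ?mulgV ?mulmxV ?redmx1 ?G0_redmx //; exact: GV.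
Qed.

Definition U1 : set G := [set g : G | G0 g /\ redmx g = 1%:M].

Lemma U1P g : principal_congruence n kF g <-> U1 g.
Proof.
split=> [[a [ua ga ra]]|[/G0P [a ua ga] rg]].
  by split; [apply/G0P; exists a | rewrite ga redmx_map].
by exists a; split=> //; rewrite -redmx_map -ga.
Qed.

Lemma cong1_red (A : 'M[F]_n) : cong1 pi A <-> integral_mx A /\ redmx A = 1%:M.
Proof.
split=> [cA|[iA rA] i j].
  have iA : integral_mx A.
    move=> i j; rewrite -[A i j](subrK (i == j)%:R) rpredD ?rpred_nat //.
    exact: (in_max_integer pi_unif) (cA i j).
  split=> //; apply/matrixP => i j; rewrite !mxE; apply/eqP.
  have -> : (i == j)%:R = red kF (i == j)%:R by case: (i == j); rewrite ?red0 ?red1.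
  by rewrite (red_eq pi_unif) ?rpred_nat.
rewrite -(red_eq pi_unif kF) ?rpred_nat ?iA //.
have /matrixP/(_ i j) := rA; rewrite !mxE => ->.
by case: (i == j); rewrite ?red0 ?red1.
Qed.

Lemma U1_cong1 g : U1 g <-> cong1 pi g.
Proof.
split=> [[[ig _] rg]|/cong1_red [ig rg]]; first exact/cong1_red.
by split=> //; apply: G0_red => //; rewrite rg unitmx1.
Qed.

(** U1, the Iwahori subgroup and the groups N_P(o) U1 and N_P^-(o) U1 are all inverse images of this
    form. *)
Definition redsub (S : set 'M[kF]_n) : set G := [set g : G | G0 g /\ S (redmx g)].

Lemma redsub_subgroup (S : set 'M[kF]_n) : S 1%:M ->
  (forall A C, S A -> S C -> S (A *m C)) ->
  (forall A, A \in unitmx -> S A -> S (invmx A)) -> is_subgroup (redsub S).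
Proof.
move=> S1 SM SV; have [G1 GM GV] := G0_subgroup; split=> [|g h [Gg Sg] [Gh Sh]|g [Gg Sg]].
- by split=> //; rewrite redmx1.
- by split; [exact: GM | rewrite G0_redmxM //; exact: SM].
- by split; [exact: GV | rewrite G0_redmxV //; apply: SV => //; exact: G0_redmx].
Qed.

Lemma U1_subgroup : is_subgroup U1.
Proof.
apply: (@redsub_subgroup [set 1%:M]) => //= [A C -> ->|A _ ->]; first by rewrite mulmx1.
by rewrite invmx1.
Qed.

Lemma U1_conj g u : G0 g -> U1 u -> U1 (g^-1 * u * g)%g.
Proof.
have [G1 GM GV] := G0_subgroup => Gg [Gu ru]; have Gg' := GV _ Gg.
have G1' := GM _ _ Gg' Gu; split; first exact: GM.
by rewrite !G0_redmxM // ru mulmx1 G0_redmxV // mulVmx ?G0_redmx.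
Qed.

(** The factor b is g with the entries below the diagonal deleted. It has the same reduction as g,
    which makes it invertible over O and puts g b^-1 in U1. *)
Lemma red_upper_factor g : G0 g -> upmx (redmx g) ->
  exists u b, [/\ U1 u, Bo b, G0 b & g = (u * b)%g].
Proof.
have [G1 GM GV] := G0_subgroup => Gg ug; have [ig _] := Gg.
pose A : 'M[F]_n := \matrix_(i, j) (if (j < i)%N then 0 else g i j).
have iA : integral_mx A by move=> i j; rewrite mxE; case: ifP => // _; rewrite rpred0.
have rA : redmx A = redmx g.
  apply/matrixP => i j; rewrite !mxE; case: ifP => // ji; rewrite red0.
  by have := ug i j ji; rewrite mxE.
have uA : A \in unitmx.
  have [a aE] := integral_mx_lift iA; rewrite aE; suff ua : a \in unitmx.
    rewrite unitmxE det_map_mx; exact: rmorph_unit.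
  by rewrite unitmx_residue -redmx_map -aE rA G0_redmx.
pose b : G := MkGL uA; have Gb : G0 b by apply: G0_red => //=; rewrite rA G0_redmx.
exists (g * b^-1)%g, b; split=> //.
- split; first exact/GM/GV.
  rewrite G0_redmxM //; last exact: GV.
  by rewrite G0_redmxV // /= rA mulmxV ?G0_redmx.
- by move=> i j ji; rewrite mxE ji.
by rewrite mulgVK.
Qed.
End Subgroups.

(** * Compactness of GL_n(O) *)

Lemma transversal_of_cover (T : eqType) (P : T -> Prop) (R : T -> T -> Prop) (s : seq T) :
  (forall x, P x -> R x x) -> (forall x y, P x -> P y -> R x y -> R y x) ->
  (forall x y z, P x -> P y -> P z -> R x y -> R y z -> R x z) ->
  (forall x, x \in s -> P x) -> (forall g, P g -> exists2 x, x \in s & R x g) ->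
  exists X : seq T, [/\ uniq X, forall x, x \in X -> P x,
    forall g, P g -> exists2 x, x \in X & R x g &
    forall x y, x \in X -> y \in X -> R x y -> x = y].
Proof.
move=> Rr Rs Rt sP cov.
suff [X [uX XP h pw]] : exists X : seq T, [/\ uniq X, forall x, x \in X -> P x,
    forall y, y \in s -> exists2 x, x \in X & R x y &
    forall x y, x \in X -> y \in X -> R x y -> x = y].
  exists X; split=> // g Pg; have [y ys Ryg] := cov g Pg; have [x xX Rxy] := h y ys.
  by exists x => //; apply: Rt Rxy Ryg; auto.
elim: s sP {cov} => [|y s IH] sP; first by exists [::].
have [|X [uX XP h pw]] := IH; first by move=> x xs; apply: sP; rewrite inE xs orbT.
have Py : P y by apply: sP; rewrite inE eqxx.
have [[x xX Rxy]|no] := pselect (exists2 x, x \in X & R x y).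
  by exists X; split=> // z; rewrite inE => /orP[/eqP ->|/h //]; exists x.
exists (y :: X); split=> /=.
- by rewrite uX andbT; apply/negP => yX; apply: no; exists y => //; exact: Rr.
- by move=> x; rewrite inE => /orP[/eqP -> //|/XP].
- move=> z; rewrite inE => /orP[/eqP ->|/h [x xX Rxz]].
    by exists y; [rewrite inE eqxx | exact: Rr].
  by exists x => //; rewrite inE xX orbT.
move=> x z; rewrite !inE => /orP[/eqP ->|xX] /orP[/eqP ->|zX] Rxz //.
- by case: no; exists z => //; apply: Rs => //; exact: XP.
- by case: no; exists x.
- exact: pw.
Qed.

Section Compactness.
Variables (p : nat) (p_pr : prime p) (F : fieldExtType (Qp p_pr)) (pi : F).
Hypothesis pi_unif : uniformizer pi.
Variables (kF : residueField (integers F)) (n : nat).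
Local Notation O := (@isInteger p p_pr F).
Local Notation G := (GLn F n).
Implicit Types g h x b u : G.

Lemma in_pOP m (y : F) : in_pO m y <-> y / p%:R ^+ m \in O.
Proof.
have p0 := expf_neq0 m (F_p_neq0 F); split=> [[z ->]|iy].
  by rewrite mulrAC divff // mul1r ovalP.
by exists (MkInteger iy) => /=; rewrite mulrC divfK.
Qed.

Definition pcong m : set G := [set u : G | forall i j, in_pO m ((glmx u - 1%:M) i j)].

Lemma integral_mxZ (a : F) (A : 'M[F]_n) : a \in O -> integral_mx A -> integral_mx (a *: A).
Proof. by move=> ia iA i j; rewrite mxE rpredM ?iA. Qed.

Lemma integral_mxD (A C : 'M[F]_n) : integral_mx A -> integral_mx C -> integral_mx (A + C).
Proof. by move=> iA iC i j; rewrite mxE rpredD ?iA ?iC. Qed.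

Lemma pcongP m u : pcong m u <-> exists Y : 'M[F]_n, integral_mx Y /\ glmx u = 1%:M + p%:R ^+ m *: Y.
Proof.
split=> [h|[Y [iY uY]] i j].
  exists (p%:R ^- m *: (glmx u - 1%:M)); split.
    by move=> i j; rewrite mxE mulrC; apply/in_pOP.
  by rewrite scalerA divff ?expf_neq0 ?F_p_neq0 // scale1r subrKC.
rewrite uY addrAC subrr add0r mxE; apply/in_pOP.
by rewrite mulrAC divff ?mul1r ?iY // expf_neq0 // F_p_neq0.
Qed.

Lemma pcongM m u v : pcong m u -> pcong m v -> pcong m (u * v)%g.
Proof.
move=> /pcongP [Y [iY uY]] /pcongP [Z [iZ vZ]]; apply/pcongP; exists (Y *m glmx v + Z); split.
  apply: integral_mxD => //; apply: integral_mxM => //; rewrite vZ; apply: integral_mxD (@integral_mx1 _ _ _ _) _.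
  by apply: integral_mxZ => //; rewrite rpredX ?rpred_nat.
rewrite /= uY mulmxDl mul1mx -scalemxAl {1}vZ scalerDr -addrA; congr (_ + _).
by rewrite addrC.
Qed.

Lemma pcong_le m k u : (k <= m)%N -> pcong m u -> pcong k u.
Proof.
move=> km /pcongP [Y [iY uY]]; apply/pcongP; exists (p%:R ^+ (m - k) *: Y); split.
  by apply: integral_mxZ => //; rewrite rpredX ?rpred_nat.
by rewrite scalerA -exprD subnKC.
Qed.

Lemma cong1_scale (Y : 'M[F]_n) (a : F) : in_max pi a -> integral_mx Y -> cong1 pi (1%:M + a *: Y).
Proof.
by move=> ma iY i j; rewrite !mxE addrAC subrr add0r; exact: in_maxMr (iY i j).
Qed.

Lemma in_max_pX m : in_max pi (p%:R ^+ m.+1 : F).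
Proof. by rewrite exprS; apply: in_maxMr (in_max_p pi_unif) _; rewrite rpredX ?rpred_nat. Qed.

(** The shift by one matters: [pcong 0] contains every invertible matrix with integral entries, even
    when its inverse is not integral. *)
Lemma pcong_U1 m u : pcong m.+1 u -> U1 kF u.
Proof.
move=> /pcongP [Y [iY uY]]; apply/(U1_cong1 pi_unif); rewrite uY.
by apply: cong1_scale => //; exact: in_max_pX.
Qed.

Lemma integral_mx_denom (A : 'M[F]_n) : exists m, integral_mx (p%:R ^+ m *: A).
Proof.
have [c cP] := choice (fun u : 'I_n * 'I_n => p_pow_denom pi_unif (A u.1 u.2)).
exists (\sum_u c u)%N => i j; rewrite mxE (bigD1 (i, j)) //= addnC exprD -mulrA rpredM //.
  by rewrite rpredX ?rpred_nat.
exact: (cP (i, j)).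
Qed.

Lemma pcong_conj x : exists m, forall u, pcong m u -> U1 kF (x * u * x^-1)%g.
Proof.
have [a ia] := integral_mx_denom x; have [c ic] := integral_mx_denom (x^-1)%g.
(* The exponents a and c absorb the denominators of x and x^-1; the remaining factor p puts the
   conjugate in U1. *)
exists (a + c).+1 => u /pcongP [Y [iY uY]]; apply/(U1_cong1 pi_unif).
suff -> : glmx (x * u * x^-1)%g =
    1%:M + p%:R *: ((p%:R ^+ a *: glmx x) *m Y *m (p%:R ^+ c *: glmx (x^-1)%g)).
  apply: cong1_scale; first exact: in_max_p.
  by apply: integral_mxM => //; apply: integral_mxM.
rewrite /= uY mulmxDr mulmx1 mulmxDl mulmxV ?glmxP //; congr (_ + _).
by rewrite -!scalemxAr -!scalemxAl !scalerA exprS exprD mulrCA mulrC mulrA mulrAC.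
Qed.

(** The limit is taken entrywise. It is invertible over O because its reduction is that of some
    member of the sequence. *)
Lemma G0_limit U (x : nat -> G) : free_ultrafilter U -> (forall j, G0 (x j)) ->
  exists2 z, G0 z & forall m, U [set j | pcong m (z^-1 * x j)%g].
Proof.
move=> FU Gx; have [UU _] := FU.
have ix (u : 'I_n * 'I_n) j : x j u.1 u.2 \in O by have [h _] := Gx j; exact: h.
have lim (u : 'I_n * 'I_n) : exists z, z \in O /\
    forall m, U [set j | (x j u.1 u.2 - z) / p%:R ^+ m \in O].
  by have [z iz zP] := integers_limit FU (ix u); exists z.
have [z zP] := choice lim.
pose Z : 'M[F]_n := \matrix_(i, j) z (i, j).
have iZ : integral_mx Z by move=> i j; rewrite mxE; have [] := zP (i, j).
have close m : U [set j | integral_mx (p%:R ^- m *: (glmx (x j) - Z))].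
  have : U [set j | forall u : 'I_n * 'I_n, (x j u.1 u.2 - z u) / p%:R ^+ m \in O].
    by apply: filter_forall => u; have [_ h] := zP u; exact: h.
  by apply: filterS => j h i k; have := h (i, k); rewrite !mxE mulrC.
have rZ : redmx kF Z \in unitmx.
  have [j] := filter_ex (close 1%N); rewrite expr1 => h.
  suff -> : redmx kF Z = redmx kF (glmx (x j)) by exact: (G0_redmx pi_unif).
  apply/matrixP => i k; rewrite !mxE; apply/esym/eqP; rewrite (red_eq pi_unif) ?(ix (i, k)) //.
    rewrite -[_ - _](mulVKf (F_p_neq0 F)); apply: in_maxMr (in_max_p pi_unif) _.
    by have := h i k; rewrite !mxE.
  by have := iZ i k; rewrite mxE.
have uZ : Z \in unitmx.
  have [a aE] := integral_mx_lift iZ; rewrite aE.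
  by rewrite unitmxE det_map_mx rmorph_unit // -unitmxE (unitmx_residue pi_unif kF) -redmx_map -aE.
have Gz : G0 (MkGL uZ : G) by apply: (G0_red pi_unif (kF := kF)).
exists (MkGL uZ) => // m; apply: filterS (close m) => j h; apply/pcongP.
have [_ iz'] := Gz; exists (glmx ((MkGL uZ : G)^-1)%g *m (p%:R ^- m *: (glmx (x j) - Z))).
split; first exact: integral_mxM.
rewrite -scalemxAr scalerA divff ?expf_neq0 ?F_p_neq0 // scale1r /= mulmxBr mulVmx //.
by rewrite subrKC.
Qed.

(** If finitely many cosets of Q never sufficed, one could choose greedily a sequence in GL_n(O)
    with pairwise distinct cosets; but two of its terms are close to a common limit, hence in the
    same coset of the open subgroup Q. *)
Lemma finite_transversal (Q : set G) m : is_subgroup Q -> pcong m `<=` Q ->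
  exists X : seq G, [/\ uniq X, forall x, x \in X -> G0 x,
    forall g, G0 g -> exists2 x, x \in X & Q (x^-1 * g)%g &
    forall x y, x \in X -> y \in X -> Q (x^-1 * y)%g -> x = y].
Proof.
move=> [Q1 QM QV] KQ.
suff [s sG cov] : exists2 s : seq G, (forall x, x \in s -> G0 x) &
    forall g, G0 g -> exists2 x, x \in s & Q (x^-1 * g)%g.
  apply: (@transversal_of_cover _ (@G0 _ _ F n) (fun x y => Q (x^-1 * y)%g) s) => //.
  - by move=> x _; rewrite mulVg.
  - by move=> x y _ _ /QV; rewrite invgM invgK.
  - by move=> x y z _ _ _ h1 h2; have := QM _ _ h1 h2; rewrite mulgA mulgK.
apply: contrapT => /forall2NP h.
have next (s : seq G) : exists g, (forall x, x \in s -> G0 x) ->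
    G0 g /\ forall x, x \in s -> ~ Q (x^-1 * g)%g.
  have [sG|sG] := pselect (forall x, x \in s -> G0 x); last by exists 1%g => /sG.
  have [/(_ sG)//|ns] := h s.
  have [[g [Gg gP]]|no] := pselect (exists g, G0 g /\ forall x, x \in s -> ~ Q (x^-1 * g)%g).
    by exists g.
  case: ns => g Gg; apply: contrapT => /forall2NP hx; apply: no; exists g; split=> // x xs.
  by case: (hx x).
have [f fP] := choice next.
pose s := fix s k := if k is k'.+1 then f (s k') :: s k' else [::].
have sG k : forall x, x \in s k -> G0 x.
  elim: k => [//|k IH] x; rewrite inE => /orP[/eqP ->|/IH //].
  by have [] := fP _ IH.
pose x k := f (s k).
have Gx k : G0 (x k) by have [] := fP _ (sG k).
have xs j k : (j < k)%N -> x j \in s k.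
  elim: k => [//|k IH]; rewrite ltnS leq_eqVlt inE => /orP[/eqP ->|/IH ->]; rewrite ?eqxx ?orbT //.
have [U FU] := free_ultrafilter_exists.
have [z Gz zP] := G0_limit FU Gx.
have [j _ /KQ zj] := free_ultrafilter_inf 0 FU (zP m).
have [k jk /KQ zk] := free_ultrafilter_inf j.+1 FU (zP m).
have [_ /(_ _ (xs _ _ jk))] := fP _ (sG k); apply.
by have := QM _ _ (QV _ zj) zk; rewrite invgM invgK mulgA mulgK.
Qed.

Lemma uniformly_locally_constant (A : Type) (f : G -> A) : locally_constant f ->
  exists m, forall x u, G0 x -> pcong m u -> f (x * u)%g = f x.
Proof.
move=> lf; apply: contrapT => /forallNP h.
have ex m : exists xu : G * G, [/\ G0 xu.1, pcong m xu.2 & f (xu.1 * xu.2)%g <> f xu.1].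
  apply: contrapT => /forallNP hm; apply: (h m) => x u Gx Ku.
  by apply: contrapT => ne; apply: (hm (x, u)).
have [xu xuP] := choice ex.
have Gx k : G0 (xu k).1 by have [] := xuP k.
have [U FU] := free_ultrafilter_exists.
have [z Gz zP] := G0_limit FU Gx; have [m mP] := lf z.
have [j mj zj] := free_ultrafilter_inf m FU (zP m).
have [_ Ku] := xuP j; apply; have {}Ku := pcong_le mj Ku.
rewrite -[(xu j).1](mulVKg z) -[in LHS]mulgA !mP //.
exact: pcongM.
Qed.
End Compactness.

(** * Functions supported on a double coset H w B *)

Lemma upuni_unit (R : fieldType) n (A : 'M[R]_n) :
  upmx A -> (forall i, A i i = 1) -> A \in unitmx.
Proof.
move=> uA dA; rewrite -unitmx_tr unitmxE unitfE det_trig; last first.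
  by apply/is_trig_mxP => j k jk; rewrite mxE uA.
by rewrite big1 ?oner_neq0 // => i _; rewrite mxE dA.
Qed.

Section PrincipalSeries.
Variables (p : nat) (p_pr : prime p) (F K : fieldExtType (Qp p_pr)) (pi : F).
Hypothesis pi_unif : uniformizer pi.
Variables (kF : residueField (integers F)) (kK : residueField (integers K)) (n : nat).
Variable chi : 'I_n -> smoothChar F kK.
Local Notation O := (@isInteger p p_pr F).
Local Notation G := (GLn F n).
Local Notation Bo := (upper F n).
Local Notation V := (Ind chi).
Local Notation act := (Ind_act chi).
Local Notation chB := (borel_char chi).
Local Notation U1 := (@U1 _ _ F kF n).
Implicit Types (g h x b u w : G) (f : V).

Lemma borel_charM b b' : Bo b -> Bo b' -> chB (b * b')%g = chB b * chB b'.
Proof.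
move=> ub ub'; rewrite /borel_char -big_split /=; apply: eq_bigr => i _.
by rewrite upmx_diagM // scharM ?upper_diag_neq0.
Qed.

Lemma borel_char_neq0 b : Bo b -> chB b != 0.
Proof.
by move=> ub; apply/prodf_neq0 => i _; rewrite schar_neq0 ?upper_diag_neq0.
Qed.

Lemma borel_char1 : chB 1%g = 1.
Proof. by apply: big1 => i _; rewrite /= mxE eqxx schar1. Qed.

Lemma borel_charV b : Bo b -> chB (b^-1)%g = (chB b)^-1.
Proof.
move=> ub; have [_ _ BV] := upper_subgroup F n; apply: (mulfI (borel_char_neq0 ub)).
by rewrite -borel_charM ?mulgV ?borel_char1 ?divff ?borel_char_neq0 //; exact: BV.
Qed.

Lemma borel_char_1max b : (forall i, in_max pi (b i i - 1)) -> chB b = 1.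
Proof. move=> bi; apply: big1 => i _; by apply: (schar_1max pi_unif); exact: bi. Qed.

Lemma IndM f g b : Bo b -> f (g * b)%g = (chB b)^-1 * f g.
Proof. by have /asboolP[_] := indfunP f; apply. Qed.

Lemma Ind_eq f f' : (forall g, f g = f' g) -> f = f'.
Proof. by move=> e; apply/val_inj/funext. Qed.

Lemma actE g f x : act g f x = f (g^-1 * x)%g. Proof. by []. Qed.

Lemma actM g h f : act (g * h)%g f = act g (act h f).
Proof. by apply: Ind_eq => x; rewrite !actE invgM mulgA. Qed.

Lemma act1 f : act 1%g f = f.
Proof. by apply: Ind_eq => x; rewrite actE invg1 mul1g. Qed.

Lemma IndZE (a : kK) f g : (a *: f) g = a * f g. Proof. by []. Qed.
Lemma Ind_sumE (I : Type) (r : seq I) (P : pred I) (f : I -> V) g :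
  (\sum_(i <- r | P i) f i) g = \sum_(i <- r | P i) f i g.
Proof. exact: (big_morph (fun f : V => f g)). Qed.

Lemma act_linear g : linear (act g).
Proof. by move=> a f f'; apply: Ind_eq => x. Qed.

Definition perm_elt (s : 'S_n) : G := MkGL (unitmx_perm F s).

Lemma perm_elt_G0 s : G0 (perm_elt s).
Proof.
apply: (G0_red pi_unif (kF := kF)) => [i j|]; first by rewrite /= !mxE rpred_nat.
suff -> : redmx kF (glmx (perm_elt s)) = perm_mx s by exact: unitmx_perm.
by apply/matrixP => i j; rewrite !mxE; case: (_ == _); rewrite ?red0 ?red1.
Qed.

Lemma redmx_perm s : redmx kF (glmx (perm_elt s)) = perm_mx s.
Proof. by apply/matrixP => i j; rewrite !mxE; case: (_ == _); rewrite ?red0 ?red1. Qed.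

Lemma bruhat g : exists l s b, [/\ G0 l, upmx (redmx kF (glmx l)),
  forall i, redmx kF (glmx l) i i = 1, Bo b & g = (l * perm_elt s * b)%g].
Proof.
have [A [s [b [iA ub gE]]]] := iwasawa_bruhat pi_unif (glmxP g).
have [OA uA dA] : [/\ integral_mx A, upmx (redmx kF A) & forall i, redmx kF A i i = 1].
  have OA : integral_mx A by move=> i j; have [] := iA i j.
  split=> // [i j ji|i]; rewrite mxE; apply/eqP.
    have [_ /(_ (ltnW ji))] := iA i j; rewrite (red_eq0 pi_unif) ?OA //.
    by case: eqP ji => [->|_ _]; rewrite ?ltnn ?subr0.
  have [_ /(_ (leqnn i))] := iA i i; rewrite eqxx -(red1 kF) (red_eq pi_unif) ?OA ?rpred1 //.
have uR : redmx kF A \in unitmx by exact: upuni_unit.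
have := glmxP g; rewrite gE !unitmx_mul => /andP[/andP[uA' _] ub'].
exists (MkGL uA'), s, (MkGL ub'); split=> //; first exact: (G0_red pi_unif (kF := kF)).
exact: val_inj.
Qed.

Lemma iwasawa g : exists x b, [/\ G0 x, Bo b & g = (x * b)%g].
Proof.
have [l [s [b [Gl _ _ ub gE]]]] := bruhat g; have [_ GM _] := G0_subgroup F n.
by exists (l * perm_elt s)%g, b; split=> //; apply: GM Gl _; exact: perm_elt_G0.
Qed.

Lemma Ind_eqG0 f f' : (forall g, G0 g -> f g = f' g) -> f = f'.
Proof.
move=> e; apply: Ind_eq => g; have [x [b [Gx ub ->]]] := iwasawa g.
by rewrite !IndM ?e.
Qed.

(** Left invariance under U1 gives local constancy, since x u = (x u x^-1) x and x u x^-1 lies in U1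
    for u close to 1. *)
Lemma inInd_U1 (f : G -> kK) : (forall u g, U1 u -> f (u * g)%g = f g) ->
  (forall g b, Bo b -> f (g * b)%g = (chB b)^-1 * f g) -> (f : G -> kK^o) \in inInd chi.
Proof.
move=> fU fB; apply/asboolP; split=> [x|//].
have [m mP] := pcong_conj pi_unif kF x; exists m => u /mP Uu.
by rewrite -[RHS](fU _ _ Uu) mulgVK.
Qed.

(* chi is trivial on w^-1 H w \cap B, so that a function supported on H w B can be
   prescribed by its value at w. *)
Definition adapted (H : set G) w :=
  is_subgroup H /\ forall h b, H h -> Bo b -> (h * w = w * b)%g -> chB b = 1.

(** The function is prescribed on H w B and extended by 0. If h w b = h' w b', then h'^-1 h w = w b'
    b^-1, and [adapted] says that both expressions prescribe the same value. *)
Lemma cell_exists (H : set G) w : adapted H w -> U1 `<=` H ->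
  exists f, [/\ forall h b, H h -> Bo b -> f (h * w * b)%g = (chB b)^-1,
    forall g, f g != 0 -> exists h b, [/\ H h, Bo b & g = (h * w * b)%g] &
    forall h, H h -> act h f = f].
Proof.
move=> [[H1 HM HV] ad] UH; have [B1 BM BV] := upper_subgroup F n.
pose D g := exists hb : G * G, [/\ H hb.1, Bo hb.2 & g = (hb.1 * w * hb.2)%g].
pose f g : kK := if pselect (D g) is left ex then (chB (projT1 (cid ex)).2)^-1 else 0.
have fE h b : H h -> Bo b -> f (h * w * b)%g = (chB b)^-1.
  move=> Hh ub; rewrite /f; case: pselect => [ex|[]]; last by exists (h, b).
  case: (cid ex) => -[h' b'] /= [Hh' ub' e].
  have := ad (h'^-1 * h)%g (b' * b^-1)%g (HM _ _ (HV _ Hh') Hh) (BM _ _ ub' (BV _ ub)).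
  rewrite borel_charM ?borel_charV //; last exact: BV.
  move=> e'; apply/invr_inj; apply: (mulIf (invr_neq0 (borel_char_neq0 ub))); rewrite !invrK.
  rewrite divff ?borel_char_neq0 // e' //.
  apply: (mulgI h'); apply: (mulIg b); rewrite !mulgA mulgV mul1g e.
  by rewrite mulgVK.
have f0 g : f g != 0 -> exists h b, [/\ H h, Bo b & g = (h * w * b)%g].
  rewrite /f; case: pselect => [[[h b] /= ?] _|]; [by exists h, b | by rewrite eqxx].
have fl h g : H h -> f (h * g)%g = f g.
  have aux h' g' : H h' -> f g' != 0 -> f (h' * g')%g = f g'.
    move=> Hh' /f0 [k [b [Hk ub ->]]].
    by rewrite !mulgA -[(h' * k * w * b)%g]/((h' * k)%g * w * b)%g !fE //; exact: HM.
  (* Off the support, [aux] is applied to the inverse of h: a nonzero value at h g would propagate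
     back to g. *)
  move=> Hh; have [g0|/aux ->//] := eqVneq (f g) 0.
  rewrite g0; apply/eqP/negPn/negP => hg; have := aux _ _ (HV _ Hh) hg.
  by rewrite mulKg g0 => e; rewrite -e eqxx in hg.
have fr g b : Bo b -> f (g * b)%g = (chB b)^-1 * f g.
  have aux g' b' : Bo b' -> f g' != 0 -> f (g' * b')%g = (chB b')^-1 * f g'.
    move=> ub' /f0 [k [c [Hk uc ->]]].
    by rewrite -[in LHS]mulgA !fE ?borel_charM ?invfM 1?mulrC //; exact: BM.
  move=> ub; have [g0|/aux ->//] := eqVneq (f g) 0.
  rewrite g0 mulr0; apply/eqP/negPn/negP => hg; have := aux _ _ (BV _ ub) hg.
  rewrite mulgK g0 => /esym/eqP; rewrite mulf_eq0 (negbTE hg) orbF invr_eq0.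
  by rewrite (negbTE (borel_char_neq0 (BV _ ub))).
have fI := @inInd_U1 f (fun u g Uu => fl u g (UH _ Uu)) fr.
exists (MkInd fI); split=> // h Hh.
by apply: Ind_eq => g; exact: fl (HV _ Hh).
Qed.
End PrincipalSeries.

(** * Generic ranks *)

Section BlockUnipotent.
Variables (R : fieldType) (n : nat).
Implicit Types (P Q : pred 'I_n) (A X Y : 'M[R]_n) (s : 'S_n).

Definition proj_mx P : 'M[R]_n := \matrix_(i, j) (P i && (i == j))%:R.

Lemma proj_mxMl P X i j : (proj_mx P *m X) i j = (P i)%:R * X i j.
Proof.
rewrite mxE (bigD1 i) //= mxE eqxx andbT big1 ?addr0 // => k ki.
by rewrite mxE eq_sym (negbTE ki) andbF mul0r.
Qed.

Lemma proj_mxMr P X i j : (X *m proj_mx P) i j = X i j * (P j)%:R.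
Proof.
rewrite mxE (bigD1 j) //= mxE eqxx andbT big1 ?addr0 // => k ki.
by rewrite mxE (negbTE ki) andbF mulr0.
Qed.

(** For P the set of indices at least i and Q its complement, this is the unipotent radical of the
    lower block parabolic; exchanging P and Q gives the upper one. *)
Definition blockuni P Q A := forall i j, ~~ (P i && Q j) -> A i j = (i == j)%:R.

Lemma blockuniP P Q A : blockuni P Q A <->
  exists X, A = 1%:M + proj_mx P *m X *m proj_mx Q.
Proof.
split=> [h|[X ->] i j].
  exists (A - 1%:M); apply/matrixP => i j; rewrite mxE proj_mxMr proj_mxMl !mxE.
  have [/andP[-> ->]|/h ->] := boolP (P i && Q j); first by rewrite mul1r mulr1 subrKC.
  by rewrite subrr mulr0 mul0r addr0.
rewrite mxE proj_mxMr proj_mxMl !mxE negb_and => /orP[] /negbTE ->; by rewrite ?mulr0 ?mul0r addr0.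
Qed.

Section Group.
Variables P Q : pred 'I_n.
Hypothesis PQ : forall i, ~~ (P i && Q i).

Lemma proj_mx_disj : proj_mx Q *m proj_mx P = 0.
Proof.
apply/matrixP => i j; rewrite proj_mxMl !mxE; have := PQ i.
by case: (P i); case: (Q i); rewrite ?mulr0 ?mul0r.
Qed.

Lemma blockuni1 : blockuni P Q 1%:M.
Proof. by move=> i j _; rewrite mxE. Qed.

Lemma blockuniM A X : blockuni P Q A -> blockuni P Q X -> blockuni P Q (A *m X).
Proof.
move=> /blockuniP [Y ->] /blockuniP [Z ->]; apply/blockuniP; exists (Y + Z).
rewrite mulmxDl mul1mx mulmxDr mulmx1 mulmxDr mulmxDl addrAC -addrA; congr (_ + _).
rewrite !mulmxA -[_ *m proj_mx Q *m proj_mx P]mulmxA proj_mx_disj mulmx0 !mul0mx addr0.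
by rewrite addrC.
Qed.

Lemma blockuni_inv A : A \in unitmx -> blockuni P Q A -> blockuni P Q (invmx A).
Proof.
move=> uA /blockuniP [Y AE]; apply/blockuniP; exists (- Y).
apply: (can_inj (mulKmx uA)); rewrite mulmxV // AE mulmxDl mul1mx mulmxDr mulmx1.
rewrite mulmxN mulNmx mulmxN !mulmxA -[_ *m proj_mx Q *m proj_mx P]mulmxA proj_mx_disj mulmx0 !mul0mx.
by rewrite oppr0 addr0 subrK.
Qed.

Lemma blockuni_unit A : blockuni P Q A -> A \in unitmx.
Proof.
move=> /blockuniP [Y AE].
suff /mulmx1_unit[] : A *m (1%:M - proj_mx P *m Y *m proj_mx Q) = 1%:M by [].
rewrite AE mulmxDl mul1mx mulmxBr mulmx1.
rewrite !mulmxA -[_ *m proj_mx Q *m proj_mx P]mulmxA proj_mx_disj mulmx0 !mul0mx.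
by rewrite subr0 subrK.
Qed.
End Group.

Lemma perm_mxMl s X i j : (perm_mx s *m X) i j = X (s i) j.
Proof. by rewrite -row_permE mxE. Qed.

Lemma perm_mxMr s X i j : (X *m perm_mx s) i j = X i ((s^-1)%g j).
Proof. by rewrite -{1}(invgK s) -col_permE mxE. Qed.

(** An upper triangular matrix on the right replaces the first j + 1 columns by combinations of
    themselves. *)
Lemma rank_upmx A (c : 'M[R]_n) (j : 'I_n) : upmx c ->
  (\rank (A *m c *m proj_mx [pred k : 'I_n | (k <= j)%N]) <=
   \rank (A *m proj_mx [pred k : 'I_n | (k <= j)%N]))%N.
Proof.
move=> uc; set q := proj_mx _.
have -> : A *m c *m q = A *m q *m (c *m q); last exact: mxrankM_maxl.
rewrite -!mulmxA; congr (_ *m _); apply/matrixP => k l; rewrite proj_mxMl proj_mxMr /=.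
have [kj|jk] := leqP k j; first by rewrite mul1r.
rewrite mul0r; have [lj|jl] := leqP l j; rewrite ?mulr0 // uc ?mul0r //.
exact: leq_ltn_trans jk.
Qed.

Section Genericity.
Variable P : pred 'I_n.
Local Notation e' := (proj_mx P).
Local Notation q j := (proj_mx [pred k : 'I_n | (k <= j)%N]).

(** The flag of A consists of the spans of its first j + 1 columns; summed here are the dimensions
    of the projections of these spans to the coordinates in P. The more general the position, the
    larger the sum. *)
Definition generic_rank A := (\sum_(j < n) \rank (e' *m A *m q j))%N.

Lemma generic_rank_le A : (generic_rank A <= n * n)%N.
Proof.
rewrite -[X in (_ <= X * _)%N]card_ord -sum_nat_const; apply: leq_sum => j _.
exact: rank_leq_row.
Qed.

Lemma generic_rank_upmxr A (c : 'M[R]_n) : upmx c ->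
  (generic_rank (A *m c) <= generic_rank A)%N.
Proof. by move=> uc; apply: leq_sum => j _; rewrite mulmxA rank_upmx. Qed.

(** The condition on l makes the rows of l A indexed by P combinations of the rows of A indexed by
    P. *)
Lemma generic_rank_l A (l : 'M[R]_n) : (forall i j, P i -> ~~ P j -> l i j = 0) ->
  (generic_rank (l *m A) <= generic_rank A)%N.
Proof.
move=> lP; apply: leq_sum => j _.
have -> : e' *m (l *m A) *m q j = e' *m l *m (e' *m A *m q j); last exact: mxrankM_maxr.
rewrite !mulmxA; congr (_ *m _ *m _); apply/matrixP => i k; rewrite proj_mxMr !proj_mxMl.
have [Pi|_] := boolP (P i); last by rewrite !mul0r.
by have [Pk|nk] := boolP (P k); rewrite ?mulr1 // lP // mulr0 mul0r.
Qed.

(* e' w q is e' N w q times a projection, so each rank can only increase; if none does, the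
   column spaces agree, which forces w^-1 N w to be upper triangular. *)
Lemma generic_rank_blockuni (N : 'M[R]_n) s : blockuni P (predC P) N ->
  (generic_rank (perm_mx s) <= generic_rank (N *m perm_mx s))%N /\
  (generic_rank (perm_mx s) = generic_rank (N *m perm_mx s) ->
   forall a c : 'I_n, (c < s a)%N -> N a ((s^-1)%g c) = 0).
Proof.
move=> uN.
have AE j : e' *m perm_mx s *m q j =
   e' *m (N *m perm_mx s) *m q j *m proj_mx [pred k : 'I_n | P ((s^-1)%g k)].
  apply/matrixP => a c; rewrite !proj_mxMr proj_mxMl proj_mxMl perm_mxMr /=.
  have [Pa|_] := boolP (P a); last by rewrite !mul0r.
  have sE : (s a == c) = (a == (s^-1)%g c) by rewrite -{1}[c](permKV s) (inj_eq perm_inj).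
  rewrite mulrAC !mul1r perm_mxEsub !mxE sE; have [Pc|nPc] := boolP (P _).
    by rewrite uN /= ?Pc ?andbF // mulr1 mulrC.
  by rewrite mulr0; case: eqP nPc => [<-|_ _]; rewrite ?Pa ?(mul0r, mulr0) ?mul0r ?mulr0.
have le j : (\rank (e' *m perm_mx s *m q j) <= \rank (e' *m (N *m perm_mx s) *m q j))%N.
  by rewrite AE mxrankM_maxl.
split=> [|e a c ca]; first by apply: leq_sum => j _; exact: le.
have [Pa|nPa] := boolP (P a); last first.
  rewrite uN /= ?(negbTE nPa) //; case: eqP ca => // ->; by rewrite permKV ltnn.
have ej : \rank (e' *m perm_mx s *m q c) = \rank (e' *m (N *m perm_mx s) *m q c).
  apply/eqP; rewrite eqn_leq le /= leqNgt; apply/negP => lt.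
  have : (generic_rank (perm_mx s) < generic_rank (N *m perm_mx s))%N.
    rewrite /generic_rank (bigD1 c) //= [X in (_ < X)%N](bigD1 c) //=.
    by rewrite -addSn leq_add // leq_sum // => j _; exact: le.
  by rewrite e ltnn.
have : ((e' *m (N *m perm_mx s) *m q c)^T <= (e' *m perm_mx s *m q c)^T)%MS.
  have sub : ((e' *m perm_mx s *m q c)^T <= (e' *m (N *m perm_mx s) *m q c)^T)%MS.
    by rewrite AE trmx_mul submxMl.
  by rewrite -(mxrank_leqif_sup sub) !mxrank_tr ej.
move=> /submxP [Z ZE]; have := congr1 (fun M : 'M[R]_n => M c a) ZE; rewrite [LHS]mxE.
rewrite proj_mxMr proj_mxMl perm_mxMr /= leqnn Pa mulr1 mul1r => ->.
rewrite mxE big1 // => k _; rewrite mxE proj_mxMr proj_mxMl perm_mxEsub !mxE /=.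
case: eqP => [<-|_]; last by rewrite mulr0 mul0r mulr0.
by rewrite leqNgt ca mulr0 mulr0.
Qed.
End Genericity.
End BlockUnipotent.

(** * The contracting monoid *)

Section Torus.
Variables (p : nat) (p_pr : prime p) (F : fieldExtType (Qp p_pr)) (pi : F).
Hypothesis pi_unif : uniformizer pi.
Variables (kF : residueField (integers F)) (n : nat).
Local Notation O := (@isInteger p p_pr F).
Local Notation G := (GLn F n).
Local Notation Bo := (upper F n).
Implicit Types (g h x b u w : G) (a : 'I_n -> nat).

Lemma unipotent0P g : unipotent0 g <-> [/\ Bo g, forall i, g i i = 1 & integral_mx (glmx g)].
Proof.
split=> [[[ug d1] /G0P[]]|[ug d1 ig]] //.
split=> //; apply/G0P; apply: (G0_red pi_unif (kF := kF)) => //.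
apply: upuni_unit => [i j ji|i]; first by rewrite mxE ug ?red0.
by rewrite mxE d1 red1.
Qed.

Lemma unipotent0_subgroup : is_subgroup (@unipotent0 _ _ F n).
Proof.
have [G1 GM GV] := G0_subgroup F n; have [B1 BM BV] := upper_subgroup F n.
have Gu g : unipotent0 g -> G0 g by move=> [_ /G0P].
split=> [|g h /[dup] /Gu Gg /unipotent0P [ug d1 _] /[dup] /Gu Gh /unipotent0P [uh dh _]
        |g /[dup] /Gu Gg /unipotent0P [ug d1 _]]; apply/unipotent0P; split.
- exact: upmx1.
- by move=> i; rewrite mxE eqxx.
- exact: integral_mx1.
- exact: upmxM.
- by move=> i; rewrite upmx_diagM // d1 dh mulr1.
- by have [] := GM _ _ Gg Gh.
- exact: BV.
- by move=> i; rewrite upmx_diagV ?glmxP // d1 invr1.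
- by have [] := GV _ Gg.
Qed.

Fact diag_pi_subproof a : diag_mx (\row_i pi ^+ a i) \in unitmx.
Proof.
rewrite unitmxE det_diag unitfE; apply/prodf_neq0 => i _.
by rewrite mxE expf_neq0 // (pi_neq0 pi_unif).
Qed.
Definition diag_pi a : G := MkGL (diag_pi_subproof a).

Lemma pX_neq0 k : pi ^+ k != 0.
Proof. by rewrite expf_neq0 // (pi_neq0 pi_unif). Qed.

Lemma diag_piMl a g i j : (diag_pi a * g)%g i j = pi ^+ a i * g i j.
Proof. by rewrite /= mul_diag_mx !mxE. Qed.

Lemma diag_piMr a g i j : (g * diag_pi a)%g i j = g i j * pi ^+ a j.
Proof. by rewrite /= mul_mx_diag !mxE. Qed.

Lemma diag_piVMl a g i j : ((diag_pi a)^-1 * g)%g i j = pi ^- a i * g i j.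
Proof.
apply: (mulfI (pX_neq0 (a i))); rewrite -diag_piMl mulrA divff ?pX_neq0 // mul1r.
by rewrite mulVKg.
Qed.

Lemma diag_piVMr a g i j : (g * (diag_pi a)^-1)%g i j = g i j / pi ^+ a j.
Proof.
apply: (mulIf (pX_neq0 (a j))); rewrite -diag_piMr -mulrA mulVf ?pX_neq0 // mulr1.
by rewrite mulgVK.
Qed.

Lemma diag_pi_conj a g i j : (diag_pi a * g * (diag_pi a)^-1)%g i j = pi ^+ a i * g i j / pi ^+ a j.
Proof. by rewrite diag_piVMr diag_piMl. Qed.

Lemma diag_pi_conjV a g i j : ((diag_pi a)^-1 * g * diag_pi a)%g i j = pi ^- a i * g i j * pi ^+ a j.
Proof. by rewrite diag_piMr diag_piVMl. Qed.

Lemma diag_piD a a' : (diag_pi a * diag_pi a')%g = diag_pi (fun i => a i + a' i)%N.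
Proof.
apply/val_inj/matrixP => i j; by rewrite [LHS]diag_piMl /= !mxE exprD mulrnAr.
Qed.

Lemma diag_pi_upper a : Bo (diag_pi a).
Proof. by move=> i j ji; rewrite /= !mxE; case: eqP ji => // ->; rewrite ltnn. Qed.

Lemma diag_pi_torus a : torus (diag_pi a).
Proof. by move=> i j /negbTE ij; rewrite /= !mxE ij. Qed.

Lemma diag_pi_torus_plus a : (forall i j : 'I_n, (i < j)%N -> (a j <= a i)%N) ->
  torus_plus (diag_pi a).
Proof.
move=> ha; split=> [|u /unipotent0P [uu du iu]]; first exact: diag_pi_torus.
apply/unipotent0P; split=> [i j ji|i|i j]; rewrite diag_pi_conj.
- by rewrite uu // mulr0 mul0r.
- by rewrite du mulr1 divff ?pX_neq0.
have [ji|ij|/val_inj ->] := ltngtP j i.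
- by rewrite uu // mulr0 mul0r rpred0.
- rewrite -(subnK (ha _ _ ij)) exprD mulrAC mulfK ?pX_neq0 //.
  by rewrite rpredM ?iu // rpredX //; case: pi_unif.
- by rewrite du mulr1 divff ?pX_neq0 // rpred1.
Qed.

Lemma diag_pi_perm a (s : 'S_n) :
  (diag_pi a * perm_elt F s)%g = (perm_elt F s * diag_pi (fun i => a ((s^-1)%g i)))%g.
Proof.
apply/val_inj/matrixP => i j; rewrite [LHS]diag_piMl [RHS]diag_piMr /= !mxE.
by case: eqP => [<-|_]; rewrite ?mulr0 ?mul0r // permK mulrC.
Qed.

Lemma torus_plus_mul (t t' : G) : torus_plus t -> torus_plus t' -> torus_plus (t * t')%g.
Proof.
move=> [tt ht] [tt' ht']; split=> [i j ij|u uu].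
  rewrite mxE big1 // => k _; have [<-|ik] := eqVneq i k; first by rewrite tt' ?mulr0.
  by rewrite tt ?mul0r.
have := ht _ (ht' _ uu); congr unipotent0.
by rewrite invgM !mulgA.
Qed.

Lemma upper_plus_mul b b' : upper_plus F n b -> upper_plus F n b' -> upper_plus F n (b * b')%g.
Proof.
have [N1 NM NV] := unipotent0_subgroup.
move=> [u [t [uu tp ->]]] [u' [t' [uu' tp' ->]]].
exists (u * (t * u' * t^-1))%g, (t * t')%g; split; last by rewrite !mulgA mulgVK.
  by apply: NM => //; have [_] := tp; apply.
exact: torus_plus_mul.
Qed.

Lemma upper_plus_unipotent u : unipotent0 u -> upper_plus F n u.
Proof.
move=> uu; exists u, 1%g; split=> //; last by rewrite mulg1.
split=> [i j /negbTE ij|v]; first by rewrite mxE ij.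
by rewrite mul1g invg1 mulg1.
Qed.

End Torus.

(** * The function e and the span of its translates by GL_n(O) *)

Section Core.
Variables (p : nat) (p_pr : prime p) (F K : fieldExtType (Qp p_pr)) (pi : F).
Hypothesis pi_unif : uniformizer pi.
Variables (kF : residueField (integers F)) (kK : residueField (integers K)) (n : nat).
Variable chi : 'I_n -> smoothChar F kK.
Local Notation O := (@isInteger p p_pr F).
Local Notation G := (GLn F n).
Local Notation Bo := (upper F n).
Local Notation V := (Ind chi).
Local Notation act := (Ind_act chi).
Local Notation chB := (borel_char chi).
Local Notation U1 := (@U1 _ _ F kF n).
Local Notation N0 := (@unipotent0 _ _ F n).
Local Notation diag_pi := (diag_pi pi_unif).
Implicit Types (g h x b u w : G) (f v : V).

Definition U1_fixed v := forall u, U1 u -> act u v = v.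

Lemma U1_fixedE v : fixedpoints act (principal_congruence n kF) v <-> U1_fixed v.
Proof. by split=> h u /(U1P kF); apply: h. Qed.

Lemma U1_adapted : adapted chi U1 1%g.
Proof.
split=> [|u b Uu ub e]; first exact: (U1_subgroup pi_unif kF n).
apply: (borel_char_1max pi_unif) => i; have := (U1_cong1 pi_unif kF _).1 Uu i i.
by rewrite eqxx; have -> : u = b by rewrite -[u]mulg1 e mul1g.
Qed.

Definition base_cell v := (forall u b, U1 u -> Bo b -> v (u * b)%g = (chB b)^-1) /\
  forall g, v g != 0 -> exists u b, [/\ U1 u, Bo b & g = (u * b)%g].

Lemma base_cell_exists : exists v, base_cell v.
Proof.
have [v [vE v0 _]] := cell_exists pi_unif U1_adapted (@subset_refl _ U1).
exists v; split=> [u b Uu ub|g /v0 [u [b [Uu ub ->]]]]; first by rewrite -(vE _ _ Uu ub) mulg1.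
by exists u, b; rewrite mulg1.
Qed.

Variable e : V.
Hypothesis eP : base_cell e.
Let eE := eP.1.
Let e_supp := eP.2.

Lemma U1_fixed_val f u g : U1_fixed f -> U1 u -> f (u * g)%g = f g.
Proof.
have [_ UM UV] := U1_subgroup pi_unif kF n; move=> fU Uu.
by rewrite -{2}(fU _ (UV _ Uu)) actE invgK.
Qed.

Lemma act_e_U1 u : U1 u -> act u e = e.
Proof.
have [_ UM UV] := U1_subgroup pi_unif kF n.
have aux u' g : U1 u' -> e g != 0 -> e (u' * g)%g = e g.
  by move=> Uu' /e_supp [k [b [Uk ub ->]]]; rewrite mulgA !eE //; exact: UM.
move=> Uu; apply: Ind_eq => g; rewrite actE; have Uu' := UV _ Uu.
have [g0|/aux->//] := eqVneq (e g) 0.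
rewrite g0; apply/eqP/negPn/negP => h; have := aux _ _ Uu h.
by rewrite mulVKg g0 => e0; rewrite -e0 eqxx in h.
Qed.

Lemma act_e_B0 b : Bo b -> G0 b -> act b e = chB b *: e.
Proof.
have [_ GM GV] := G0_subgroup F n; have [_ BM BV] := upper_subgroup F n.
move=> ub Gb; apply: Ind_eq => g; rewrite actE IndZE.
have [g0|/e_supp [u [c [Uu uc ->]]]] := eqVneq (e g) 0.
  rewrite g0 mulr0; apply/eqP/negPn/negP => /e_supp [u [c [Uu uc gE]]].
  have {}gE : g = ((b^-1)^-1 * u * b^-1 * (b * c))%g by rewrite invgK !mulgA mulgVK -mulgA -gE mulVKg.
  have : e g = (chB (b * c)%g)^-1.
    rewrite gE eE //; last exact: BM.
    by apply: (U1_conj pi_unif) => //; exact: GV.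
  move=> h; have := borel_char_neq0 chi (BM _ _ ub uc).
  by rewrite -invr_eq0 -h g0 eqxx.
have -> : (b^-1 * (u * c))%g = (b^-1 * u * b * (b^-1 * c))%g by rewrite !mulgA mulgK.
rewrite !eE //; [|exact: (U1_conj pi_unif)|by apply: BM => //; exact: BV].
rewrite borel_charM ?borel_charV //; last exact: BV.
by rewrite invfM invrK.
Qed.

Lemma act_e_fixed x : G0 x -> U1_fixed (act x e).
Proof.
move=> Gx u Uu; rewrite -actM -[(u * x)%g](mulVKg x) actM act_e_U1 //.
by rewrite mulgA; exact: (U1_conj pi_unif).
Qed.

Lemma e_supp_red g : G0 g -> e g != 0 -> upmx (redmx kF (glmx g)).
Proof.
have [_ GM GV] := G0_subgroup F n.
move=> Gg /e_supp [u [b [[Gu ru] ub gE]]].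
have Gb : G0 b.
  have -> : b = (u^-1 * g)%g by rewrite gE mulKg.
  by apply: GM => //; exact: GV.
rewrite gE G0_redmxM // ru mul1mx => i j ji; by rewrite mxE ub // red0.
Qed.

Definition iwahori : set G := redsub (@upmx kF n).

Lemma iwahori_subgroup : is_subgroup iwahori.
Proof.
apply: (redsub_subgroup pi_unif) => //; [exact: upmx1 | exact: upmxM | exact: upmx_inv].
Qed.

(** For x in GL_n(O) modulo the Iwahori subgroup the supports x U1 B partition G. Since x normalizes
    U1, a U1-fixed f is determined on x U1 B by f(x). *)
Lemma U1_fixed_expand : exists X : seq G, (forall x, x \in X -> G0 x) /\
  forall f, U1_fixed f -> f = \sum_(x <- X) ((f x : kK) *: act x e : V) :> V.
Proof.
have [I1 IM IV] := iwahori_subgroup; have [_ GM GV] := G0_subgroup F n.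
have KI : pcong 1 `<=` iwahori.
  by move=> u /(pcong_U1 pi_unif kF) [Gu ru]; split=> //=; rewrite ru; exact: upmx1.
have [X [uX XG cov pw]] := finite_transversal pi_unif kF iwahori_subgroup KI.
exists X; split=> // f fU; apply: (Ind_eqG0 pi_unif kF) => g Gg.
have [x xX Ixg] := cov g Gg; have Gx := XG _ xX.
rewrite Ind_sumE (bigD1_seq x) // big1_seq ?addr0 => [|y /andP[yx yX]]; last first.
    rewrite IndZE actE; have [->|yg] := eqVneq (e (y^-1 * g)%g) 0; first by rewrite mulr0.
  have Iyg : iwahori (y^-1 * g)%g.
    have Gyg : G0 (y^-1 * g)%g by apply: GM => //; apply: GV; exact: XG.
    by split=> //; exact: e_supp_red.
  case/eqP: yx; apply: pw => //; have := IM _ _ Iyg (IV _ Ixg).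
  by rewrite invgM invgK mulgA mulgK.
rewrite IndZE actE; have [Gxg uxg] := Ixg.
have [u [b [Uu ub Gb xg]]] := red_upper_factor pi_unif Gxg uxg.
have gE : g = (x * u * x^-1 * (x * b))%g by rewrite -(mulVKg x g) xg !mulgA mulgVK.
have Uc : U1 (x * u * x^-1)%g.
  by have := U1_conj pi_unif (GV _ Gx) Uu; rewrite invgK.
by rewrite [RHS]addr0 xg eE // gE U1_fixed_val // IndM // [RHS]mulrC.
Qed.
End Core.

(** * Contracting the U1-invariants *)

Section Contraction.
Variables (p : nat) (p_pr : prime p) (F K : fieldExtType (Qp p_pr)) (pi : F).
Hypothesis pi_unif : uniformizer pi.
Variables (kF : residueField (integers F)) (kK : residueField (integers K)) (n : nat).
Variable chi : 'I_n -> smoothChar F kK.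
Local Notation O := (@isInteger p p_pr F).
Local Notation G := (GLn F n).
Local Notation Bo := (upper F n).
Local Notation V := (Ind chi).
Local Notation act := (Ind_act chi).
Local Notation chB := (borel_char chi).
Local Notation U1 := (@U1 _ _ F kF n).
Local Notation N0 := (@unipotent0 _ _ F n).
Local Notation diag_pi := (diag_pi pi_unif).
Implicit Types (g h x b u w : G) (f v : V).

Definition block_subgroup (P Q : pred 'I_n) : set G := redsub (@blockuni kF n P Q).

Lemma block_subgroupP (P Q : pred 'I_n) : (forall i, ~~ (P i && Q i)) ->
  is_subgroup (block_subgroup P Q).
Proof.
move=> PQ; apply: (redsub_subgroup pi_unif).
- exact: blockuni1.
- exact: blockuniM.
- exact: blockuni_inv.
Qed.

Lemma U1_block (P Q : pred 'I_n) : U1 `<=` block_subgroup P Q.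
Proof. by move=> u [Gu ru]; split=> //=; rewrite ru; exact: blockuni1. Qed.

(** If h w = w b, the diagonal entries of b are those of h up to order, hence congruent to 1, where
    the characters are trivial. *)
Lemma block_adapted (P Q : pred 'I_n) (s : 'S_n) : (forall i, ~~ (P i && Q i)) ->
  adapted chi (block_subgroup P Q) (perm_elt F s).
Proof.
move=> PQ; split=> [|h b [[ih _] rh] ub e]; first exact: block_subgroupP.
apply: (borel_char_1max pi_unif) => a; have := congr1 (@glmx _ _) e => /=.
move=> /matrixP /(_ ((s^-1)%g a) a); rewrite perm_mxMr perm_mxMl permKV => <-.
rewrite -(red_eq pi_unif kF) ?rpred1 ?ih // red1.
by have := rh _ _ (PQ ((s^-1)%g a)); rewrite mxE eqxx => ->.
Qed.

Section Step.
Variable i : nat.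
Local Notation P := [pred j : 'I_n | (i <= j)%N].
Local Notation s := (diag_pi (fun j => (j < i)%N)).

Lemma disjP : forall j, ~~ (P j && predC P j). Proof. by move=> j /=; rewrite andbN. Qed.
Lemma disjP' : forall j, ~~ (predC P j && P j). Proof. by move=> j /=; rewrite andNb. Qed.

Lemma block_red_in_max (Q R : pred 'I_n) h a c : block_subgroup Q R h ->
  ~~ (Q a && R c) -> a != c -> in_max pi (h a c).
Proof.
move=> [[ih _] rh] /rh; rewrite mxE => ra /negbTE ac.
by rewrite -(red_eq0 pi_unif kF) ?ih // ra ac.
Qed.

(** Conjugation by s divides the lower left block by pi, which stays integral because that block of
    h is divisible by pi, and multiplies the upper right block by pi. With [block_conjV] this gives
    s H s^-1 = H'. *)
Lemma block_conj h : block_subgroup (predC P) P h -> block_subgroup P (predC P) (s * h * s^-1)%g.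
Proof.
move=> Hh; have [[ih _] rh] := Hh; have ipi : pi \in O by case: pi_unif.
have E a c : (s * h * s^-1)%g a c = pi ^+ (a < i)%N * h a c / pi ^+ (c < i)%N by rewrite diag_pi_conj.
have iE : integral_mx (glmx (s * h * s^-1)%g).
  move=> a c; rewrite E; case: (ltnP a i) => [ai|ia]; case: (ltnP c i) => [ci|ic];
    rewrite ?expr0 ?expr1 ?mul1r ?divr1 ?ih //.
  - by rewrite mulrAC divff ?(pi_neq0 pi_unif) // mul1r ih.
  - by rewrite rpredM ?ih.
  - apply: (block_red_in_max Hh); first by rewrite /= -ltnNge ltnNge ia.
    by apply: contraTneq ci => <-; rewrite -leqNgt.
have rE : blockuni P (predC P) (redmx kF (glmx (s * h * s^-1)%g)).
  move=> a c ac; rewrite mxE E; move: ac; rewrite /= negb_and negbK -ltnNge.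
  case: (ltnP a i) => [ai|ia]; case: (ltnP c i) => [ci|ic] //= _;
    rewrite ?expr0 ?expr1 ?mul1r ?divr1.
  - rewrite mulrAC divff ?(pi_neq0 pi_unif) // mul1r.
    by have := rh a c; rewrite mxE => -> //=; rewrite negb_and (leqNgt i c) ci orbT.
  - have -> : (a == c) = false by apply: contraTF ic => /eqP <-; rewrite -ltnNge.
    apply/eqP; rewrite (red_eq0 pi_unif) ?rpredM ?ih //.
    by apply: in_maxMr (ih _ _); rewrite /in_max divff ?rpred1 ?(pi_neq0 pi_unif).
  - by have := rh a c; rewrite mxE => -> //=; rewrite ia.
split=> //; apply: (G0_red pi_unif (kF := kF)) iE _; exact: (@blockuni_unit kF n P (predC P) disjP _ rE).
Qed.

Lemma block_conjV h : block_subgroup P (predC P) h -> block_subgroup (predC P) P (s^-1 * h * s)%g.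
Proof.
move=> Hh; have [[ih _] rh] := Hh; have ipi : pi \in O by case: pi_unif.
have E a c : (s^-1 * h * s)%g a c = pi ^- (a < i)%N * h a c * pi ^+ (c < i)%N by rewrite diag_pi_conjV.
have iE : integral_mx (glmx (s^-1 * h * s)%g).
  move=> a c; rewrite E; case: (ltnP a i) => [ai|ia]; case: (ltnP c i) => [ci|ic];
    rewrite ?expr0 ?expr1 ?invr1 ?mul1r ?mulr1 ?ih //.
  - by rewrite mulrAC mulVf ?(pi_neq0 pi_unif) // mul1r ih.
  - rewrite mulrC; apply: (block_red_in_max Hh); first by rewrite /= leqNgt ai.
    by apply: contraTneq ic => <-; rewrite -ltnNge.
  - by rewrite rpredM ?ih.
have rE : blockuni (predC P) P (redmx kF (glmx (s^-1 * h * s)%g)).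
  move=> a c ac; rewrite mxE E; move: ac; rewrite /= negb_and negbK -ltnNge.
  case: (ltnP a i) => [ai|ia]; case: (ltnP c i) => [ci|ic] //= _;
    rewrite ?expr0 ?expr1 ?invr1 ?mul1r ?mulr1.
  - rewrite mulrAC mulVf ?(pi_neq0 pi_unif) // mul1r.
    by have := rh a c; rewrite mxE => -> //=; rewrite negb_and (leqNgt i a) ai.
  - have -> : (a == c) = false by apply: contraTF ia => /eqP ->; rewrite -ltnNge.
    apply/eqP; rewrite (red_eq0 pi_unif) ?rpredM ?ih //.
    by apply: in_maxMl (ih _ _) _; rewrite /in_max divff ?rpred1 ?(pi_neq0 pi_unif).
  - by have := rh a c; rewrite mxE => -> //=; rewrite negb_and negbK ic orbT.
split=> //; apply: (G0_red pi_unif (kF := kF)) iE _; exact: (@blockuni_unit kF n (predC P) P disjP' _ rE).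
Qed.

(* With H' = s H s^-1: the action of s carries E_{H,w} to a multiple of E_{H',w}. *)
Lemma act_cell (w : 'S_n) (E E' : V) :
  let H := block_subgroup (predC P) P in let H' := block_subgroup P (predC P) in
  (forall h b, H h -> Bo b -> E (h * perm_elt F w * b)%g = (chB b)^-1) ->
  (forall g, E g != 0 -> exists h b, [/\ H h, Bo b & g = (h * perm_elt F w * b)%g]) ->
  (forall h b, H' h -> Bo b -> E' (h * perm_elt F w * b)%g = (chB b)^-1) ->
  (forall g, E' g != 0 -> exists h b, [/\ H' h, Bo b & g = (h * perm_elt F w * b)%g]) ->
  exists2 c, c != 0 & act s E = c *: E'.
Proof.
move=> H H' EE E0 EE' E0'; have [B1 BM BV] := upper_subgroup F n.
(* The element tau = w^-1 s w of T crosses to the right of w and yields the scalar: c is the value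
   of the character at tau. *)
set tau := diag_pi (fun j => ((w^-1)%g j < i)%N); have utau : Bo tau := diag_pi_upper _ _.
have sw : (s * perm_elt F w)%g = (perm_elt F w * tau)%g by exact: diag_pi_perm.
exists (chB tau); first exact: borel_char_neq0.
apply: Ind_eq => g; rewrite actE IndZE.
have [g0|/E0' [h [b [Hh ub ->]]]] := eqVneq (E' g) 0.
  rewrite g0 mulr0; apply/eqP/negPn/negP => /E0 [h [b [Hh ub sg]]].
  have gE : g = ((s * h * s^-1) * perm_elt F w * (tau * b))%g.
    by rewrite -(mulVKg s g) sg !mulgA -[(_ * perm_elt F w * tau)%g]mulgA -sw !mulgA mulgVK.
  have : E' g = (chB (tau * b)%g)^-1 by rewrite gE EE' //; [exact: block_conj | exact: BM].
  by move=> e; have := borel_char_neq0 chi (BM _ _ utau ub); rewrite -invr_eq0 -e g0 eqxx.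
have -> : (s^-1 * (h * perm_elt F w * b))%g = ((s^-1 * h * s) * perm_elt F w * (tau^-1 * b))%g.
  rewrite !mulgA -[(_ * s * perm_elt F w)%g]mulgA sw !mulgA mulgK.
  by [].
rewrite EE' // EE //; [|exact: block_conjV|by apply: BM => //; exact: BV].
rewrite borel_charM ?borel_charV //; last exact: BV.
by rewrite invfM invrK.
Qed.
End Step.
End Contraction.

(** * Descent from t s to t, and its iteration *)

Section Step.
Variables (p : nat) (p_pr : prime p) (F K : fieldExtType (Qp p_pr)) (pi : F).
Hypothesis pi_unif : uniformizer pi.
Variables (kF : residueField (integers F)) (kK : residueField (integers K)) (n : nat).
Variable chi : 'I_n -> smoothChar F kK.
Local Notation O := (@isInteger p p_pr F).
Local Notation G := (GLn F n).
Local Notation Bo := (upper F n).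
Local Notation V := (Ind chi).
Local Notation act := (Ind_act chi).
Local Notation chB := (borel_char chi).
Local Notation U1 := (@U1 _ _ F kF n).
Local Notation N0 := (@unipotent0 _ _ F n).
Local Notation diag_pi := (diag_pi pi_unif).
Local Notation U1_fixed := (@U1_fixed _ _ F K kF kK n chi).
Implicit Types (g h x b u w : G) (f v : V).

Lemma redmx_upper b : Bo b -> upmx (redmx kF (glmx b)).
Proof. by move=> ub i j ji; rewrite mxE ub // red0. Qed.

(** Replacing the lower part of l by 0 and its diagonal by 1 gives an element of N_0 with the same
    reduction as l. *)
Lemma pro_iwahori_factor l : G0 l -> upmx (redmx kF (glmx l)) ->
  (forall i, redmx kF (glmx l) i i = 1) -> exists m u, [/\ N0 m, U1 u & l = (m * u)%g].
Proof.
have [_ GM GV] := G0_subgroup F n.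
move=> Gl ul dl; have [il _] := Gl.
pose A : 'M[F]_n := \matrix_(i, j) (if (j < i)%N then 0 else if i == j then 1 else l i j).
have uA : A \in unitmx.
  by apply: upuni_unit => [i j ji|i]; rewrite mxE ?ji // ltnn eqxx.
pose m : G := MkGL uA.
have Nm : N0 m.
  apply/(unipotent0P pi_unif kF); split=> [i j ji|i|i j]; rewrite mxE.
  - by rewrite ji.
  - by rewrite ltnn eqxx.
  - by case: ifP => _; [rewrite rpred0 | case: ifP => _; rewrite ?rpred1 ?il].
have Gm : G0 m by have [_ /G0P] := Nm.
exists m, (m^-1 * l)%g; split=> //; last by rewrite mulVKg.
split; first by apply: (GM) => //; exact: GV.
rewrite G0_redmxM //; last exact: GV.
rewrite (G0_redmxV pi_unif) //; suff -> : redmx kF (glmx m) = redmx kF (glmx l).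
  by rewrite mulVmx // (G0_redmx pi_unif).
apply/matrixP => i j; rewrite !mxE; case: ifP => [ji|_].
  by have := ul i j ji; rewrite mxE red0.
by case: eqP => [<-|//]; have := dl i; rewrite mxE red1.
Qed.

Variable e : V.
Hypothesis eP : base_cell kF e.

Section Module.
Variables (M : set V) (t : G) (i : nat).
Local Notation s := (diag_pi (fun j => (j < i)%N)).
Local Notation P := [pred j : 'I_n | (i <= j)%N].
Hypotheses (MD : forall f f', M f -> M f' -> M (f + f'))
  (MZ : forall (a : kK) f, M f -> M (a *: f : V)) (M0 : M 0)
  (MN : forall u f, N0 u -> M f -> M (act u f))
  (tN : forall u, N0 u -> N0 (t * u * t^-1)%g)
  (tsM : forall v, U1_fixed v -> M (act (t * s)%g v)).

Lemma M_sum (I : eqType) (r : seq I) (f : I -> V) :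
  (forall x : I, x \in r -> M (f x)) -> M (\sum_(x <- r) f x).
Proof. by move=> h; rewrite big_seq; apply: big_ind. Qed.

Lemma act_sum g (I : Type) (r : seq I) (f : I -> V) :
  act g (\sum_(x <- r) f x) = \sum_(x <- r) act g (f x).
Proof.
by apply: (big_morph (act g : V -> V)) => [f1 f2|]; apply: Ind_eq.
Qed.

Lemma act_scale g (a : kK) f : act g (a *: f : V) = a *: act g f :> V.
Proof. by apply: Ind_eq. Qed.

Lemma act_sub g f1 f2 : act g (f1 - f2 : V) = act g f1 - act g f2 :> V.
Proof. exact: Ind_eq. Qed.

Local Notation rho x := (generic_rank P (redmx kF (glmx x))).

(* Put H = N_P(o) U1 and H' = s H s^-1, which contains U1. Then E_{H',w} is a multiple of
   s E_{H,w}, so t E_{H',w} lies in M, and E_{H',w} - w e is a combination of functions y e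
   with y of larger generic rank than w. *)
Lemma cell_step (w : 'S_n) :
  (forall y, G0 y -> (rho (perm_elt F w) < rho y)%N -> M (act t (act y e))) ->
  M (act t (act (perm_elt F w) e)).
Proof.
have [_ GM GV] := G0_subgroup F n; have [B1 BM BV] := upper_subgroup F n.
move=> IH; set W := perm_elt F w.
have dj := @disjP n i; have dj' := @disjP' n i.
have [E [EE E0 EU]] := cell_exists pi_unif (block_adapted pi_unif kF chi w dj') (@U1_block _ _ _ kF _ _ _).
have [E' [EE' E0' EU']] := cell_exists pi_unif (block_adapted pi_unif kF chi w dj) (@U1_block _ _ _ kF _ _ _).
have [c c0 sE] := act_cell pi_unif EE E0 EE' E0'; rewrite -/W in EE' E0'.
have ME' : M (act t E').
  have -> : E' = c^-1 *: act s E :> V by rewrite sE scalerA mulVf // scale1r.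
  rewrite act_scale; apply: MZ; rewrite -actM; apply: tsM => u Uu.
  exact/EU/U1_block.
have GW : G0 W by exact: (perm_elt_G0 pi_unif kF).
have UH' : U1 `<=` block_subgroup kF P (predC P) := @U1_block _ _ _ kF _ _ _.
pose f : V := E' - act W e.
have fU : U1_fixed f.
  by move=> u Uu; rewrite act_sub EU' ?(act_e_fixed pi_unif eP GW Uu) //; exact: UH'.
have fE y : (f y : kK) = (E' y : kK) - (e (W^-1 * y)%g : kK) by [].
have [X [XG XE]] := U1_fixed_expand pi_unif eP.
have We : act W e = E' - \sum_(x <- X) ((f x : kK) *: act x e : V) :> V.
  by rewrite -XE // subKr.
have -> : act t (act W e) = act t E' + (-1 : kK) *: \sum_(x <- X) ((f x : kK) *: act t (act x e) : V) :> V.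
  by rewrite scaleN1r We act_sub act_sum; under eq_bigr => x _ do rewrite act_scale.
apply: MD => //; apply: MZ; apply: M_sum => y yX; have Gy := XG _ yX.
have [->|fy] := eqVneq (f y) 0; first by rewrite scale0r.
apply: MZ; apply: IH => //.
(* The support w U1 B of w e is contained in that of E', so f vanishes wherever E' does. *)
have E'y : E' y != 0.
  apply: contra fy => /eqP E'y; have [e0|] := eqVneq (e (W^-1 * y)%g) 0.
    by apply/eqP; rewrite fE E'y e0 subrr.
  move=> /eP.2 [u [b [Uu ub yE]]].
  have := EE' (W * u * W^-1)%g b; rewrite mulgVK -[(W * u * b)%g]mulgA -yE mulVKg E'y => h.
  have Hu : block_subgroup kF P (predC P) (W * u * W^-1)%g.
    by apply: UH'; have := U1_conj pi_unif (GV _ GW) Uu; rewrite invgK.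
  by have := borel_char_neq0 chi ub; rewrite -invr_eq0 -h // eqxx.
have [h [b [Hh ub yE]]] := E0' _ E'y; have [Gh rh] := Hh.
have Gb : G0 b.
  have -> : b = ((h * W)^-1 * y)%g by rewrite yE mulKg.
  by apply: (GM) => //; apply: (GV); exact: GM.
have ry : redmx kF (glmx y) *m redmx kF (glmx b^-1%g) = redmx kF (glmx h) *m perm_mx w.
  rewrite -(redmx_perm kF) -!G0_redmxM //; [|exact: GV]; by rewrite yE mulgK.
have ub' : upmx (redmx kF (glmx b^-1%g)) by apply: redmx_upper; exact: BV.
have [le eq] := generic_rank_blockuni w rh.
have le2 := generic_rank_upmxr P (redmx kF (glmx y)) ub'; rewrite ry in le2.
rewrite (redmx_perm kF); apply: leq_trans le2; rewrite ltn_neqAle le andbT.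
(* If the ranks agree, w^-1 h w is upper triangular modulo pi. Then y lies in w U1 B, where E' and w
   e coincide, so f(y) = 0. *)
apply/eqP => /eq {}eq; case/eqP: fy.
have Gq : G0 (W^-1 * h * W)%g by apply: (GM) => //; apply: (GM) => //; exact: GV.
have uq : upmx (redmx kF (glmx (W^-1 * h * W)%g)).
  move=> a d da; have : perm_mx w *m redmx kF (glmx (W^-1 * h * W)%g) = redmx kF (glmx h) *m perm_mx w.
    by rewrite -(redmx_perm kF) -!G0_redmxM // !mulgA mulgV mul1g.
  move=> /matrixP /(_ ((w^-1)%g a) d); rewrite perm_mxMl perm_mxMr permKV => ->.
  by apply: eq; rewrite permKV.
have [u [d [Uu ud Gd qE]]] := red_upper_factor pi_unif Gq uq.
have yE2 : y = (W * u * W^-1 * W * (d * b))%g.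
  by rewrite mulgVK mulgA -[(W * u * d)%g]mulgA -qE -!mulgA mulVKg yE !mulgA.
rewrite fE {1}yE2 EE'; last exact: BM.
  rewrite yE2 mulgVK -!mulgA mulKg eP.1 ?subrr //; exact: BM.
by apply: UH'; have := U1_conj pi_unif (GV _ GW) Uu; rewrite invgK.
Qed.
(** Descending induction on the generic rank. In x = l w b the factor b acts on e by a scalar, and l
    = k u with k in N_0 and u in U1 fixing w e; t k = (t k t^-1) t then reduces to w. As the rank of
    w is at least that of x, [cell_step] only calls on elements of rank larger than that of x. *)
Lemma cell_step_G0 x : G0 x -> M (act t (act x e)).
Proof.
have [_ GM GV] := G0_subgroup F n; have [B1 BM BV] := upper_subgroup F n.
have [m] := ubnP (n * n - rho x); elim: m x => // m IH x xm Gx.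
have [l [w [b [Gl ul dl ub xE]]]] := bruhat pi_unif kF x.
have Gw : G0 (perm_elt F w) by exact: (perm_elt_G0 pi_unif kF).
have Gb : G0 b.
  have -> : b = ((l * perm_elt F w)^-1 * x)%g by rewrite xE mulKg.
  by apply: (GM) => //; apply: (GV); exact: GM.
have rw : (rho x <= rho (perm_elt F w))%N.
  rewrite xE !G0_redmxM //; last exact: GM.
  apply: leq_trans (generic_rank_upmxr _ _ (redmx_upper ub)) _.
  apply: generic_rank_l => j k /= ij; rewrite -ltnNge => ki; apply: ul.
  exact: leq_trans ij.
have [k [u [Nk Uu lE]]] := pro_iwahori_factor Gl ul dl.
rewrite xE !actM (act_e_B0 pi_unif eP ub Gb) !act_scale; apply: MZ.
rewrite lE actM (act_e_fixed pi_unif eP Gw Uu) -actM.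
rewrite -[(t * k)%g](mulgVK t) actM; apply: MN; first exact: tN.
apply: cell_step => y Gy rwy; apply: IH => //.
have := generic_rank_le P (redmx kF (glmx y)); move: xm rw rwy; clear; lia.
Qed.

Lemma contraction_step v : U1_fixed v -> M (act t v).
Proof.
have [X [XG XE]] := U1_fixed_expand pi_unif eP.
move=> vU; rewrite (XE v vU) act_sum; apply: M_sum => x xX.
by rewrite act_scale; apply: MZ; apply: cell_step_G0; exact: XG.
Qed.
End Module.

Lemma eq_diag_pi a a' : a =1 a' -> diag_pi a = diag_pi a' :> G.
Proof. by move=> aa'; apply/val_inj/matrixP => i j; rewrite !mxE aa'. Qed.

(** The diagonal element is the product over i in L of the elements s attached to i;
    [contraction_step] removes one factor at a time, the remaining product still being in T_+. *)
Lemma contraction_chain (M : set V) (L : seq nat) :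
  (forall f f', M f -> M f' -> M (f + f')) -> (forall (a : kK) f, M f -> M (a *: f : V)) ->
  M 0 -> (forall u f, N0 u -> M f -> M (act u f)) ->
  (forall v, U1_fixed v -> M (act (diag_pi (fun j => \sum_(i <- L) (j < i))%N) v)) ->
  forall v, U1_fixed v -> M v.
Proof.
move=> MD MZ M0 MN; elim: L => [|i L IH] h.
  move=> v /h; suff -> : diag_pi (fun j => \sum_(i <- [::]) (j < i))%N = 1%g :> G by rewrite act1.
  by apply/val_inj/matrixP => j k; rewrite !mxE big_nil expr0.
apply: IH; apply: (@contraction_step M _ i) => //.
  apply: (diag_pi_torus_plus pi_unif kF _).2 => j k jk; apply: leq_sum => r _.
  by case: (ltnP k r) => // kr; rewrite (ltn_trans jk kr).
move=> v vU; rewrite diag_piD; have := h v vU; congr (M (act _ _)); apply: eq_diag_pi => j.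
by rewrite big_cons addnC.
Qed.
End Step.

(** * Generation *)

Section Generation.
Variables (p : nat) (p_pr : prime p) (F K : fieldExtType (Qp p_pr)) (pi : F).
Hypothesis pi_unif : uniformizer pi.
Variables (kF : residueField (integers F)) (kK : residueField (integers K)) (n : nat).
Variable chi : 'I_n -> smoothChar F kK.
Local Notation O := (@isInteger p p_pr F).
Local Notation G := (GLn F n).
Local Notation Bo := (upper F n).
Local Notation V := (Ind chi).
Local Notation act := (Ind_act chi).
Local Notation chB := (borel_char chi).
Local Notation U1 := (@U1 _ _ F kF n).
Local Notation N0 := (@unipotent0 _ _ F n).
Local Notation diag_pi := (diag_pi pi_unif).
Local Notation iwahori := (@iwahori _ _ F kF n).
Implicit Types (g h x b u w : G) (f v : V).

Lemma U1_LU u : U1 u -> exists l b, [/\ U1 l, forall i j : 'I_n, (i <= j)%N -> l i j = (i == j)%:R,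
  Bo b, chB b = 1 & u = (l * b)%g].
Proof.
move=> /(U1_cong1 pi_unif) /(cong1_LU pi_unif) [A [C [cA lA uC cC uE]]].
have := glmxP u; rewrite uE unitmx_mul => /andP[uA uC'].
exists (MkGL uA), (MkGL uC'); split=> //; [exact/(U1_cong1 pi_unif)| |exact: val_inj].
apply: (borel_char_1max pi_unif) => i; have := cC i i; by rewrite eqxx.
Qed.

Section Dilation.
Variable k : nat.
Hypothesis k0 : (0 < k)%N.
Local Notation t := (diag_pi (fun i : 'I_n => k * i)%N).

(** The exponents of t increase along the diagonal, opposite to those of T_+: an entry below the
    diagonal is multiplied by a positive power of pi^k, hence by an element of p^m O. *)
Lemma lower_dilation m l : pi ^+ k / p%:R ^+ m \in O -> U1 l ->
  (forall i j : 'I_n, (i <= j)%N -> l i j = (i == j)%:R) ->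
  pcong m (t * l * t^-1)%g /\ U1 (t * l * t^-1)%g.
Proof.
have ipi : pi \in O by case: pi_unif.
move=> pk Ul ll; have cl := (U1_cong1 pi_unif kF l).1 Ul.
have E i j : (t * l * t^-1)%g i j - (i == j)%:R =
    pi ^+ (k * (i - j)) * (l i j - (i == j)%:R).
  rewrite diag_pi_conj; have [ij|ji] := leqP i j.
    rewrite ll // subrr mulr0; case: eqP => [->|_]; last by rewrite mulr0 mul0r subr0.
    by rewrite mulr1 divff ?pX_neq0 // subrr.
  have -> : (i == j) = false by apply: contraTF ji => /eqP ->; rewrite ltnn.
  rewrite !subr0 -{1}(subnK (ltnW ji)) mulnDr exprD.
  by rewrite [LHS]mulrAC mulfK ?pX_neq0.
have iE i j : l i j - (i == j)%:R \in O by exact: (in_max_integer pi_unif) (cl i j).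
split; last first.
  by apply/(U1_cong1 pi_unif) => i j; rewrite E; apply: in_maxMl => //; rewrite rpredX.
move=> i j; apply/in_pOP; have := E i j; rewrite !mxE => ->.
have [ij|ji] := leqP i j; first by rewrite ll // subrr mulr0 mul0r rpred0.
have -> : (k * (i - j) = k + k * (i - j).-1)%N.
  by rewrite -mulnS prednK // subn_gt0.
rewrite exprD mulrAC; apply: rpredM; last exact: iE.
by rewrite mulrAC rpredM ?rpredX.
Qed.

Lemma upper_contraction b : Bo b -> G0 b -> iwahori (t^-1 * b * t)%g.
Proof.
have ipi : pi \in O by case: pi_unif.
move=> ub Gb; have [ib _] := Gb.
have E (i j : 'I_n) : (i <= j)%N -> (t^-1 * b * t)%g i j = pi ^+ (k * (j - i)) * b i j.
  move=> ij; rewrite diag_pi_conjV; have -> : (k * j = k * (j - i) + k * i)%N by rewrite -mulnDr subnK.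
  rewrite exprD.
  by rewrite [LHS]mulrC -!mulrA mulVKf ?pX_neq0.
have L (i j : 'I_n) : (j < i)%N -> (t^-1 * b * t)%g i j = 0.
  by move=> ji; rewrite diag_pi_conjV ub // mulr0 mul0r.
have iE : integral_mx (glmx (t^-1 * b * t)%g).
  move=> i j; have [ij|ji] := leqP i j; last by rewrite L // rpred0.
  by rewrite E // rpredM ?rpredX ?ib.
have uE : upmx (redmx kF (glmx (t^-1 * b * t)%g)).
  by move=> i j ji; rewrite mxE L // red0.
split=> //; apply: (G0_red pi_unif (kF := kF)) => //.
rewrite -unitmx_tr unitmxE unitfE det_trig; last first.
  by apply/is_trig_mxP => i j ij; rewrite mxE uE.
apply/prodf_neq0 => i _; rewrite [X in X != 0]mxE [X in X != 0]mxE E // subnn muln0 expr0 mul1r.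
have := upmx_diag_neq0 i (G0_redmx pi_unif kF Gb) (redmx_upper kF ub).
by rewrite mxE.
Qed.
End Dilation.

Variable e : V.
Hypothesis eP : base_cell kF e.

(* f is a combination of translates of e by x t, where t contracts N^- so strongly that f is
   constant on x t N^-_1 t^-1, and x runs through G0 modulo G0 \cap t I t^-1. *)
Lemma Ind_generated f : exists (X : seq G) (c : G -> kK) (t : G),
  f = \sum_(x <- X) (c x *: act (x * t)%g e : V) :> V.
Proof.
have [_ GM GV] := G0_subgroup F n; have [B1 BM BV] := upper_subgroup F n.
have /asboolP [lf _] := indfunP f.
have [m mP] := uniformly_locally_constant pi_unif kF lf.
have [k k0 kP] := pi_pow_p pi_unif m.
pose t := diag_pi (fun i : 'I_n => k * i)%N; have ut : Bo t := diag_pi_upper _ _.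
have [_ IM IV] := iwahori_subgroup pi_unif kF n.
pose Gam : set G := (@G0 _ _ F n) `&` [set g | iwahori (t^-1 * g * t)%g].
have Gsub : is_subgroup Gam.
  apply: subgroupI; first exact: G0_subgroup.
  by apply: subgroup_conj; exact: (iwahori_subgroup pi_unif).
have [_ GaM GaV] := Gsub.
have UI u : U1 u -> iwahori u by move=> [Gu ru]; split=> //=; rewrite ru; exact: upmx1.
have [m' KG] : exists m', pcong m' `<=` Gam.
  have [m' m'P] := pcong_conj pi_unif kF (t^-1)%g; exists m'.+1 => u Ku; split.
    by have [] := pcong_U1 pi_unif kF Ku.
  have := m'P u (pcong_le (leqnSn _) Ku); rewrite invgK; exact: UI.
have [X [uX XG cov pw]] := finite_transversal pi_unif kF Gsub KG.
(* The function [act (x * t) e] takes the value chi(t) at x, whence the normalization. *)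
exists X, (fun x => (chB t)^-1 * f x), t.
apply: (Ind_eqG0 pi_unif kF) => g Gg; have [x xX [Gxg Ixg]] := cov g Gg; have Gx := XG _ xX.
rewrite Ind_sumE (bigD1_seq x) // big1_seq => [|y /andP[yx yX]]; last first.
  rewrite IndZE actE; have [->|] := eqVneq (e ((y * t)^-1 * g)%g) 0; first by rewrite mulr0.
  move=> /eP.2 [u [b [Uu ub yg]]]; case/eqP: yx; apply: pw => //.
  suff Gyg : Gam (y^-1 * g)%g.
    by have := GaM _ _ Gyg (GaV _ (conj Gxg Ixg)); rewrite invgM invgK mulgA mulgK.
  have Gyg : G0 (y^-1 * g)%g by apply: (GM) => //; apply: (GV); exact: XG.
  (* By the Iwahori factorization of U1, GL_n(O) meets t U1 B only inside [Gam]; so on GL_n(O) the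
     terms of the sum have disjoint supports. *)
  split=> //=; have [l [c [Ul ll uc _ uE]]] := U1_LU Uu.
  have [_ Ul'] := lower_dilation kP Ul ll; rewrite -/t in Ul'.
  have ygE : (y^-1 * g = (t * l * t^-1) * (t * c * b))%g.
    have -> : (y^-1 * g = t * (u * b))%g by rewrite -yg invgM -mulgA mulVKg.
    by rewrite uE !mulgA mulgVK.
  have utcb : Bo (t * c * b)%g by apply: (BM) => //; exact: BM.
  have Gtcb : G0 (t * c * b)%g.
    rewrite -(mulKg (t * l * t^-1)%g (t * c * b)%g) -ygE; apply: (GM) => //; apply: (GV).
    by have [] := Ul'.
  have := IM _ _ (UI _ Ul) (upper_contraction k utcb Gtcb).
  by congr iwahori; rewrite ygE !mulgA !mulgVK mulVg mul1g.
rewrite [RHS]addr0 IndZE actE; have [Gj uj] := Ixg.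
have [u [b [Uu ub Gb jE]]] := red_upper_factor pi_unif Gj uj.
have [l [c [Ul ll uc cc uE]]] := U1_LU Uu.
have [Kl _] := lower_dilation kP Ul ll; rewrite -/t in Kl.
have xg : ((x * t)^-1 * g = u * (b * t^-1))%g.
  by rewrite mulgA -jE invgM !mulgA mulgK.
have ut' : Bo (t^-1)%g := BV _ ut.
rewrite xg eP.1 //; last exact: BM.
have gE : g = (x * (t * l * t^-1) * (t * c * (b * t^-1)))%g.
  by rewrite -[g](mulVKg (x * t)%g) xg uE !mulgA mulgVK.
rewrite {1}gE IndM; last by apply: (BM); exact: BM.
have Ct := borel_char_neq0 chi ut.
have -> : chB (t * c * (b * t^-1))%g = chB b.
  rewrite !borel_charM ?cc ?mulr1 ?borel_charV //; [|exact: BM..].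
  by rewrite mulrCA divff // mulr1.
rewrite mP // borel_charM // borel_charV // invfM invrK.
have swap (a d y : kK) : a != 0 -> d^-1 * y = (a^-1 * y) * (d^-1 * a).
  by move=> a0; rewrite mulrACA [y * a]mulrC mulrACA mulVf // mul1r.
exact: swap.
Qed.

End Generation.

(** * Minimality *)

Section Spans.
Variables (R : pzRingType) (X : lmodType R).

Lemma submoduleP (M : set X) : submodule M <->
  M 0 /\ forall a u v, M u -> M v -> M (a *: u + v).
Proof.
rewrite /submodule; split=> [[m0 mZ]|[m0 mZ]].
  split=> [|a u v Mu Mv]; first by have := m0; rewrite !inE.
  by have := mZ a u v; rewrite !inE; apply.
by split=> [|a u v]; rewrite !inE //; exact: mZ.
Qed.

Lemma mspan_submodule (S : set X) : submodule (mspan S).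
Proof.
apply/submoduleP; split=> [M [/submoduleP[]//]|a u v Mu Mv M [sM SM]].
by have [_] := (submoduleP M).1 sM; apply; [exact: Mu | exact: Mv].
Qed.

Lemma sub_mspan (S : set X) : S `<=` mspan S.
Proof. by move=> x Sx M [_]; apply. Qed.

Lemma mspan_min (S M : set X) : submodule M -> S `<=` M -> mspan S `<=` M.
Proof. by move=> sM SM x; apply. Qed.
End Spans.

(** The list is k copies of 1, ..., n. It writes the diagonal element with exponents k (n - j) as a
    product of the elements s, as [contraction_chain] requires. *)
Lemma level_chain n k : exists L : seq nat,
  forall j : 'I_n, (k * (n - j) = \sum_(i <- L) (j < i))%N.
Proof.
have base m j : (\sum_(i <- iota 1 m) (j < i) = m - j)%N.
  elim: m => [|m IH]; first by rewrite big_nil.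
  have -> : iota 1 m.+1 = iota 1 m ++ [:: m.+1] by rewrite -{1}[m.+1]addn1 iotaD add1n.
  by rewrite big_cat /= big_seq1 IH ltnS; case: leqP; lia.
elim: k => [|k [L LE]]; first by exists [::] => j; rewrite big_nil.
by exists (iota 1 n ++ L) => j; rewrite big_cat /= base -LE mulSn.
Qed.

Section Absorption.
Variables (p : nat) (p_pr : prime p) (F : fieldExtType (Qp p_pr)) (pi : F).
Hypothesis pi_unif : uniformizer pi.
Variables (kF : residueField (integers F)) (n : nat).
Local Notation O := (@isInteger p p_pr F).
Local Notation G := (GLn F n).
Local Notation Bo := (upper F n).
Local Notation diag_pi := (diag_pi pi_unif).
Implicit Types (g h x b u w t : G).

Lemma torusMl t g i j : torus t -> (t * g)%g i j = t i i * g i j.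
Proof.
move=> tt; rewrite mxE (bigD1 i) //= big1 ?addr0 // => k ki.
by rewrite tt ?mul0r // eq_sym.
Qed.

Lemma torusMr t g i j : torus t -> (g * t)%g i j = g i j * t j j.
Proof.
move=> tt; rewrite mxE (bigD1 j) //= big1 ?addr0 // => k kj.
by rewrite tt ?mulr0.
Qed.

Lemma torus_upper t : torus t -> Bo t.
Proof. by move=> tt i j ji; apply: tt; apply: contraTneq ji => ->; rewrite ltnn. Qed.

Lemma torusVMr t g i j : torus t -> (g * t^-1)%g i j = g i j / t j j.
Proof.
move=> tt; apply: (mulIf (upper_diag_neq0 j (torus_upper tt))).
by rewrite divfK ?upper_diag_neq0 -?(torusMr _ _ _ tt) ?mulgVK //; exact: torus_upper.
Qed.

Definition level k := diag_pi (fun j : 'I_n => k * (n - j))%N.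

(** Split [level k * b] into its unipotent part and its diagonal t. At a place i < j, both the
    unipotent entry and the factor by which t conjugates N_0 carry a power of pi of exponent at
    least k, which for large k clears the denominators of b_ij / b_jj and b_ii / b_jj. *)
Lemma absorption b : Bo b -> exists k0, forall k, (k0 <= k)%N -> upper_plus F n (level k * b)%g.
Proof.
move=> ub; have b0 i : b i i != 0 by exact: upper_diag_neq0.
have ipi : pi \in O by case: pi_unif.
have ex (u : 'I_n * 'I_n) : exists m, forall k, (m <= k)%N ->
    pi ^+ k * (b u.1 u.2 / b u.2 u.2) \in O /\ pi ^+ k * (b u.1 u.1 / b u.2 u.2) \in O.
  have [m1 h1] := pi_pow_denom pi_unif (b u.1 u.2 / b u.2 u.2).
  have [m2 h2] := pi_pow_denom pi_unif (b u.1 u.1 / b u.2 u.2).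
  exists (m1 + m2)%N => k km; split; [apply: h1|apply: h2]; apply: leq_trans km.
    exact: leq_addr.
  exact: leq_addl.
have [m mP] := choice ex; exists (\sum_u m u)%N => k km.
have mk i j : (m (i, j) <= k)%N.
  by apply: leq_trans km; rewrite (bigD1 (i, j)) //= leq_addr.
have uD : diag_mx (\row_i (level k * b)%g i i) \in unitmx.
  rewrite unitmxE det_diag unitfE; apply/prodf_neq0 => i _.
  by rewrite mxE diag_piMl mulf_neq0 ?(pX_neq0 pi_unif) ?b0.
pose t : G := MkGL uD.
have tt : torus t by move=> i j /negbTE ij; rewrite /= mxE ij.
have tE i : t i i = pi ^+ (k * (n - i)) * b i i by rewrite /= mxE eqxx mulr1n mxE diag_piMl.
have expE (i j : 'I_n) : (i < j)%N -> exists2 r, (k <= r)%N & (k * (n - i) = r + k * (n - j))%N.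
  move=> ij; exists (k * (j - i))%N; first by rewrite leq_pmulr // subn_gt0.
  by rewrite -mulnDr addnC addnBA ?(ltnW ij) // subnK // ltnW.
exists (level k * b * t^-1)%g, t; split; last by rewrite mulgVK.
  apply/(unipotent0P pi_unif kF); split=> [i j ji|i|i j]; rewrite torusVMr // diag_piMl tE.
  - by rewrite ub // mulr0 mul0r.
  - by rewrite divff // mulf_neq0 ?(pX_neq0 pi_unif) ?b0.
  have [ji|ij|/val_inj ->] := ltngtP j i.
  - by rewrite ub // mulr0 mul0r rpred0.
  - have [r kr ->] := expE _ _ ij; rewrite exprD.
    have -> : pi ^+ r * pi ^+ (k * (n - j)) * b i j / (pi ^+ (k * (n - j)) * b j j) =
      pi ^+ r * (b i j / b j j).
      have := pX_neq0 pi_unif (k * (n - j)); have := b0 j.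
      move: (pi ^+ (k * (n - j))) (b j j) => a c c0 a0; by field; rewrite c0.
    by have [] := mP (i, j) r (leq_trans (mk i j) kr).
  - by rewrite divff ?rpred1 // mulf_neq0 ?(pX_neq0 pi_unif) ?b0.
split=> // u /(unipotent0P pi_unif kF) [uu du iu].
apply/(unipotent0P pi_unif kF); split=> [i j ji|i|i j]; rewrite torusVMr // torusMl //.
- by rewrite uu // mulr0 mul0r.
- by rewrite du mulr1 divff // upper_diag_neq0 //; exact: torus_upper.
have [ji|ij|/val_inj ->] := ltngtP j i.
- by rewrite uu // mulr0 mul0r rpred0.
- have [r kr e] := expE _ _ ij; rewrite !tE e exprD.
  have -> : pi ^+ r * pi ^+ (k * (n - j)) * b i i * u i j / (pi ^+ (k * (n - j)) * b j j) =
      pi ^+ r * (b i i / b j j) * u i j.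
    have := pX_neq0 pi_unif (k * (n - j)); have := b0 j; move: (pi ^+ (k * (n - j))) (b j j) => a c c0 a0.
    by field; rewrite c0.
  by have [_ h] := mP (i, j) r (leq_trans (mk i j) kr); rewrite rpredM ?iu.
by rewrite du mulr1 divff ?rpred1 // upper_diag_neq0 //; exact: torus_upper.
Qed.

End Absorption.

Theorem proposition4p2 (p : nat) (p_pr : prime p)
    (F K : fieldExtType (Qp p_pr))
    (kF : residueField (integers F)) (kK : residueField (integers K))
    (n : nat) (chi : 'I_n -> smoothChar F kK) :
  let V : lmodType kK := Ind chi in
  let act : GLn F n -> V -> V := Ind_act chi in
  let M0 : set V :=
    mspan (translates act (upper_plus F n)
             (fixedpoints act (principal_congruence n kF))) in
  let V_oK : lmodType (integers K) := restrict_scalars (residue kK) V in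
  minimal_in
    (generating_subreps (act : GLn F n -> V_oK -> V_oK)
       (upper F n) (upper_plus F n))
    M0.
Proof.
move=> V act M0 V_oK.
have [pi pi_unif] := uniformizer_exists F.
have [e eP] := base_cell_exists pi_unif kF chi.
have [_ G0M G0V] := G0_subgroup F n; have [_ BM BV] := upper_subgroup F n.
have fixE v : fixedpoints act (principal_congruence n kF) v <-> U1_fixed kF v by exact: U1_fixedE.
have actL g (a : kK) (f f' : V) : act g (a *: f + f') = a *: act g f + act g f' by exact: act_linear.
(* The map from o_K to k_K is surjective, so o_K-submodules of V are the k_K-subspaces. *)
have restr (M : set V) : @submodule _ V_oK M <-> submodule M.
  split=> /submoduleP [m0 mZ]; apply/submoduleP; split=> // a u v Mu Mv.
    by have [x <-] := residue_surj a; exact: (mZ x u v Mu Mv).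
  exact: (mZ (residue kK a) u v Mu Mv).
have clos (M : set V) : submodule M -> [/\ M 0, forall f f', M f -> M f' -> M (f + f') &
    forall (a : kK) f, M f -> M (a *: f)].
  move=> /submoduleP [m0 mZ]; split=> // [f f' Mf Mf'|a f Mf].
    by have := mZ 1 _ _ Mf Mf'; rewrite scale1r.
  by have := mZ a _ _ Mf m0; rewrite addr0.
have sumM (M : set V) (I : eqType) (r : seq I) (f : I -> V) : submodule M ->
    (forall x, x \in r -> M (f x)) -> M (\sum_(x <- r) f x).
  by move=> /clos [m0 mD _] h; rewrite big_seq; apply: big_ind.
have preim (M : set V) g : submodule M -> submodule [set v | M (act g v)].
  move=> /submoduleP [m0 mZ]; apply/submoduleP; split=> [|a u v Mu Mv] /=.
    by have -> : act g 0 = 0 by exact: Ind_eq.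
  by rewrite actL; exact: mZ.
have sM0 : submodule M0 by exact: mspan_submodule.
have M0B b v : upper_plus F n b -> M0 v -> M0 (act b v).
  move=> ub; apply: (mspan_min (preim M0 b sM0)) => _ [b' [w [ub' Fw ->]]] /=.
  rewrite -[act b _]actM; apply: sub_mspan; exists (b * b')%g, w; split=> //.
  exact: (upper_plus_mul pi_unif kF).
have fixM0 v : U1_fixed kF v -> M0 v.
  move=> /fixE Fv; apply: sub_mspan; exists 1%g, v; split=> //; last by rewrite [act _ _]act1.
  by apply: upper_plus_unipotent; have [] := unipotent0_subgroup pi_unif kF n.
split; first split.
- exact/restr.
- by move=> _ [b [v [ub M0v ->]]]; exact: M0B.
- apply/seteqP; split=> // f _.
  have sN := (restr _).1 (mspan_submodule (translates (act : _ -> V_oK -> V_oK) (upper F n) M0)).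
  have [X [c [t ->]]] := Ind_generated pi_unif eP f.
  apply: sumM => // x _; have [_ _ NZ] := clos _ sN; apply: NZ.
  (* Decomposing the inverse of x t puts the Borel factor on the left: x t = b^-1 y^-1, with y^-1 e
     fixed by U1. *)
  have [y [b [Gy ub xE]]] := iwasawa pi_unif kF (x * t)^-1%g.
  apply: sub_mspan; exists b^-1%g, (act y^-1%g e); split; first exact: BV.
    apply: fixM0; apply: (act_e_fixed pi_unif eP); exact: (G0V _ Gy).
  by rewrite -[act b^-1%g _]actM -invgM -xE invgK.
move=> M' [/restr sM' M'B M'gen] M'M0; apply/seteqP; split=> //.
have [m0 mD mZ] := clos _ sM'.
have M'Bp b v : upper_plus F n b -> M' v -> M' (act b v).
  by move=> ub Mv; apply: M'B; exists b, v.
(* Asking for all large k, rather than for some k, makes the condition stable under sums. The f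
   satisfying it thus form a submodule, which contains B M' by [absorption], hence is all of V. *)
have ev f : exists k0, forall k, (k0 <= k)%N -> M' (act (level pi_unif n k) f).
  pose S : set V := [set f | exists k0, forall k, (k0 <= k)%N -> M' (act (level pi_unif n k) f)].
  suff : S f by [].
  have sS : @submodule _ V_oK S.
    apply/restr/submoduleP; split=> [|a u v [k1 h1] [k2 h2]].
      by exists 0%N => k _; have -> : act (level pi_unif n k) 0 = 0 by exact: Ind_eq.
    exists (k1 + k2)%N => k kk; rewrite actL; apply: mD.
      by apply: mZ; apply: h1; apply: leq_trans kk; exact: leq_addr.
    by apply: h2; apply: leq_trans kk; exact: leq_addl.
  apply: (mspan_min sS (S := translates (act : _ -> V_oK -> V_oK) (upper F n) M')).
    move=> _ [b [v [ub M'v ->]]]; have [k0 k0P] := absorption pi_unif kF ub.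
    by exists k0 => k kk; rewrite -[act _ _]actM; apply: M'Bp => //; exact: k0P.
  by rewrite M'gen.
have M'fix v : U1_fixed kF v -> M' v.
  have [X [XG XE]] := U1_fixed_expand pi_unif eP.
  (* V^U1 is spanned by finitely many translates x e, so a single k serves all of them. *)
  have [k kP] : exists k, forall x, x \in X -> M' (act (level pi_unif n k) (act x e)).
    have [k0 k0P] := choice (fun x => ev (act x e)).
    exists (\sum_(x <- X) k0 x)%N => x xX; apply: k0P.
    by rewrite (big_rem x) //= leq_addr.
  have [L LE] := level_chain n k.
  apply: (contraction_chain (pi_unif := pi_unif) eP (M := M') (L := L)) => //.
    by move=> u f Nu; apply: M'Bp; exact: upper_plus_unipotent.
  move=> w wU; rewrite (XE w wU).
  have -> : diag_pi pi_unif (fun j : 'I_n => (\sum_(i <- L) (j < i))%N) = level pi_unif n k.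
    by apply: eq_diag_pi => j; rewrite LE.
  rewrite [Ind_act _ _ _]act_sum; apply: sumM => // x xX.
  by rewrite act_scale; apply: mZ; exact: kP.
apply: (mspan_min sM') => _ [b [w [ub /fixE Fw ->]]].
by apply: M'Bp => //; exact: M'fix.
Qed.
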